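(* Let $\theta \in \mathbb{R}$ and let $X_1, X_2, \dots$ be i.i.d. real random variables with mean $\theta$ whose distribution lies in the domain of attraction of a Gaussian. Then for any $\lambda \in \mathbb{R}$ and any $\alpha \in [0,\infty)$, the sequence $(E_n^{\alpha}(\theta;\lambda))_{n \ge 1}$ is an asymptotic e-value, i.e. $E_n^{\alpha}(\theta;\lambda) \ge 0$ for all $n$ and $$\limsup_{n\to\infty} \mathbb{E}\big[E_n^{\alpha}(\theta;\lambda)\big] \le 1 .$$
   Context: Notation. For real $x$, $x_+ = \max\{0,x\}$ and $x_+^\alpha = (x_+)^\alpha$ for $\alpha>0$; for $\alpha = 0$, $x_+^0 := \mathbf{1}\{x \ge 0\}$. Let $S_n(\theta) = \sum_{i=1}^n (X_i-\theta)$, $V_n(\theta) = \big(\sum_{i=1}^n (X_i-\theta)^2\big)^{1/2}$ and $Z_n(\theta) = S_n(\theta)/V_n(\theta)$ (with $Z_n(\theta) := 0$ on the event $V_n(\theta)=0$). For $\lambda \in \mathbb{R}$ and $\alpha \in [0,\infty)$ define $$E_n^{\alpha}(\theta;\lambda) := \frac{(Z_n(\theta)-\lambda)_+^\alpha}{I_\alpha(\lambda)}, \qquad I_\alpha(\lambda) := \mathbb{E}\big[(Z-\lambda)_+^\alpha\big],$$ where $Z$ is a standard Gaussian random variable. Domain of attraction: the i.i.d. sequence $(X_n)$ (equivalently, its common distribution) lies in the domain of attraction of a Gaussian if there exist real sequences $(a_n)$ and $(b_n)$, with $a_n>0$, such that $\big(\sum_{i\le n} X_i - b_n\big)/a_n$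 converges in distribution to $N(0,1)$. Asymptotic e-value: for a set of distributions $\mathcal{P}$, a sequence of nonnegative random variables $(E_n)_{n\ge1}$ is an asymptotic e-value if $\limsup_{n\to\infty}\mathbb{E}_P[E_n] \le 1$ for all $P \in \mathcal{P}$; here $\mathcal{P}$ is the set of distributions with mean $\theta$ in the domain of attraction of a Gaussian, under which the $X_i$ are i.i.d. *)

(* Defs.v *)
From HB Require Import structures.
From mathcomp Require Export all_boot all_order all_algebra finmap.
From mathcomp Require Export all_classical all_reals all_analysis.

Set Implicit Arguments.
Unset Strict Implicit.
Unset Printing Implicit Defensive.

Import Order.TTheory GRing.Theory Num.Theory.
Import numFieldNormedType.Exports.

Local Open Scope classical_set_scope.
Local Open Scope ring_scope.

Section iid.
Context d (T : measurableType d) (R : realType) (P : probability T R).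

Definition mutually_independent (I : choiceType) (X : I -> {RV P >-> R}) :=
  forall (J : {fset I}) (A : I -> set R),
    (forall i, i \in J -> measurable (A i)) ->
    P (\bigcap_(i in [set` J]) (X i @^-1` A i)) =
    (\prod_(i <- J) P (X i @^-1` A i))%E.

Definition identically_distributed (I : Type) (X : I -> {RV P >-> R}) :=
  forall i j (A : set R), measurable A ->
    distribution P (X i) A = distribution P (X j) A.

Definition iid (X : nat -> {RV P >-> R}) :=
  mutually_independent X /\ identically_distributed X.

End iid.

Arguments mutually_independent {d T R} P {I} X.
Arguments identically_distributed {d T R} P {I} X.
Arguments iid {d T R} P X.

Section gaussian_attraction.
Context d (T : measurableType d) (R : realType) (P : probability T R).

Definition cvg_in_distribution (Y : nat -> T -> R)
    (mu : probability (measurableTypeR R) R) :=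
  forall f : R -> R, continuous f -> (exists M : R, forall x, `|f x| <= M) ->
    'E_P[f \o Y n]%E @[n --> \oo] --> 'E_mu[f]%E.

Definition in_gaussian_domain_of_attraction (X : nat -> {RV P >-> R}) :=
  exists a b : nat -> R, (forall n, 0 < a n) /\
    cvg_in_distribution
      (fun n w => (\sum_(i < n) X i w - b n) / a n) (normal_prob 0 1).

End gaussian_attraction.

Arguments cvg_in_distribution {d T R} P Y mu.
Arguments in_gaussian_domain_of_attraction {d T R} P X.

Section evalue.
Context d (T : measurableType d) (R : realType).
Implicit Types (X : nat -> {mfun T >-> R}) (theta lambda alpha : R) (n : nat).

(* [0 `^ 0 = 1] in the library, so the exponent 0 needs its own case to be the
   indicator of [0 <= x]. *)
Definition pos_powR (x alpha : R) : R :=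
  if alpha == 0 then (0 <= x)%R%:R else Num.max 0 x `^ alpha.

(* The sample X_1, ..., X_n is [X 0, ..., X n.-1]. *)
Definition centered_sum X theta n (w : T) : R := \sum_(i < n) (X i w - theta).

Definition root_sum_squares X theta n (w : T) : R :=
  Num.sqrt (\sum_(i < n) (X i w - theta) ^+ 2).

Definition self_normalized_sum X theta n (w : T) : R :=
  if root_sum_squares X theta n w == 0 then 0
  else centered_sum X theta n w / root_sum_squares X theta n w.

(* The moment is finite and positive, so neither [fine] nor the division below
   falls back on a default value. *)
Definition gaussian_pos_moment alpha lambda : R :=
  fine 'E_(normal_prob 0 1)[fun z : R => pos_powR (z - lambda) alpha]%E.

Definition self_normalized_evalue alpha X theta lambda n (w : T) : R :=
  pos_powR (self_normalized_sum X theta n w - lambda) alpha /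
  gaussian_pos_moment alpha lambda.

Definition asymptotic_evalue (PP : set (probability T R)) (E : nat -> T -> R) :=
  [/\ forall n, (0 < n)%N -> measurable_fun [set: T] (E n),
      forall n w, (0 < n)%N -> 0 <= E n w &
      forall P, PP P -> (limn_esup (fun n => 'E_P[E n]) <= 1)%E].

End evalue.

(* Main.v *)
Require Import Defs.
From mathcomp Require Import measurable_realfun ring lra.

(** Let [Y_i = X_i - theta], let [S], [V] and [Z = S / V] be the centered sum, the
    root of the sum of squares and the self-normalized sum of the first [n]
    observations, and let [f x = (x - lambda)_+ ^ alpha]. The theorem says that
    [limsup E f(Z)] is at most the Gaussian expectation of [f]. It follows from
    two facts: [Z] is asymptotically Gaussian, and [E exp |Z|] is bounded
    uniformly in [n]. The second fact makes [f(Z)] uniformly integrable, so [f]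
    may be truncated. As [f] is nondecreasing, its truncation lies below a
    continuous function that lies in turn below a slightly shifted truncation;
    this one-sided sandwich also covers the exponent 0, for which [f] jumps
    ([limsup_truncated_le], [limsup_expectation_le]).

    Asymptotic normality. The hypothesis is that [(S - c_n) / a_n] converges to
    a Gaussian for some [a_n] and [c_n]; it has to be shown that [V / a_n] tends
    to 1 and [c_n / a_n] to 0. Let [phi] be the characteristic function of
    [Y]. The squared modulus of the characteristic function of the sum forgets
    [c_n], so [|phi(t / a_n)| ^ (2 n)] tends to [exp(- t^2)]. Let
    [L(r) = E (1 - exp(- (r Y)^2))], a smooth truncated second moment. Averaging
    [1 - Re phi] over a Gaussian frequency turns the limit of the
    characteristic functions into [n L(t / a_n) --> t^2] ([cvg_laplace]). Since
    [E exp(- r^2 V^2) = (1 - L(r))^n], this is the convergence of [V / a_n] to 1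
    ([cvg_laplace_sum_squares]).

    The identity [L(sqrt 2 r) = 2 L(r) - E (1 - exp(- (r Y)^2))^2] combined with
    the limits of [n L] at two scales shows that the last expectation is
    [o(L(r))] ([truncated_moment_slow]): the truncated variance varies slowly.
    Karamata's argument then gives [r E (|Y| (1 - exp(- (r Y)^2))) = o(L(r))]
    ([truncated_mean_error_small]). Because [Y] has mean zero, this quantity
    controls the imaginary part of [phi], which is therefore negligible, and the
    centering [c_n / a_n] tends to 0 ([cvg_centering]).

    Exponential moment. The same estimate yields
    [E exp(+- r Y - 2 (r Y)^2) <= 1 - L(r) / 4] for small [r], hence a bound on
    [E exp(+- r S - 2 r^2 V^2)] by independence. To exchange the deterministic
    [r] for [1 / V], the range of [V] is peeled dyadically: where [r V] is of
    order one, [|Z| <= r |S|] and the compensator [2 r^2 V^2] is bounded. The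
    scales [r] contribute summable amounts because [L] shrinks geometrically
    along them ([exponential_moment_bounded]). *)

Set Implicit Arguments.
Unset Strict Implicit.
Unset Printing Implicit Defensive.

Import Order.TTheory GRing.Theory Num.Theory.
Import numFieldNormedType.Exports.

Local Open Scope classical_set_scope.
Local Open Scope ring_scope.

(** * Elementary inequalities *)

Section elementary_inequalities.
Context {R : realType}.
Implicit Types (x y r e : R).

(** A smooth stand-in for [min 1 (x ^+ 2)]. Unlike the usual truncation, its
    expectation is one minus a Laplace transform; the latter factorizes over
    independent sums and is reached from characteristic functions. *)
Definition satsq x : R := 1 - expR (- x ^+ 2).

Lemma expRN_le1 y : 0 <= y -> expR (- y) <= 1.
Proof. by move=> y0; rewrite expR_le1 oppr_le0. Qed.

Lemma expRN_mul_le1 y : 0 <= y -> expR (- y) * (1 + y) <= 1.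
Proof.
move=> y0; rewrite -[leRHS](expRxMexpNx_1 y) mulrC ler_wpM2r ?expR_ge0//.
exact: expR_ge1Dx.
Qed.

Lemma satsq_ge0 x : 0 <= satsq x.
Proof. by rewrite subr_ge0 expRN_le1 ?sqr_ge0. Qed.

Lemma satsq_le1 x : satsq x <= 1.
Proof. by rewrite lerBlDr lerDl expR_ge0. Qed.

Lemma satsq_le_sqr x : satsq x <= x ^+ 2.
Proof. by rewrite /satsq; have := expR_ge1Dx (- x ^+ 2); lra. Qed.

Lemma sqr_le_satsq x : x ^+ 2 <= satsq x * (1 + x ^+ 2).
Proof. by rewrite /satsq; have := expRN_mul_le1 (sqr_ge0 x); nra. Qed.

Lemma satsqN x : satsq (- x) = satsq x.
Proof. by rewrite /satsq sqrrN. Qed.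

Lemma le_satsqM r y x : 0 <= r -> r <= y -> satsq (r * x) <= satsq (y * x).
Proof.
move=> r0 ry; rewrite /satsq lerB// ler_expR lerN2 !exprMn ler_wpM2r ?sqr_ge0//.
by rewrite ler_pXn2r// nnegrE// (le_trans r0).
Qed.

(** Doubling the square loses exactly [satsq x ^+ 2]: comparing the two sides
    turns convergence at two scales into smallness of the quadratic term. *)
Lemma satsq_sqrt2 x : satsq (Num.sqrt 2 * x) = 2 * satsq x - satsq x ^+ 2.
Proof.
rewrite /satsq exprMn sqr_sqrtr//.
have -> : - (2 * x ^+ 2) = - x ^+ 2 + - x ^+ 2 by ring.
by rewrite expRD; ring.
Qed.

Lemma ler_norm_sin x : `|sin x| <= `|x|.
Proof.
wlog x0 : x / 0 <= x.
  move=> H; have [/H//|/ltW x0] := leP 0 x.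
  by rewrite -normrN -sinN -[leRHS]normrN H// oppr_ge0.
move: x0; rewrite le_eqVlt => /predU1P[<-|x0]; first by rewrite sin0 normr0.
have [|c _] := @MVT R sin cos 0 x x0 (fun x _ => is_derive_sin x).
  by apply: continuous_subspaceT => y; exact: continuous_sin.
by rewrite sin0 !subr0 => ->; rewrite normrM ler_piMl// cos_max.
Qed.

Lemma cosB1 x : 1 - cos x = 2 * sin (x / 2) ^+ 2.
Proof.
have {1}-> : x = (x / 2) *+ 2 by rewrite -mulr_natr; field.
by rewrite cos_mulr2n sin2cos2; ring.
Qed.

Lemma sqr_sin_le x : sin x ^+ 2 <= x ^+ 2.
Proof.
by rewrite -(real_normK (num_real (sin x))) -(real_normK (num_real x))
  ler_pXn2r ?nnegrE// ler_norm_sin.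
Qed.

Lemma onem_cos_ge0 x : 0 <= 1 - cos x.
Proof. by rewrite subr_ge0 cos_le1. Qed.

Lemma onem_cos_le2 x : 1 - cos x <= 2.
Proof. by have := cos_geN1 x; lra. Qed.

Lemma onem_cos_le x : 1 - cos x <= x ^+ 2 / 2.
Proof. by rewrite cosB1; have := sqr_sin_le (x / 2); nra. Qed.

Lemma sin_sub_id_le x : `|sin x - x| <= `|x| ^+ 3 / 2.
Proof.
wlog x0 : x / 0 <= x.
  move=> H; have [/H//|/ltW x0] := leP 0 x.
  have := H (- x); rewrite sinN normrN oppr_ge0 => /(_ x0).
  by rewrite (_ : - sin x - - x = - (sin x - x)) ?normrN; [|ring].
move: x0; rewrite le_eqVlt => /predU1P[<-|x0].
  by rewrite sin0 subr0 normr0 expr0n mul0r.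
have [|c /[!in_itv]/= /andP[c0 cx]] :=
    @MVT R sin cos 0 x x0 (fun x _ => is_derive_sin x).
  by apply: continuous_subspaceT => y; exact: continuous_sin.
rewrite sin0 !subr0 => ->; rewrite (_ : _ - x = - ((1 - cos c) * x)); last by ring.
rewrite normrN normrM (gtr0_norm x0) ger0_norm ?onem_cos_ge0//.
have := onem_cos_le c; have : c ^+ 2 <= x ^+ 2.
  by rewrite ler_pXn2r ?nnegrE ?ltW.
by rewrite !exprS expr0; nra.
Qed.

Lemma sin_sub_id_le2 x : `|sin x - x| <= 2 * `|x|.
Proof. by rewrite (le_trans (ler_normB _ _))//; have := ler_norm_sin x; lra. Qed.

(** Both the small and the large regime of [sin x - x] are captured by one
    bound: cubic near the origin, linear at infinity. *)
Lemma sin_sub_id_satsq x : `|sin x - x| <= 4 * (`|x| * satsq x).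
Proof.
have H := sqr_le_satsq x; have W := satsq_ge0 x.
have [x1|x1] := leP `|x| 1.
  apply: le_trans (sin_sub_id_le x) _.
  have X : x ^+ 2 = `|x| ^+ 2 by rewrite real_normK ?num_real.
  rewrite X in H; rewrite exprS.
  have : `|x| ^+ 2 <= 2 * satsq x.
    have : `|x| ^+ 2 <= 1 by rewrite expr_le1.
    by nra.
  by have : 0 <= `|x| by []; nra.
apply: le_trans (sin_sub_id_le2 x) _.
have : 1 / 2 <= satsq x.
  have : 1 <= x ^+ 2 by rewrite -(real_normK (num_real x)) expr_ge1 // ltW.
  nra.
by have : 0 <= `|x| by []; nra.
Qed.

(** The uniform domination of [1 - cos], integrable in [r] against a Gaussian. *)
Lemma onem_cos_satsq r x : 1 - cos (r * x) <= (r ^+ 2 / 2 + 2) * satsq x.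
Proof.
have x2 := sqr_ge0 x; have r2 := sqr_ge0 r.
have H := sqr_le_satsq x; have H1 := onem_cos_le (r * x).
have H2 := onem_cos_le2 (r * x); have H3 := onem_cos_ge0 (r * x).
rewrite exprMn in H1.
rewrite -(ler_pM2r (_ : 0 < 1 + x ^+ 2)); last by lra.
rewrite -mulrA (@le_trans _ _ ((r ^+ 2 / 2 + 2) * x ^+ 2))//; last by nra.
by nra.
Qed.

(** The increment is at most [expR (- (x ^+ 2 / 4)) * satsq x], and the
    exponential turns the factor [`|x|] into a multiple of the square root of
    [satsq x]. The arithmetic-geometric inequality trades the resulting power
    3 / 2 for the powers 1 and 2. *)
Lemma satsq_half_increment e x : 0 < e ->
  `|x| * (satsq x - satsq (x / 2)) <= e * satsq x + e^-1 * satsq x ^+ 2.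
Proof.
move=> e0; set w := satsq x; have w0 : 0 <= w := satsq_ge0 x.
have x2 := sqr_ge0 x.
pose y := x ^+ 2.
have -> : w - satsq (x / 2) = expR (- (y / 4)) - expR (- y).
  rewrite /w /satsq exprMn (_ : 2^-1 ^+ 2 = 4^-1 :> R); last by field.
  by rewrite -/y; ring.
set p := expR (- (y / 4)); have p0 : 0 <= p by exact: expR_ge0.
have p2 : p ^+ 2 * (1 + y / 2) <= 1.
  rewrite -expRM_natl (_ : 2%:R * _ = - (y / 2)); last by field.
  by apply: expRN_mul_le1; rewrite divr_ge0.
have pw : p - expR (- y) <= p * w.
  rewrite /w /satsq mulrBr mulr1 lerB// -[leRHS]mul1r -/y ler_wpM2r ?expR_ge0//.
  by rewrite expRN_le1 // divr_ge0.
have py : (`|x| * p) ^+ 2 <= 2 * w.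
  rewrite exprMn real_normK ?num_real// -/y.
  have := sqr_le_satsq x; rewrite -/w -/y => H.
  have : 0 <= p ^+ 2 by exact: sqr_ge0.
  have : 0 <= y by [].
  by nra.
have xp : 0 <= `|x| * p by rewrite mulr_ge0.
apply: (@le_trans _ _ (`|x| * p * w)).
  by rewrite -mulrA ler_wpM2l.
have -> : e * w + e^-1 * w ^+ 2 = (e + e^-1 * w) * w by ring.
rewrite ler_wpM2r//.
have ew : 0 <= e + e^-1 * w.
  by rewrite addr_ge0 ?mulr_ge0// ?invr_ge0 ltW.
rewrite -(@ler_pXn2r _ 2)// ?nnegrE//; apply: le_trans py _.
have -> : (e + e^-1 * w) ^+ 2 = (e - e^-1 * w) ^+ 2 + 4 * w.
  by field; rewrite gt_eqF.
by have := sqr_ge0 (e - e^-1 * w); lra.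
Qed.

(** Compensating by [2 * x ^+ 2], more than the [x ^+ 2 / 2] that would cancel
    the second order term, leaves a strictly negative quadratic term near 0. The
    last summand only serves the region [x < - 1 / 6], where [satsq x] is bounded
    below, and the constant 150 makes the right-hand side exceed 1 there. *)
Lemma expR_drift_le x :
  expR (x - 2 * x ^+ 2) <= 1 + x - satsq x / 2 + 150 * (`|x| * satsq x).
Proof.
have w0 := satsq_ge0 x; have w1 := satsq_le1 x; have wx := satsq_le_sqr x.
have H := sqr_le_satsq x.
have D0 : 0 < 1 - x + 2 * x ^+ 2.
  by have := sqr_ge0 (x - 1 / 4); nra.
have E : expR (x - 2 * x ^+ 2) * (1 - x + 2 * x ^+ 2) <= 1.
  rewrite -[leRHS](expRxMexpNx_1 (x - 2 * x ^+ 2)) ler_wpM2l ?expR_ge0//.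
  by have := expR_ge1Dx (- (x - 2 * x ^+ 2)); lra.
have E0 := expR_ge0 (x - 2 * x ^+ 2).
have [x1|x1] := leP 1 x.
  have : expR (x - 2 * x ^+ 2) <= 1 by rewrite expR_le1; nra.
  have : 0 <= `|x| * satsq x by rewrite mulr_ge0.
  lra.
have [x2|x2] := leP (- (1 / 6)) x.
  have : expR (x - 2 * x ^+ 2) <= 1 + x - x ^+ 2 / 2.
    rewrite -(ler_pM2r D0); apply: le_trans E _.
    have -> : (1 + x - x ^+ 2 / 2) * (1 - x + 2 * x ^+ 2) =
      1 + x ^+ 2 * (1 / 2 + 5 / 2 * x - x ^+ 2) by field.
    by rewrite lerDl mulr_ge0 ?sqr_ge0//; nra.
  have : 0 <= `|x| * satsq x by rewrite mulr_ge0.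
  lra.
have : expR (x - 2 * x ^+ 2) <= 1 by rewrite expR_le1; nra.
rewrite ltr0_norm; last by lra.
have : 1 / 37 <= satsq x by nra.
nra.
Qed.

End elementary_inequalities.

(** * Measurability and integration of real functions *)

Section measurability.
Context d (T : measurableType d) (R : realType).
Implicit Types f g : T -> R.

Lemma measurable_cos_fun f : measurable_fun setT f ->
  measurable_fun setT (fun w => cos (f w)).
Proof.
apply: measurableT_comp; apply: continuous_measurable_fun.
exact: continuous_cos.
Qed.

Lemma measurable_sin_fun f : measurable_fun setT f ->
  measurable_fun setT (fun w => sin (f w)).
Proof.
apply: measurableT_comp; apply: continuous_measurable_fun.
exact: continuous_sin.
Qed.

Lemma measurable_expR_fun f : measurable_fun setT f ->
  measurable_fun setT (fun w => expR (f w)).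
Proof. by apply: measurableT_comp; exact: measurable_expR. Qed.

Lemma measurable_norm_fun f : measurable_fun setT f ->
  measurable_fun setT (fun w => `|f w|).
Proof. by move=> mf; exact: measurableT_comp. Qed.

Lemma measurable_satsq_fun f : measurable_fun setT f ->
  measurable_fun setT (fun w => satsq (f w)).
Proof.
move=> mf; rewrite /satsq; apply: measurable_funB => //.
by apply: measurable_expR_fun; apply: measurable_funN; exact: measurable_funX.
Qed.

Lemma measurable_scale_fun (r : R) f : measurable_fun setT f ->
  measurable_fun setT (fun w => r * f w).
Proof. by move=> mf; exact: measurable_funM. Qed.

End measurability.

Ltac meas := repeat first
  [ exact: measurable_cst | assumption
  | apply: measurable_scale_fun | apply: measurable_satsq_fun
  | apply: measurable_cos_fun | apply: measurable_sin_fun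
  | apply: measurable_expR_fun | apply: measurable_norm_fun
  | apply: measurable_funD | apply: measurable_funB
  | apply: measurable_funN | apply: measurable_funM | apply: measurable_funX ].

Section integral_tools.
Context d (T : measurableType d) (R : realType) (mu : {measure set T -> \bar R}).
Implicit Types (f g : T -> R).

Local Notation intg f := (mu.-integrable setT (EFin \o f)).

Lemma integrable_measurable f : intg f -> measurable_fun setT f.
Proof. by move=> /integrableP[/measurable_EFinP]. Qed.

Lemma integrable_dominated f g : measurable_fun setT f -> intg g ->
  (forall w, `|f w| <= g w) -> intg f.
Proof.
move=> mf ig fg; apply: le_integrable ig => //; first exact/measurable_EFinP.
by move=> w _ /=; rewrite lee_fin (le_trans (fg w))// ler_norm.
Qed.

Lemma integrable_scale r f : intg f -> intg (fun w => r * f w).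
Proof.
move=> fi; rewrite (_ : EFin \o _ = (fun w => r%:E * (EFin \o f) w)%E) //.
exact: integrableZl.
Qed.

Lemma integrable_scaler r f : intg f -> intg (fun w => f w * r).
Proof.
move=> /(integrable_scale r); congr (_.-integrable _ _).
by apply/funext => w /=; rewrite mulrC.
Qed.

Lemma integrable_add f g : intg f -> intg g -> intg (fun w => f w + g w).
Proof.
move=> fi gi.
rewrite (_ : EFin \o _ = (fun w => (EFin \o f) w + (EFin \o g) w)%E) //.
exact: integrableD.
Qed.

Lemma integrable_sub f g : intg f -> intg g -> intg (fun w => f w - g w).
Proof.
move=> fi gi.
rewrite (_ : EFin \o _ = (fun w => (EFin \o f) w - (EFin \o g) w)%E) //.
exact: integrableB.
Qed.

Lemma integrable_sum_ord n (F : nat -> T -> R) : (forall i, intg (F i)) ->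
  intg (fun w => \sum_(i < n) F i w).
Proof.
move=> iF; elim: n => [|n IH].
  under eq_fun do rewrite big_ord0.
  by rewrite (_ : EFin \o _ = cst 0%E)//; exact: integrable0.
by under eq_fun do rewrite big_ord_recr /=; exact: integrable_add.
Qed.

Lemma Rintegral_sum_ord n (F : nat -> T -> R) : (forall i, intg (F i)) ->
  \int[mu]_w (\sum_(i < n) F i w) = \sum_(i < n) \int[mu]_w F i w.
Proof.
move=> iF; elim: n => [|n IH].
  rewrite big_ord0; under eq_Rintegral do rewrite big_ord0.
  by rewrite /Rintegral integral0.
under eq_Rintegral do rewrite big_ord_recr /=.
by rewrite RintegralD// ?IH ?big_ord_recr//; exact: integrable_sum_ord.
Qed.

Lemma EFin_Rintegral f : intg f -> (\int[mu]_w (f w)%:E)%E = (\int[mu]_w f w)%:E.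
Proof. by move=> fi; rewrite /Rintegral fineK//; exact: integrable_fin_num. Qed.

Lemma le_RintegralT f g : intg f -> intg g -> (forall w, f w <= g w) ->
  \int[mu]_w f w <= \int[mu]_w g w.
Proof. by move=> fi gi fg; exact: le_Rintegral. Qed.

Lemma norm_RintegralT_le f g : intg g -> measurable_fun setT f ->
  (forall w, `|f w| <= g w) ->
  `|\int[mu]_w f w| <= \int[mu]_w g w.
Proof.
move=> gi mf fg; have fi := integrable_dominated mf gi fg.
apply: le_trans (le_normr_Rintegral _ _) _ => //.
apply: le_RintegralT => //.
by apply: integrable_dominated gi _ => // [|w]; [meas|rewrite normr_id].
Qed.

Lemma RintegralT_dct (f_ : nat -> T -> R) f g :
  (forall n, measurable_fun setT (f_ n)) -> intg g ->
  (forall n w, `|f_ n w| <= g w) ->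
  (forall w, f_ n w @[n --> \oo] --> f w) ->
  \int[mu]_w f_ n w @[n --> \oo] --> \int[mu]_w f w.
Proof.
move=> mf ig fg ff.
have mff : measurable_fun setT f by apply: (measurable_fun_cvg mf) => w _.
have [] := @dominated_convergence _ _ _ mu setT measurableT
  (fun n => EFin \o f_ n) (EFin \o f) (EFin \o g).
- by move=> n; exact/measurable_EFinP.
- exact/measurable_EFinP.
- by apply: aeW => w _; apply: cvg_EFin; [exact: nearW|exact: ff].
- exact: ig.
- by apply: aeW => w n _; rewrite lee_fin.
by move=> fi _; rewrite [X in _ --> X](EFin_Rintegral fi) => /fine_cvg.
Qed.

End integral_tools.

Section expectation_tools.
Context d (T : measurableType d) (R : realType) (P : probability T R).
Implicit Types (f g : T -> R) (Y : T -> R).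

Local Notation intg f := (P.-integrable setT (EFin \o f)).

Lemma integrable_bounded M f : measurable_fun setT f ->
  (forall w, `|f w| <= M) -> intg f.
Proof.
move=> mf fM; apply: measurable_bounded_integrable => //.
  by rewrite (le_lt_trans (probability_le1 P measurableT)) ?ltry.
exists M; split; first exact: num_real.
by move=> N MN w _ /=; exact: le_trans (fM w) (ltW MN).
Qed.

Lemma RintegralT_cst (c : R) : \int[P]_w c = c.
Proof. by rewrite Rintegral_cst//= probability_setT mulr1. Qed.

Lemma integrable_cst (c : R) : intg (fun=> c).
Proof. exact: (@integrable_bounded `|c|). Qed.

Lemma EFin_expectation f : intg f -> 'E_P[f]%E = (\int[P]_w f w)%:E.
Proof. by move=> fi; rewrite unlock EFin_Rintegral. Qed.

Lemma RintegralT_bct M (f_ : nat -> T -> R) f :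
  (forall n, measurable_fun setT (f_ n)) ->
  (forall n w, `|f_ n w| <= M) ->
  (forall w, f_ n w @[n --> \oo] --> f w) ->
  \int[P]_w f_ n w @[n --> \oo] --> \int[P]_w f w.
Proof.
by move=> mf fM; exact: (RintegralT_dct mf (integrable_cst M) fM).
Qed.

End expectation_tools.

(** * Induction on bounded measurable functions *)

Section bounded_measurable_induction.
Context d (T : measurableType d) (R : realType).

(** The layer-cake sum counts the integers between 1 and [y], that is, it is
    the integer part of [y]. *)
Lemma layer_sum_approx (k : nat) (y : R) : 0 <= y -> y <= k%:R ->
  0 <= y - \sum_(j < k) (j.+1%:R <= y)%R%:R <= 1.
Proof.
elim: k y => [|k IH] y y0 yk.
  by rewrite big_ord0 subr0 y0 (le_trans yk).
rewrite big_ord_recr /=; have [yk'|ky] := leP y k%:R.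
  have -> : (k.+1%:R <= y) = false.
    by apply/negbTE; rewrite -ltNge (le_lt_trans yk')// ltr_nat.
  by rewrite addr0 IH.
under eq_bigr => i _.
  rewrite (_ : (i.+1%:R <= y)) /=; last first.
    by rewrite (le_trans _ (ltW ky))// ler_nat.
  over.
rewrite sumr_const card_ord.
have Sk : k.+1%:R = k%:R + 1 :> R by rewrite natr1.
rewrite Sk in yk *; have [H|H] := leP (k%:R + 1) y; rewrite ?mulr1n ?mulr0n; lra.
Qed.

(** [f] is a uniform limit of combinations of indicators of its level sets, so
    linearity and bounded limits reduce every such [K] to indicators. *)
Lemma bounded_measurable_ind (K : (T -> R) -> Prop) :
  (forall A, measurable A -> K \1_A) ->
  (forall a f g, K f -> K g -> K (fun w => f w + a * g w)) ->
  (forall (M : R) (f_ : nat -> T -> R) (f : T -> R), (forall n w, `|f_ n w| <= M) ->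
    (forall w, f_ n w @[n --> \oo] --> f w) -> (forall n, K (f_ n)) -> K f) ->
  forall (M : R) (f : T -> R), measurable_fun setT f ->
    (forall w, `|f w| <= M) -> K f.
Proof.
move=> K1 Klin Klim M0 f mf fM0.
(* The added 1 makes the division by [2 * M] legitimate when [M0] is 0. *)
pose M := `|M0| + 1; have M_gt0 : 0 < M by rewrite ltr_wpDl.
have fM w : `|f w| <= M.
  by rewrite (le_trans (fM0 w))// (le_trans (ler_norm _))// lerDl.
pose y k w := k%:R * ((f w + M) / (2 * M)).
have y01 k w : 0 <= y k w /\ y k w <= k%:R.
  have : - M <= f w <= M by rewrite -ler_norml.
  move=> /andP[f1 f2]; split; rewrite /y.
    by rewrite mulr_ge0// divr_ge0//; lra.
  by rewrite ler_piMr// ler_pdivrMr; lra.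
pose A k j := [set w | j.+1%:R <= y k w].
have mA k j : measurable (A k j).
  have my : measurable_fun setT (y k).
    rewrite /y; apply: measurable_scale_fun; apply: measurable_funM => //.
    exact: measurable_funD.
  have := measurable_fun_ler (measurable_cst (j.+1%:R : R)) my.
  move=> /(_ measurableT [set true] I); rewrite setTI.
  by congr measurable; apply/seteqP; split => w /=.
pose f_ k w := \sum_(j < k) (2 * M / k%:R) * \1_(A k j) w + - M * \1_setT w.
have f_E k w : f_ k w = 2 * M / k%:R * \sum_(j < k) (j.+1%:R <= y k w)%R%:R - M.
  rewrite /f_ indicT mulr1 -mulr_sumr; congr (_ * _ + _).
  apply: eq_bigr => j _; rewrite indicE; congr (_%:R); congr nat_of_bool.
  by apply/idP/idP => [/set_mem//|?]; apply/mem_set.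
have err k w : (0 < k)%N -> `|f_ k w - f w| <= 2 * M / k%:R.
  move=> k0; have kR : 0 < k%:R :> R by rewrite ltr0n.
  have [y0 yk] := y01 k w; have := layer_sum_approx y0 yk.
  set S := \sum_(_ < _) _ => S01; rewrite f_E -/S.
  have -> : 2 * M / k%:R * S - M - f w = - (2 * M / k%:R * (y k w - S)).
    by rewrite /y; field; rewrite !gt_eqF.
  have c0 : 0 <= 2 * M / k%:R by rewrite divr_ge0// mulr_ge0// ltW.
  rewrite normrN normrM ger0_norm//; case/andP: S01 => S0 S1.
  by rewrite ger0_norm// ler_piMr.
have err_cvg : 2 * M / k%:R @[k --> \oo] --> (0 : R).
  rewrite -[X in _ --> X](mulr0 (2 * M)).
  apply: cvgM; first exact: cvg_cst.
  apply/gtr0_cvgV0; last exact: cvgr_idn.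
  by near=> n; rewrite ltr0n; near: n; exact: nbhs_infty_gt.
apply: (Klim (3 * M) f_).
- move=> [|k] w; first by rewrite f_E big_ord0 mulr0 sub0r normrN ger0_norm; lra.
  have := err k.+1 w isT; have : 2 * M / k.+1%:R <= 2 * M.
    by rewrite ler_pdivrMr// ler_peMr ?ler1n//; lra.
  have := fM w; have := ler_normD (f_ k.+1 w - f w) (f w).
  rewrite subrK => H1 H2 H3 H4; apply: (le_trans H1).
  rewrite (_ : 3 * M = 2 * M + M); last by ring.
  by rewrite lerD// (le_trans H4).
- move=> w; apply/subr_cvg0; apply: norm_cvg0.
  apply: (@squeeze_cvgr _ _ _ _ (cst 0) (fun k => 2 * M / k%:R)) => //.
    by near=> k; rewrite normr_ge0/= err//; near: k; exact: nbhs_infty_gt.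
  exact: cvg_cst.
- move=> k; apply: (Klin (- M)); last exact: K1.
  have K0 : K (fun=> 0).
    have := Klin (-1) _ _ (K1 _ (@measurableT _ T)) (K1 _ (@measurableT _ T)).
    by under eq_fun do rewrite indicT mulr1 subrr.
  have : forall m, K (fun w => \sum_(j < m) (2 * M / k%:R) * \1_(A k j) w).
    elim=> [|m IH]; first by under eq_fun do rewrite big_ord0.
    under eq_fun do rewrite big_ord_recr /=.
    by apply: (Klin _ _ _ IH); exact: K1.
  exact.
Unshelve. all: by end_near. Qed.

End bounded_measurable_induction.

(** * The characteristic function of the Gaussian *)

Section gaussian.
Context {R : realType}.
Local Notation mu := (@lebesgue_measure R).
Local Notation gamma := (normal_prob (0 : R) 1).
Local Notation pdf := (normal_pdf (0 : R) 1).

Lemma Rintegral_normal_prob (M : R) (f : R -> R) : measurable_fun setT f ->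
  (forall x, `|f x| <= M) ->
  \int[gamma]_x f x = \int[mu]_x (f x * pdf x).
Proof.
have ipdf : mu.-integrable setT (EFin \o pdf) by exact: integrable_normal_pdf.
have ifpdf (N : R) (g : R -> R) : measurable_fun setT g -> (forall x, `|g x| <= N) ->
    mu.-integrable setT (EFin \o (fun x => g x * pdf x)).
  move=> mg gN; have iN : mu.-integrable setT (EFin \o (fun x => N * pdf x)).
    exact: integrable_scale.
  apply: le_integrable iN => //.
    by apply/measurable_EFinP; apply: measurable_funM => //; exact: measurable_normal_pdf.
  move=> x _ /=; rewrite lee_fin !normrM ler_wpM2r//.
  by rewrite (le_trans (gN x))// ler_norm.
move=> mf fM.
pose K (g : R -> R) := [/\ measurable_fun setT g, exists N : R, forall x, `|g x| <= N &
  \int[gamma]_x g x = \int[mu]_x (g x * pdf x)].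
suff [] : K f by [].
apply: (bounded_measurable_ind _ _ _ mf fM).
- move=> A mA; split.
  + exact: measurable_indic.
  + by exists 1 => x; rewrite indicE; case: (x \in A); rewrite ?normr1 ?normr0.
  + rewrite /Rintegral integral_indic// setIT; congr fine.
    transitivity (\int[mu]_(x in A) (pdf x)%:E)%E; first by [].
    rewrite [LHS]integral_mkcond; apply: eq_integral => x _.
    by rewrite /patch indicE; case: (x \in A); rewrite ?mul1r ?mul0r.
- move=> a g h [mg [Ng gN] Kg] [mh [Nh hN] Kh]; split.
  + by meas.
  + exists (Ng + `|a| * Nh) => x; rewrite (le_trans (ler_normD _ _))// lerD//.
    by rewrite normrM ler_wpM2l.
  + have ig := integrable_bounded gamma mg gN.
    have ih := integrable_bounded gamma mh hN.
    rewrite RintegralD//; last exact: integrable_scale.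
    rewrite RintegralZl// Kg Kh.
    under [RHS]eq_Rintegral do rewrite mulrDl -mulrA.
    rewrite RintegralD//; [|exact: ifpdf gN|]; last first.
      by apply: integrable_scale; exact: ifpdf hN.
    by rewrite RintegralZl//; exact: ifpdf hN.
- move=> N g_ g gN gg Kg; have mg_ n : measurable_fun setT (g_ n) by case: (Kg n).
  have mg : measurable_fun setT g by apply: (measurable_fun_cvg mg_) => x _.
  have gN' x : `|g x| <= N.
    have H : `|g_ n x| @[n --> \oo] --> `|g x| by apply: cvg_norm; exact: gg.
    rewrite -(cvg_lim _ H)//; apply: limr_le; first by apply/cvg_ex; eexists; exact: H.
    by apply: nearW => n.
  split => //; first by exists N.
  have l1 : \int[gamma]_x g_ n x @[n --> \oo] --> \int[gamma]_x g x.
    refine (RintegralT_bct (P := gamma) mg_ gN gg).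
  have l2 : \int[mu]_x (g_ n x * pdf x) @[n --> \oo] --> \int[mu]_x (g x * pdf x).
    apply: (@RintegralT_dct _ _ _ mu (fun n x => g_ n x * pdf x) _ (fun x => N * pdf x)).
    + by move=> n; refine (measurable_funM (mg_ n) (measurable_normal_pdf _ _)).
    + exact: integrable_scale.
    + by move=> n x; rewrite normrM (ger0_norm (normal_pdf_ge0 _ _ _)) ler_wpM2r// normal_pdf_ge0.
    + by move=> x; apply: cvgM => //; exact: cvg_cst.
  have E : (fun n => \int[gamma]_x g_ n x) = (fun n => \int[mu]_x (g_ n x * pdf x)).
    by apply/funext => n; case: (Kg n).
  by rewrite E in l1; exact: (cvg_unique _ l1 l2).
Qed.

End gaussian.

Section gaussian_characteristic_function.
Context {R : realType}.
Local Notation mu := (@lebesgue_measure R).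
Local Notation gamma := (normal_prob (0 : R) 1).
Local Notation pdf := (normal_pdf (0 : R) 1).

Lemma normal_pdf01E x : pdf x = normal_peak 1 * expR (- x ^+ 2 / 2).
Proof. by rewrite normal_pdfE ?oner_neq0// /normal_fun subr0 expr1n. Qed.

Lemma is_derive_normal_pdf01 (x : R) : is_derive x 1 pdf (- x * pdf x).
Proof.
have -> : pdf = fun x => normal_peak 1 * expR (- x ^+ 2 / 2).
  by apply/funext => y; exact: normal_pdf01E.
apply: trigger_derive => /=.
by rewrite /GRing.scale /= mulr0 mulr0; field.
Qed.

(** The factor [`|x|] is absorbed by passing to the density of variance 2. *)
Lemma integrable_id_normal_pdf :
  mu.-integrable setT (EFin \o (fun x : R => `|x| * pdf x)).
Proof.
have i2 : mu.-integrable setT (EFin \o normal_pdf (0 : R) (Num.sqrt 2)).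
  exact: integrable_normal_pdf.
pose c := normal_peak 1 / normal_peak (Num.sqrt 2) : R.
have i3 : mu.-integrable setT (EFin \o (fun x => c * normal_pdf (0 : R) (Num.sqrt 2) x)).
  exact: integrable_scale.
apply: (integrable_dominated _ i3).
  by apply: measurable_funM; [meas|exact: measurable_normal_pdf].
move=> x; rewrite ger0_norm ?mulr_ge0 ?normal_pdf_ge0//.
rewrite normal_pdf01E normal_pdfE; last by rewrite gt_eqF// sqrtr_gt0.
rewrite /c /normal_fun subr0 sqr_sqrtr//.
rewrite [leRHS]mulrA divfK; last by rewrite gt_eqF// normal_peak_gt0// gt_eqF// sqrtr_gt0.
rewrite mulrCA ler_wpM2l ?normal_peak_ge0//.
have -> : - x ^+ 2 / (2 *+ 2) = - (x ^+ 2 / 4).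
  by rewrite -mulr_natr; field.
have -> : - x ^+ 2 / 2 = - (x ^+ 2 / 4) + - (x ^+ 2 / 4) by field.
rewrite expRD mulrA -[leRHS]mul1r ler_wpM2r ?expR_ge0//.
rewrite -[leRHS](expRxMexpNx_1 (x ^+ 2 / 4)) ler_wpM2r ?expR_ge0//.
apply: le_trans (expR_ge1Dx _).
rewrite -(real_normK (num_real x)); have := sqr_ge0 (`|x| / 2 - 1); lra.
Qed.

Lemma cvg_scale_invn (c : R) : c / n%:R @[n --> \oo] --> 0.
Proof.
rewrite -[X in _ --> X](mulr0 c); apply: cvgM; first exact: cvg_cst.
apply/gtr0_cvgV0; last exact: cvgr_idn.
by near=> n; rewrite ltr0n; near: n; exact: nbhs_infty_gt.
Unshelve. all: by end_near. Qed.

Lemma normal_pdf01_le (n : nat) : (0 < n)%N -> pdf n%:R <= normal_peak 1 * 2 / n%:R.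
Proof.
move=> n0; rewrite normal_pdf01E -mulrA ler_wpM2l ?normal_peak_ge0//.
have n1 : 1 <= n%:R :> R by rewrite ler1n.
rewrite ler_pdivlMr ?ltr0n// mulNr.
have := @expRN_mul_le1 R (n%:R ^+ 2 / 2); have := expR_ge0 (- (n%:R ^+ 2 / 2) : R).
rewrite expr2; set e := expR _; set m := (n%:R : R) in n1 * => e0.
have m2 : 0 <= m * m / 2 by nra.
move=> /(_ m2) H; nra.
Qed.

Lemma cvg_normal_pdf01 : pdf n%:R @[n --> \oo] --> 0.
Proof.
apply: (@squeeze_cvgr _ _ _ _ (cst 0) (fun n => normal_peak 1 * 2 / n%:R)).
- by near=> n; rewrite normal_pdf_ge0 normal_pdf01_le//; near: n; exact: nbhs_infty_gt.
- exact: cvg_cst.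
- exact: cvg_scale_invn.
Unshelve. all: by end_near. Qed.

(** The integrand is the derivative of [sin (t * x + c) * pdf x], which vanishes
    at both infinities. The phase [c] treats cosine and sine at once. *)
Lemma gaussian_ibp (t c : R) :
  \int[mu]_x (t * cos (t * x + c) * pdf x - sin (t * x + c) * (x * pdf x)) = 0.
Proof.
pose h x := t * cos (t * x + c) * pdf x - sin (t * x + c) * (x * pdf x).
pose H x := sin (t * x + c) * pdf x.
have dH (x : R) : is_derive x 1 H (h x).
  have := is_derive_normal_pdf01 x; rewrite /H /h => ?.
  apply: trigger_derive; rewrite /GRing.scale /=; ring.
have ch : continuous h.
  move=> x; apply: differentiable_continuous; apply/derivable1_diffP.
  by have ? := is_derive_normal_pdf01 x; rewrite /h; exact: ex_derive.
have cH : continuous H.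
  move=> x; apply: differentiable_continuous; apply/derivable1_diffP.
  exact: (@ex_derive _ _ _ _ _ _ _ (dH x)).
have mh : measurable_fun setT h by exact: continuous_measurable_fun.
pose g x := `|t| * pdf x + `|x| * pdf x.
have ig : mu.-integrable setT (EFin \o g).
  apply: integrable_add; last exact: integrable_id_normal_pdf.
  by apply: integrable_scale; exact: integrable_normal_pdf.
have hg x : `|h x| <= g x.
  rewrite /h /g (le_trans (ler_normB _ _))// !normrM.
  rewrite (ger0_norm (normal_pdf_ge0 _ _ _)) lerD// ?ler_wpM2r ?normal_pdf_ge0//.
    by rewrite ler_piMr// cos_max.
  by rewrite ler_piMl ?mulr_ge0 ?normal_pdf_ge0// sin_max.
have E (n : nat) : (0 < n)%N ->
    \int[mu]_(x in `[- n%:R, n%:R]) h x = H n%:R - H (- n%:R).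
  move=> n0; rewrite /Rintegral (@continuous_FTC2 _ h H)//.
  - by rewrite gtrN// ltr0n.
  - exact: continuous_subspaceT.
  - split.
    + by move=> x _; exact: (@ex_derive _ _ _ _ _ _ _ (dH x)).
    + by apply: cvg_at_right_filter; exact: cH.
    + by apply: cvg_at_left_filter; exact: cH.
  - by move=> x _; rewrite derive1E derive_val.
have l1 : \int[mu]_(x in `[- n%:R, n%:R]) h x @[n --> \oo] --> \int[mu]_x h x.
  under eq_fun do rewrite Rintegral_mkcond.
  apply: (@RintegralT_dct _ _ _ mu _ _ g) => //.
  - by move=> n; apply/(measurable_restrictT h) => //; exact: measurable_funTS.
  - move=> n x; rewrite /patch; case: ifPn => // _.
    by rewrite normr0 (le_trans _ (hg x)).
  - move=> x; apply: cvg_near_cst; near=> n; rewrite patchT// inE/= in_itv/= -ler_norml.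
    by near: n; exact: nbhs_infty_ger.
have l2 : H n%:R - H (- n%:R) @[n --> \oo] --> (0 : R).
  apply: norm_cvg0; apply: (@squeeze_cvgr _ _ _ _ (cst 0) (fun n => 2 * pdf n%:R)).
  - apply: nearW => n; rewrite normr_ge0/= (le_trans (ler_normB _ _))//.
    have N y : `|H y| <= pdf y.
      by rewrite /H normrM (ger0_norm (normal_pdf_ge0 _ _ _)) ler_piMl ?normal_pdf_ge0// sin_max.
    have := N n%:R; have := N (- n%:R); rewrite !normal_pdf01E sqrrN; lra.
  - exact: cvg_cst.
  - by rewrite -[X in _ --> X](mulr0 2); apply: cvgM; [exact: cvg_cst|exact: cvg_normal_pdf01].
apply: (cvg_unique _ l1) => //.
apply: cvg_trans l2; apply: near_eq_cvg; near=> n; rewrite E//.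
by near: n; exact: nbhs_infty_gt.
Unshelve. all: by end_near. Qed.

Let F (c t : R) := \int[mu]_x (cos (t * x + c) * pdf x).

Let integrable_cos_pdf c t :
  mu.-integrable setT (EFin \o (fun x : R => cos (t * x + c) * pdf x)).
Proof.
apply: (@integrable_dominated _ _ _ mu _ pdf).
- by apply: measurable_funM; [meas|exact: measurable_normal_pdf].
- exact: integrable_normal_pdf.
- move=> x; rewrite normrM (ger0_norm (normal_pdf_ge0 _ _ _)).
  by rewrite ler_piMl ?normal_pdf_ge0// cos_max.
Qed.

Let integrable_sin_pdf c t :
  mu.-integrable setT (EFin \o (fun x : R => sin (t * x + c) * (x * pdf x))).
Proof.
apply: (@integrable_dominated _ _ _ mu _ (fun x => `|x| * pdf x)).
- by apply: measurable_funM; [meas|apply: measurable_funM; [meas|exact: measurable_normal_pdf]].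
- exact: integrable_id_normal_pdf.
- move=> x; rewrite !normrM (ger0_norm (normal_pdf_ge0 _ _ _)).
  by rewrite ler_piMl ?mulr_ge0 ?normal_pdf_ge0// sin_max.
Qed.

(** Differentiating under the integral produces the term that the integration
    by parts converts back into [F]: the ODE [F' = - t F]. *)
Let is_derive_F (c t : R) : is_derive t 1 (F c) (- t * F c t).
Proof.
pose f (u x : R) := cos (u * x + c) * pdf x.
have df (u x : R) : is_derive u 1 (f ^~ x) (- (sin (u * x + c) * (x * pdf x))).
  rewrite /f; apply: trigger_derive; rewrite /GRing.scale /=; ring.
have d1f u x : partial1of2 f u x = - (sin (u * x + c) * (x * pdf x)).
  by rewrite partial1of2E derive_val.
have It : (`]t - 1, t + 1[%classic : set R) t.
  by rewrite /= in_itv/= ltrBlDr ltrDl ltr01.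
have intf x : (`]t - 1, t + 1[%classic : set R) x ->
    mu.-integrable setT (EFin \o f x).
  by move=> _; exact: integrable_cos_pdf.
have derf (x y : R) : (`]t - 1, t + 1[%classic : set R) x -> setT y ->
    derivable (f ^~ y) x 1.
  by move=> _ _; exact: (@ex_derive _ _ _ _ _ _ _ (df x y)).
have G0 (y : R) : 0 <= `|y| * pdf y by rewrite mulr_ge0 ?normal_pdf_ge0.
have Gub (x y : R) : (`]t - 1, t + 1[%classic : set R) x -> setT y ->
    `|partial1of2 f x y| <= `|y| * pdf y.
  move=> _ _; rewrite d1f normrN !normrM (ger0_norm (normal_pdf_ge0 _ _ _)).
  by rewrite ler_piMl ?mulr_ge0 ?normal_pdf_ge0// sin_max.
apply: DeriveDef.
  exact: (derivable_under_integral measurableT It intf derf G0 integrable_id_normal_pdf Gub).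
rewrite -derive1E.
rewrite (differentiation_under_integral measurableT It intf derf G0 integrable_id_normal_pdf Gub).
have := gaussian_ibp t c.
under eq_Rintegral do rewrite -mulrA.
rewrite RintegralB//; last exact: (integrable_scale t (integrable_cos_pdf c t)).
rewrite RintegralZl//.
move=> /eqP; rewrite subr_eq0 => /eqP H.
rewrite mulNr [t * _]H.
under eq_Rintegral do rewrite d1f -mulN1r.
by rewrite RintegralZl// mulN1r.
Qed.

Lemma gaussian_cos (c t : R) :
  \int[gamma]_x cos (t * x + c) = cos c * expR (- (t ^+ 2 / 2)).
Proof.
have FE u : \int[gamma]_x cos (u * x + c) = F c u.
  apply: (@Rintegral_normal_prob _ 1); first by meas.
  by move=> x; exact: cos_max.
have F0 : F c 0 = cos c.
  rewrite -FE; under eq_Rintegral do rewrite mul0r add0r.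
  by rewrite (RintegralT_cst gamma).
rewrite FE.
pose G (u : R) := F c u * expR (u ^+ 2 / 2).
have dG (u : R) : is_derive u 1 G 0.
  have ? := is_derive_F c u.
  rewrite /G; apply: trigger_derive; rewrite /GRing.scale /= mulr0 mulr0.
  by field.
have : G t = G 0 by apply: is_derive_0_is_cst => x; exact: dG.
rewrite /G expr0n/= mul0r expR0 mulr1 F0 => <-.
by rewrite -mulrA expRxMexpNx_1 mulr1.
Qed.

Lemma gaussian_cos0 (t : R) : \int[gamma]_x cos (t * x) = expR (- (t ^+ 2 / 2)).
Proof.
have := gaussian_cos 0 t; rewrite cos0 mul1r.
by under eq_Rintegral do rewrite addr0.
Qed.

Lemma gaussian_sin0 (t : R) : \int[gamma]_x sin (t * x) = 0.
Proof.
have := gaussian_cos (- (pi / 2)) t; rewrite cosN cos_pihalf mul0r.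
by under eq_Rintegral do rewrite cosBpihalf.
Qed.

End gaussian_characteristic_function.

(** * Second moment and Gaussian averages *)

Section trigonometric_limits.
Context {R : realType}.
Implicit Types (u : nat -> R) (x y z : R).

Lemma onem_cos_sub_le z : `|(1 - cos z) - z ^+ 2 / 2| <= z ^+ 4.
Proof.
have [y ->] : exists y, z = 2 * y by exists (z / 2); field.
have H := sin_sub_id_le y; have H1 := ler_norm_sin y.
have -> : (1 - cos (2 * y)) - (2 * y) ^+ 2 / 2 = 2 * ((sin y - y) * (sin y + y)).
  by rewrite cosB1 (_ : 2 * y / 2 = y); field.
have -> : (2 * y) ^+ 4 = 16 * `|y| ^+ 4.
  rewrite (_ : `|y| ^+ 4 = y ^+ 4); last first.
  by rewrite (exprM `|y| 2 2) real_normK ?num_real// -exprM.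
  by field.
rewrite !normrM (ger0_norm (_ : 0 <= 2))//.
have : `|sin y + y| <= 2 * `|y| by rewrite (le_trans (ler_normD _ _))//; lra.
move: H; set p := `|sin y - y|; set q := `|sin y + y|; set m := `|y|.
have p0 : 0 <= p := normr_ge0 _; have q0 : 0 <= q := normr_ge0 _.
have m0 : 0 <= m := normr_ge0 _; move=> pm qm.
have : p * q <= (m ^+ 3 / 2) * (2 * m) by apply: ler_pM.
rewrite (_ : m ^+ 3 / 2 * (2 * m) = m ^+ 4); last by field.
have : 0 <= m ^+ 4 by exact: exprn_ge0.
lra.
Qed.

Lemma cvg_onem_cos_sqr u y : (forall n, u n != 0) -> u n @[n --> \oo] --> 0 ->
  (1 - cos (u n * y)) / u n ^+ 2 @[n --> \oo] --> y ^+ 2 / 2.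
Proof.
move=> u0 ul; apply/subr_cvg0; apply: norm_cvg0.
apply: (@squeeze_cvgr _ _ _ _ (cst 0) (fun n => u n ^+ 2 * y ^+ 4)).
- apply: nearW => n; rewrite normr_ge0/=.
  have -> : (1 - cos (u n * y)) / u n ^+ 2 - y ^+ 2 / 2 =
            ((1 - cos (u n * y)) - (u n * y) ^+ 2 / 2) / u n ^+ 2.
    by field.
  rewrite normrM normfV ler_pdivrMr; last by rewrite normr_gt0 sqrf_eq0.
  apply: le_trans (onem_cos_sub_le _) _.
  rewrite (ger0_norm (sqr_ge0 _)) exprMn le_eqVlt; apply/orP; left; apply/eqP; ring.
- exact: cvg_cst.
- rewrite -[X in _ --> X](mul0r (y ^+ 4)); apply: cvgM; last exact: cvg_cst.
  by rewrite -[X in _ --> X](mulr0 0); apply: cvgM.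
Qed.

Lemma cvg_sin_sub_id u y : (forall n, u n != 0) -> u n @[n --> \oo] --> 0 ->
  (sin (u n * y) - u n * y) / u n @[n --> \oo] --> 0.
Proof.
move=> u0 ul; apply: norm_cvg0.
apply: (@squeeze_cvgr _ _ _ _ (cst 0) (fun n => `|u n| ^+ 2 * `|y| ^+ 3)).
- apply: nearW => n; rewrite normr_ge0/= normrM normfV ler_pdivrMr ?normr_gt0//.
  apply: le_trans (sin_sub_id_le _) _; rewrite normrM exprMn.
  have -> : `|u n| ^+ 2 * `|y| ^+ 3 * `|u n| = `|u n| ^+ 3 * `|y| ^+ 3 by ring.
  have : 0 <= `|u n| ^+ 3 * `|y| ^+ 3 by rewrite mulr_ge0// exprn_ge0.
  lra.
- exact: cvg_cst.
- rewrite -[X in _ --> X](mul0r (`|y| ^+ 3)); apply: cvgM; last exact: cvg_cst.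
  rewrite -[X in _ --> X](mulr0 0); have nu : `|u n| @[n --> \oo] --> 0.
    by rewrite -(normr0 R); apply: cvg_norm.
  by apply: cvgM.
Qed.

End trigonometric_limits.

(** The second moment is the limit of the second difference quotients of the
    characteristic function; Fatou's lemma makes it finite and domination
    identifies it. *)
Section gaussian_second_moment.
Context {R : realType}.
Local Notation gamma := (normal_prob (0 : R) 1).

Let u n : R := n.+1%:R^-1.

Let u0 n : u n != 0. Proof. by rewrite invr_eq0 pnatr_eq0. Qed.

Let cvg_u : u n @[n --> \oo] --> 0. Proof. exact: cvg_harmonic. Qed.

Let f n (x : R) := (1 - cos (u n * x)) / u n ^+ 2.

Let f_ge0 n x : 0 <= f n x.
Proof. by rewrite divr_ge0 ?onem_cos_ge0 ?sqr_ge0. Qed.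

Let f_le n x : f n x <= x ^+ 2 / 2.
Proof.
rewrite /f ler_pdivrMr ?exprn_even_gt0//=.
by rewrite (le_trans (onem_cos_le _))// exprMn; lra.
Qed.

Let measurable_f n : measurable_fun setT (f n).
Proof. by apply: measurable_funM => //; meas. Qed.

Let integrable_f n : gamma.-integrable setT (EFin \o f n).
Proof.
apply: (@integrable_bounded _ _ _ gamma (2 / u n ^+ 2)) => [|x].
  exact: measurable_f.
rewrite ger0_norm// /f ler_wpM2r ?invr_ge0 ?sqr_ge0//.
exact: onem_cos_le2.
Qed.

Let Rintegral_f n : \int[gamma]_x f n x = (1 - expR (- (u n ^+ 2 / 2))) / u n ^+ 2.
Proof.
rewrite /f; rewrite RintegralZr//; last first.
  by apply: (@integrable_bounded _ _ _ gamma 2) => [|x]; [meas|rewrite /= ger0_norm ?onem_cos_ge0 ?onem_cos_le2].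
rewrite RintegralB//; last 2 first.
- exact: integrable_cst.
- by apply: (@integrable_bounded _ _ _ gamma 1) => [|x]; [meas|exact: cos_max].
by rewrite (RintegralT_cst gamma) gaussian_cos0.
Qed.

Let cvg_Rintegral_f : \int[gamma]_x f n x @[n --> \oo] --> (1 / 2 : R).
Proof.
have v0 n : 0 < u n ^+ 2 by rewrite exprn_even_gt0//=.
have v_cvg : u n ^+ 2 @[n --> \oo] --> 0.
  by rewrite -[X in _ --> X](mulr0 0); apply: cvgM.
apply: (@squeeze_cvgr _ _ _ _ (fun n => 1 / 2 - u n ^+ 2) (cst (1 / 2))).
- apply: nearW => n; rewrite Rintegral_f.
  set v := u n ^+ 2; have v0' : 0 < v := v0 n.
  rewrite ler_pdivlMr// ler_pdivrMr//=.
  have := expRN_mul_le1 (ltW (divr_gt0 v0' (ltr0n _ 2))).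
  have := expR_ge1Dx (- (v / 2)); have := expR_ge0 (- (v / 2)).
  set e := expR _ => e0 e1 e2; apply/andP; split; nra.
- rewrite -[X in _ --> X](subr0 (1 / 2)); apply: cvgB => //; exact: cvg_cst.
- exact: cvg_cst.
Qed.

Lemma integrable_sqr_gaussian : gamma.-integrable setT (EFin \o (fun x : R => x ^+ 2)).
Proof.
suff : gamma.-integrable setT (EFin \o (fun x : R => x ^+ 2 / 2)).
  move=> /(integrable_scale 2); congr (_.-integrable _ _).
  by apply/funext => x /=; congr EFin; field.
apply/integrableP; split; first by apply/measurable_EFinP; apply: measurable_funM => //; meas.
have := @fatou _ _ _ gamma setT measurableT (fun n => EFin \o f n).
have -> : (fun x : R => limn_einf ((fun n => EFin \o f n) ^~ x)) =
          (fun x => (x ^+ 2 / 2)%:E).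
  apply/funext => x; apply: (cvg_limn_einf_sup _).1.
  by apply: cvg_EFin; [exact: nearW|exact: (cvg_onem_cos_sqr u0 cvg_u)].
have -> : limn_einf (fun n => \int[gamma]_x (EFin \o f n) x)%E = (1 / 2)%:E.
  apply: (cvg_limn_einf_sup _).1.
  under eq_fun do rewrite EFin_Rintegral//.
  by apply: cvg_EFin; [exact: nearW|exact: cvg_Rintegral_f].
move=> H; apply: (@le_lt_trans _ _ (1 / 2)%:E); last exact: ltry.
under eq_integral do rewrite /= ger0_norm ?divr_ge0 ?sqr_ge0//.
apply: H => n; first by apply/measurable_EFinP; exact: measurable_f.
by move=> x _; rewrite lee_fin.
Qed.

Lemma gaussian_second_moment : \int[gamma]_x x ^+ 2 = 1.
Proof.
have H : \int[gamma]_x f n x @[n --> \oo] --> \int[gamma]_x (x ^+ 2 / 2).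
  apply: (@RintegralT_dct _ _ _ gamma f _ (fun x => x ^+ 2 / 2)).
  - exact: measurable_f.
  - by have := integrable_scale 2^-1 integrable_sqr_gaussian;
      congr (_.-integrable _ _); apply/funext => x /=; rewrite mulrC.
  - by move=> n x; rewrite ger0_norm.
  - by move=> x; exact: (cvg_onem_cos_sqr u0 cvg_u).
have : \int[gamma]_x (x ^+ 2 / 2) = 1 / 2.
  exact: (cvg_unique _ H cvg_Rintegral_f).
rewrite RintegralZr//; last exact: integrable_sqr_gaussian.
by move=> /(congr1 (fun z => z * 2)); rewrite !divfK// pnatr_eq0.
Qed.

End gaussian_second_moment.

(** Averaging a cosine over a Gaussian frequency turns it into a Gaussian kernel:
    this passes from characteristic functions to Laplace transforms of squares. *)
Section gaussian_average.
Context d (T : measurableType d) (R : realType) (P : probability T R).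
Local Notation gamma := (normal_prob (0 : R) 1).

Variable Y : T -> R.
Hypothesis mY : measurable_fun setT Y.

Let f (z : R * T) := (cos (z.1 * Y z.2))%:E.

Let fi : (gamma \x P)%E.-integrable setT f.
Proof.
apply: (@integrable_bounded _ _ _ (gamma \x P)%E 1) => [|z]; last exact: cos_max.
apply: measurable_cos_fun; apply: measurable_funM; first exact: measurable_fst.
by apply: measurableT_comp => //; exact: measurable_snd.
Qed.

Let integrable_cos r : P.-integrable setT (EFin \o (fun w => cos (r * Y w))).
Proof. by apply: (integrable_bounded P (M := 1)) => [|w]; [meas|exact: cos_max]. Qed.

Lemma measurable_Rintegral_cos :
  measurable_fun setT (fun r : R => \int[P]_w cos (r * Y w)).
Proof.
apply/measurable_EFinP; have := measurable_fubini_F fi.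
congr measurable_fun; apply/funext => r.
by rewrite /fubini_F /= -(EFin_Rintegral (integrable_cos r)).
Qed.

Lemma gaussian_average_cos :
  \int[gamma]_r (\int[P]_w cos (r * Y w)) = \int[P]_w expR (- (Y w ^+ 2 / 2)).
Proof.
transitivity (fine (\int[gamma]_r \int[P]_w f (r, w))%E).
  congr fine; apply: eq_integral => r _.
  by rewrite /= -(EFin_Rintegral (integrable_cos r)).
rewrite (Fubini fi); congr fine; apply: eq_integral => w _.
rewrite /f /= (_ : (\int[gamma]_r _)%E = (\int[gamma]_r cos (r * Y w))%:E).
  by under eq_Rintegral do rewrite mulrC; rewrite gaussian_cos0.
apply: EFin_Rintegral.
apply: (@integrable_bounded _ _ _ gamma 1) => [|r]; last exact: cos_max.
by apply: measurable_cos_fun; apply: measurable_funM; [exact: measurable_id|exact: measurable_cst].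
Qed.

End gaussian_average.

(** * Limits of n-th powers *)

Section power_limits.
Context {R : realType}.
Implicit Types (x y r : nat -> R) (s : R).

Lemma cvg_of_natmul x s : n%:R * x n @[n --> \oo] --> s -> x n @[n --> \oo] --> 0.
Proof.
move=> xs; have -> : (0 : R) = 0 * s by rewrite mul0r.
have l : n%:R^-1 * (n%:R * x n) @[n --> \oo] --> 0 * s.
  apply: cvgM => //; apply/gtr0_cvgV0; last exact: cvgr_idn.
  by near=> n; rewrite ltr0n; near: n; exact: nbhs_infty_gt.
apply: cvg_trans l; apply: near_eq_cvg; near=> n.
rewrite mulKf// pnatr_eq0 -lt0n; near: n; exact: nbhs_infty_gt.
Unshelve. all: by end_near. Qed.

Lemma cvg_expr_onem x s : n%:R * x n @[n --> \oo] --> s ->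
  (1 - x n) ^+ n @[n --> \oo] --> expR (- s).
Proof.
move=> xs; have x0 := cvg_of_natmul xs.
have cE (y : nat -> R) : y n @[n --> \oo] --> s ->
    expR (- y n) @[n --> \oo] --> expR (- s).
  by move=> ys; apply: continuous_cvg; [exact: continuous_expR|exact: cvgN].
apply: (@squeeze_cvgr _ _ _ _ (fun n => expR (- (n%:R * x n / (1 - x n))))
                              (fun n => expR (- (n%:R * x n)))).
- near=> n; have x1 : 0 < 1 - x n.
    rewrite subr_gt0; near: n; apply: cvgr_lt x0 _ _; exact: ltr01.
  have x1' := ltW x1.
  apply/andP; split.
    rewrite -mulrA -mulrN expRM_natl; apply: lerXn2r; rewrite ?nnegrE ?expR_ge0//.
    rewrite expRN -[leRHS]invrK lef_pV2 ?posrE ?expR_gt0 ?invr_gt0//.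
    apply: le_trans (expR_ge1Dx _).
    rewrite -(ler_pM2r x1) mulVf ?gt_eqF// mulrDl divfK ?gt_eqF//; lra.
  rewrite -mulrN expRM_natl; apply: lerXn2r; rewrite ?nnegrE ?expR_ge0//.
  by have := expR_ge1Dx (- x n).
- apply: cE; have -> : s = s / (1 - 0) by rewrite subr0 divr1.
  apply: cvgM => //; apply: cvgV; first by rewrite subr0 oner_neq0.
  by apply: cvgB => //; exact: cvg_cst.
- exact: cE.
Unshelve. all: by end_near. Qed.

(** Converse of the previous limit, through [r n = expR (- l n / n)]. *)
Lemma cvg_natmul_onem r s : (forall n, 0 <= r n) ->
  r n ^+ n @[n --> \oo] --> expR (- s) ->
  n%:R * (1 - r n) @[n --> \oo] --> s.
Proof.
move=> r0 rs.
pose l n := - ln (r n ^+ n).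
have ls : l n @[n --> \oo] --> s.
  rewrite -[X in _ --> X]opprK -[X in - X]expRK; apply: cvgN.
  by apply: continuous_cvg => //; apply: continuous_ln; exact: expR_gt0.
have ln0 : l n / n%:R @[n --> \oo] --> 0.
  have -> : (0 : R) = s * 0 by rewrite mulr0.
  apply: cvgM => //; apply/gtr0_cvgV0; last exact: cvgr_idn.
  by near=> n; rewrite ltr0n; near: n; exact: nbhs_infty_gt.
have rE : \forall n \near \oo, (0 < n)%N /\ r n = expR (- (l n / n%:R)).
  near=> n; have n0 : (0 < n)%N by near: n; exact: nbhs_infty_gt.
  split => //; have rn : 0 < r n ^+ n.
    near: n; apply: cvgr_gt rs _ _; exact: expR_gt0.
  have rn0 : 0 < r n.
    rewrite lt_neqAle r0 andbT eq_sym; apply: contraTneq rn => ->.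
    by rewrite expr0n gtn_eqF// ltxx.
  rewrite /l lnXn// (_ : - (- (ln (r n) *+ n) / n%:R) = ln (r n)) ?lnK//.
  by rewrite -mulr_natr; field; rewrite pnatr_eq0 gtn_eqF.
apply: (@squeeze_cvgr _ _ _ _ (fun n => l n / (1 + l n / n%:R)) l) => //.
- near=> n; have [n0 ->] : (0 < n)%N /\ r n = expR (- (l n / n%:R)) by near: n.
  have nR : 0 < n%:R :> R by rewrite ltr0n.
  have : - 1 < l n / n%:R by near: n; apply: cvgr_gt ln0 _ _; rewrite oppr_lt0.
  set z := l n / n%:R => z0; have z1 : 0 < 1 + z by lra.
  have -> : l n = n%:R * z by rewrite /z mulrCA divff ?mulr1// gt_eqF.
  rewrite -mulrA !ler_pM2l//; apply/andP; split; last first.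
    by have := expR_ge1Dx (- z); lra.
  rewrite ler_pdivrMr//; have := expR_ge1Dx z; have := expRxMexpNx_1 z.
  have := expR_gt0 (- z); have := expR_gt0 z.
  set p := expR z; set q := expR (- z) => p0 q0 pq pz; nra.
- have -> : s = s / (1 + 0) by rewrite addr0 divr1.
  apply: cvgM => //; apply: cvgV; first by rewrite addr0 oner_neq0.
  by apply: cvgD => //; exact: cvg_cst.
Unshelve. all: by end_near. Qed.

End power_limits.

(** * From characteristic functions to the truncated second moment *)

(** [A + iB] is the characteristic function of a mean-zero variable [Y], and
    [cfY] its convergence along the norming sequence [a], up to a phase. The
    variable [D] plays the symmetrization of [Y], whose characteristic function
    [rho] is real, which makes the phase disappear. *)
Section laplace_of_attraction.
Context d (T : measurableType d) (R : realType) (P : probability T R).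
Variable Y : T -> R.
Hypothesis mY : measurable_fun setT Y.
Hypothesis iY : P.-integrable setT (EFin \o Y).
Hypothesis Y0 : \int[P]_w Y w = 0.
Local Notation gamma := (normal_prob (0 : R) 1).

Let A (t : R) := \int[P]_w cos (t * Y w).
Let B (t : R) := \int[P]_w sin (t * Y w).
Let L (r : R) := \int[P]_w satsq (r * Y w).

Variable a : nat -> R.
Hypothesis a0 : forall n, 0 < a n.
Hypothesis cfY : forall t,
  (A (t / a n) ^+ 2 + B (t / a n) ^+ 2) ^+ n @[n --> \oo] --> expR (- t ^+ 2).

Variable D : T -> R.
Hypothesis mD : measurable_fun setT D.
Hypothesis cfD : forall t, \int[P]_w cos (t * D w) = A t ^+ 2 + B t ^+ 2.

Let rho (t : R) := \int[P]_w cos (t * D w).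

Let i1 (h : T -> R) : measurable_fun setT h -> (forall w, `|h w| <= 1) ->
  P.-integrable setT (EFin \o h).
Proof. exact: integrable_bounded. Qed.

Let icos t (Z : T -> R) : measurable_fun setT Z ->
  P.-integrable setT (EFin \o (fun w => cos (t * Z w))).
Proof. by move=> mZ; apply: i1 => [|w]; [meas|exact: cos_max]. Qed.

Let isin t (Z : T -> R) : measurable_fun setT Z ->
  P.-integrable setT (EFin \o (fun w => sin (t * Z w))).
Proof. by move=> mZ; apply: i1 => [|w]; [meas|exact: sin_max]. Qed.

Let norm_satsq (x : R) : `|satsq x| <= 1.
Proof. by rewrite ger0_norm ?satsq_ge0 ?satsq_le1. Qed.

Let isat t (Z : T -> R) : measurable_fun setT Z ->
  P.-integrable setT (EFin \o (fun w => satsq (t * Z w))).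
Proof. by move=> mZ; apply: i1 => [|w]; [meas|]. Qed.

Let onem_rho t : 1 - rho t = \int[P]_w (1 - cos (t * D w)).
Proof. by rewrite RintegralB ?RintegralT_cst//; [exact: integrable_cst|exact: icos]. Qed.

Let onem_A t : 1 - A t = \int[P]_w (1 - cos (t * Y w)).
Proof. by rewrite RintegralB ?RintegralT_cst//; [exact: integrable_cst|exact: icos]. Qed.

Let cvg_rho t : n%:R * (1 - rho (t / a n)) @[n --> \oo] --> t ^+ 2.
Proof.
apply: cvg_natmul_onem => [n|]; first by rewrite /rho cfD addr_ge0 ?sqr_ge0.
by under eq_fun do rewrite /rho cfD; exact: cfY.
Qed.

(** The convergence says [rho (r / a n) --> 1] for every [r], so the Gaussian
    average of [rho (r / a n)], which is the Laplace transform of [D ^+ 2] at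
    [(a n)^-2 / 2], tends to 1. If [(a n)^-1] exceeded [e] infinitely often, the
    transform at [e ^+ 2 / 2] would be 1, so that [D = 0] almost surely,
    contradicting the limit of [n%:R * (1 - rho (t / a n))]. *)
Lemma cvg_norming_inv : (a n)^-1 @[n --> \oo] --> 0.
Proof.
have l1 : \int[gamma]_r rho (r / a n) @[n --> \oo] --> (1 : R).
  rewrite -[X in _ --> X](RintegralT_cst gamma).
  apply: (@RintegralT_bct _ _ _ gamma 1 (fun n r => rho (r / a n))).
  - move=> n; rewrite /rho.
    have := @measurable_Rintegral_cos _ _ _ P (fun w => D w / a n).
    have E : (fun r : R => \int[P]_w cos (r * (D w / a n))) =
             (fun r => \int[P]_w cos (r / a n * D w)).
      by apply/funext => r; apply: eq_Rintegral => w _; congr cos; ring.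
    by rewrite E; apply; apply: measurable_funM.
  - move=> n r; rewrite -[leRHS](RintegralT_cst P) /rho.
    apply: norm_RintegralT_le => [||w]; [exact: integrable_cst|meas|exact: cos_max].
  - move=> r; have := cvg_of_natmul (@cvg_rho r).
    move=> l; have : 1 - (1 - rho (r / a n)) @[n --> \oo] --> (1 - 0 : R).
      by apply: cvgB l; exact: cvg_cst.
    by rewrite subr0; under eq_fun do rewrite subKr.
have E n : \int[gamma]_r rho (r / a n) =
    \int[P]_w expR (- (((a n)^-1 * D w) ^+ 2 / 2)).
  rewrite -gaussian_average_cos; last exact: measurable_funM.
  apply: eq_Rintegral => r _; apply: eq_Rintegral => w _; congr cos; ring.
apply/cvgr0Pnorm_lt => e e0.
pose q := \int[P]_w expR (- ((e * D w) ^+ 2 / 2)).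
have ie c : P.-integrable setT (EFin \o (fun w => expR (- ((c * D w) ^+ 2 / 2)))).
  apply: i1 => [|w]; last by rewrite ger0_norm ?expR_ge0// expRN_le1 ?divr_ge0 ?sqr_ge0.
  by apply: measurable_expR_fun; apply: measurable_funN; apply: measurable_funM => //; meas.
have q1 : q < 1.
  rewrite ltNge; apply/negP => q1.
  have H t : 1 - rho t <= 0.
    rewrite onem_rho; pose c := (t * Num.sqrt 2 / e) ^+ 2 / 2 + 2.
    have s2 : 0 < Num.sqrt 2 :> R by rewrite sqrtr_gt0.
    apply: (@le_trans _ _ (\int[P]_w (c * (1 - expR (- ((e * D w) ^+ 2 / 2)))))).
      apply: le_RintegralT.
      + by apply: integrable_sub; [exact: integrable_cst|exact: icos].
      + by apply: integrable_scale; apply: integrable_sub => //; exact: integrable_cst.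
      + move=> w; have := onem_cos_satsq (t * Num.sqrt 2 / e) (e * D w / Num.sqrt 2).
        rewrite /satsq -/c (_ : _ * (e * D w / _) = t * D w).
          by rewrite [(_ / Num.sqrt 2) ^+ 2]exprMn exprVn sqr_sqrtr.
        by field; rewrite !gt_eqF.
    rewrite RintegralZl//; last by apply: integrable_sub => //; exact: integrable_cst.
    rewrite RintegralB//; last exact: integrable_cst.
    rewrite RintegralT_cst mulr_ge0_le0 ?subr_le0//.
    by rewrite addr_ge0// divr_ge0 ?sqr_ge0.
  have rho1 t : rho t = 1.
    apply/eqP; rewrite eq_le; apply/andP; split.
      rewrite -(RintegralT_cst P 1); apply: le_RintegralT => [||w].
      + exact: icos.
      + exact: integrable_cst.
      + exact: cos_le1.
    by have := H t; rewrite subr_le0.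
  have l : (fun=> 0 : R) n @[n --> \oo] --> (1 : R).
    have := @cvg_rho 1; rewrite expr1n.
    by under eq_fun do rewrite rho1 subrr mulr0.
  have /eqP : 0 = 1 :> R by exact: (cvg_unique _ (cvg_cst 0) l).
  by rewrite eq_sym oner_eq0.
near=> n; rewrite ger0_norm ?invr_ge0 ?ltW// ltNge; apply/negP => ea.
have : q < \int[gamma]_r rho (r / a n).
  by near: n; apply: cvgr_gt l1 _ _.
rewrite E ltNge => /negP; apply; rewrite /q; apply: le_RintegralT.
- exact: ie.
- exact: ie.
- move=> w; rewrite ler_expR lerN2 ler_pM2r ?invr_gt0// !exprMn ler_wpM2r ?sqr_ge0//.
  by apply: lerXn2r => //; rewrite ?nnegrE ?invr_ge0 ltW.
Unshelve. all: by end_near. Qed.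

Let cvg_scale t : t / a n @[n --> \oo] --> 0.
Proof.
rewrite -[X in _ --> X](mulr0 t).
by apply: cvgM; [exact: cvg_cst|exact: cvg_norming_inv].
Qed.

(** [1 - A] may be of larger order than [t ^+ 2], as [Y] may have infinite
    variance. A bounded weight gives a lower bound of order [t ^+ 2] in every
    case, with the constant [kappa]. *)
Let weight w := (1 + Y w ^+ 2)^-1.

Let weight_gt0 w : 0 < weight w.
Proof. by rewrite invr_gt0 ltr_wpDr ?sqr_ge0. Qed.

Let weight_ge0 w : 0 <= weight w. Proof. exact: ltW. Qed.

Let weight_le1 w : weight w <= 1.
Proof. by rewrite invf_le1 ?lerDl ?sqr_ge0 // ltr_wpDr ?sqr_ge0. Qed.

Let measurable_weight : measurable_fun setT weight.
Proof.
have c : continuous (fun y : R => (1 + y ^+ 2)^-1) by exact: continuous_oneDsqrV.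
exact: (measurableT_comp (continuous_measurable_fun c) mY).
Qed.

Let sqr_weight_le1 w : Y w ^+ 2 * weight w <= 1.
Proof.
by rewrite /weight ler_pdivrMr ?mul1r ?lerDr// ltr_wpDr ?sqr_ge0.
Qed.

Let kappa := \int[P]_w (Y w ^+ 2 / 2 * weight w).

Let ikappa : P.-integrable setT (EFin \o (fun w => Y w ^+ 2 / 2 * weight w)).
Proof.
apply: i1 => [|w].
  by apply: measurable_funM => //; apply: measurable_funM => //; meas.
rewrite ger0_norm; last by rewrite mulr_ge0 ?divr_ge0 ?sqr_ge0// ltW.
by have := sqr_weight_le1 w; have := weight_gt0 w; have := sqr_ge0 (Y w); nra.
Qed.

Let kappa_gt0 : 0 < kappa.
Proof.
rewrite ltNge; apply/negP => k0.
have HA t : A t = 1.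
  apply/eqP; rewrite eq_le; apply/andP; split.
    rewrite -(RintegralT_cst P 1); apply: le_RintegralT => [||w].
    + exact: icos.
    + exact: integrable_cst.
    + exact: cos_le1.
  rewrite -subr_le0 onem_A.
  apply: (@le_trans _ _ (\int[P]_w ((t ^+ 2 + 4) * (Y w ^+ 2 / 2 * weight w)))).
    apply: le_RintegralT.
    + by apply: integrable_sub; [exact: integrable_cst|exact: icos].
    + exact: integrable_scale.
    + move=> w; rewrite /weight mulrA ler_pdivlMr ?ltr_wpDr ?sqr_ge0//.
      have := onem_cos_le (t * Y w); have := onem_cos_le2 (t * Y w).
      by rewrite exprMn; have := sqr_ge0 (Y w); have := onem_cos_ge0 (t * Y w); nra.
  by rewrite RintegralZl// mulr_ge0_le0// addr_ge0 ?sqr_ge0.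
have rho_ge1 t : 1 <= rho t by rewrite /rho cfD HA expr1n lerDl sqr_ge0.
have : (1 : R) <= 0.
  have l := @cvg_rho 1; rewrite expr1n in l.
  rewrite -(cvg_lim _ l)//; apply: limr_le; first by apply/cvg_ex; eexists; exact: l.
  by apply: nearW => n; rewrite mulr_ge0_le0// subr_le0.
by rewrite ler10.
Qed.

(** As [E Y = 0], the imaginary part [B t] is [o(t)], while [1 - A t] is at
    least of order [t ^+ 2]; hence [B ^+ 2 = o(1 - A)] and
    [1 - A ^+ 2 - B ^+ 2] is equivalent to [2 * (1 - A)]. *)
Lemma cvg_onem_real_part t :
  n%:R * (1 - A (t / a n)) @[n --> \oo] --> t ^+ 2 / 2.
Proof.
have [->|t0] := eqVneq t 0.
  rewrite expr0n mul0r; under eq_fun => n.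
    rewrite mul0r onem_A.
    under eq_Rintegral do rewrite mul0r cos0 subrr.
    rewrite RintegralT_cst mulr0. over.
  exact: cvg_cst.
pose v n := t / a n.
have v0 n : v n != 0 by rewrite mulf_neq0// invr_eq0 gt_eqF.
have v2 n : 0 < v n ^+ 2 by rewrite exprn_even_gt0//=.
have vl : v n @[n --> \oo] --> 0 by exact: cvg_scale.
pose p n := (1 - A (v n)) / v n ^+ 2; pose q n := B (v n) / v n.
have ql : q n @[n --> \oo] --> 0.
  have -> : q = fun n => \int[P]_w ((sin (v n * Y w) - v n * Y w) / v n).
    apply/funext => n; rewrite RintegralZr//; last first.
      by apply: integrable_sub; [exact: isin|exact: integrable_scale].
    rewrite RintegralB//; [|exact: isin|exact: integrable_scale].
    by rewrite RintegralZl// Y0 mulr0 subr0.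
  rewrite -[X in _ --> X](RintegralT_cst P).
  apply: (@RintegralT_dct _ _ _ P _ _ (fun w => 2 * `|Y w|)).
  - by move=> n; apply: measurable_funM => //; meas.
  - apply: integrable_scale; apply: integrable_dominated (integrable_norm iY) _.
    + by meas.
    + by move=> w; rewrite normr_id.
  - move=> n w; rewrite normrM normfV ler_pdivrMr ?normr_gt0//.
    by rewrite (le_trans (sin_sub_id_le2 _))// normrM -mulrA (mulrC `|v n|).
  - by move=> w; exact: cvg_sin_sub_id.
have pl : \forall n \near \oo, kappa / 2 <= p n.
  have l : \int[P]_w ((1 - cos (v n * Y w)) / v n ^+ 2 * weight w) @[n --> \oo] --> kappa.
    apply: (@RintegralT_bct _ _ _ P 1).
    - by move=> n; apply: measurable_funM => //; apply: measurable_funM => //; meas.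
    - move=> n w; rewrite ger0_norm; last first.
        by rewrite mulr_ge0 ?divr_ge0 ?onem_cos_ge0 ?sqr_ge0// ltW.
      apply: le_trans (sqr_weight_le1 w); rewrite ler_wpM2r// ler_pdivrMr//.
      apply: le_trans (onem_cos_le _) _; rewrite exprMn.
      by have := sqr_ge0 (Y w); have := v2 n; nra.
    - by move=> w; apply: cvgM; [exact: cvg_onem_cos_sqr|exact: cvg_cst].
  near=> n; apply: (@le_trans _ _ (\int[P]_w ((1 - cos (v n * Y w)) / v n ^+ 2 * weight w))).
    near: n; apply: cvgr_ge l _ _; have := kappa_gt0; lra.
  have ic : P.-integrable setT (EFin \o (fun w => (1 - cos (v n * Y w)) / v n ^+ 2)).
    by apply: integrable_scaler; apply: integrable_sub; [exact: integrable_cst|exact: icos].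
  rewrite /p onem_A -RintegralZr//; last first.
    by apply: integrable_sub; [exact: integrable_cst|exact: icos].
  apply: le_RintegralT => //.
  - apply: (integrable_dominated _ ic).
      by apply: measurable_funM => //; exact: (integrable_measurable ic).
    move=> w; rewrite ger0_norm; last by rewrite mulr_ge0 ?divr_ge0 ?onem_cos_ge0 ?sqr_ge0// ltW.
    by rewrite ler_piMr// divr_ge0 ?onem_cos_ge0 ?sqr_ge0.
  - by move=> w; rewrite ler_piMr// divr_ge0 ?onem_cos_ge0 ?sqr_ge0.
have ul : 1 - A (v n) @[n --> \oo] --> 0.
  have -> : (fun n => 1 - A (v n)) = (fun n => \int[P]_w (1 - cos (v n * Y w))).
    by apply/funext => n; exact: onem_A.
  rewrite -[X in _ --> X](RintegralT_cst P).
  apply: (@RintegralT_bct _ _ _ P 2).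
  - by move=> n; meas.
  - by move=> n w; rewrite ger0_norm ?onem_cos_ge0 ?onem_cos_le2.
  - move=> w; rewrite -(subrr (cos 0)) cos0; apply: cvgB; first exact: cvg_cst.
    rewrite -[in X in _ --> X]cos0 -(mul0r (Y w)); apply: continuous_cvg; first exact: continuous_cos.
    by apply: cvgM => //; exact: cvg_cst.
(* [1 - A ^+ 2 - B ^+ 2 = (1 - A) * (2 - (1 - A) - q ^+ 2 / p)] with the ratios
   [p = (1 - A) / v ^+ 2] and [q = B / v]. *)
have dl : 2 - (1 - A (v n)) - q n ^+ 2 / p n @[n --> \oo] --> (2 : R).
  rewrite -[X in _ --> X](subr0 2) -[X in _ --> X](subr0 (2 - 0)).
  apply: cvgB; first by apply: cvgB => //; exact: cvg_cst.
  apply: (@squeeze_cvgr _ _ _ _ (cst 0) (fun n => q n ^+ 2 * (2 / kappa))).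
  - near=> n; have pk : kappa / 2 <= p n by near: n.
    have k0 := kappa_gt0; have p0 : 0 < p n by lra.
    have p0' := ltW p0; rewrite divr_ge0 ?sqr_ge0//= ler_wpM2l ?sqr_ge0//.
    have : (p n)^-1 <= (kappa / 2)^-1 by rewrite lef_pV2 ?posrE//; lra.
    by rewrite [in X in X -> _](invf_div kappa 2).
  - exact: cvg_cst.
  - rewrite -[X in _ --> X](mul0r (2 / kappa)); apply: cvgM; last exact: cvg_cst.
    by rewrite -[X in _ --> X](mulr0 0); apply: cvgM.
have l : n%:R * (1 - rho (v n)) / (2 - (1 - A (v n)) - q n ^+ 2 / p n) @[n --> \oo]
    --> t ^+ 2 / 2.
  by apply: cvgM; [exact: cvg_rho|apply: cvgV; rewrite ?pnatr_eq0].
apply: cvg_trans l; apply: near_eq_cvg; near=> n.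
have pk : kappa / 2 <= p n by near: n.
have k0 := kappa_gt0; have p0 : 0 < p n by lra.
have d0 : 0 < 2 - (1 - A (v n)) - q n ^+ 2 / p n.
  by near: n; apply: cvgr_gt dl _ _.
rewrite -[LHS]/(_ / _) -/(v n).
apply: (@mulIf _ (2 - (1 - A (v n)) - q n ^+ 2 / p n)); first by rewrite gt_eqF.
rewrite divfK ?gt_eqF// /rho cfD.
have -> : B (v n) = q n * v n by rewrite /q divfK.
have -> : A (v n) = 1 - p n * v n ^+ 2 by rewrite /p divfK ?gt_eqF//; ring.
by field; rewrite gt_eqF.
Unshelve. all: by end_near. Qed.

(** [L] is a Gaussian average of [1 - A], so the pointwise limit of
    [n%:R * (1 - A (t / a n))] should pass through the average. The
    dominating function is a multiple of [I n = n%:R * L (t / a n)] itself, which is not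
    yet known to be bounded; dominated convergence is therefore applied after
    division by [1 + I n] and the resulting estimate
    [`|I n - t ^+ 2| <= e n * (1 + I n)] closes up because [e n --> 0]. *)
Lemma cvg_laplace t : n%:R * L (t / a n) @[n --> \oo] --> t ^+ 2.
Proof.
(* [sqrt 2] turns the Gaussian kernel [expR (- x ^+ 2 / 2)] into [expR (- x ^+ 2)]. *)
pose c n := Num.sqrt 2 * (t / a n).
pose h n r := n%:R * (1 - A (c n * r)).
pose I n := n%:R * L (t / a n).
have L0 n : 0 <= L (t / a n) by apply: Rintegral_ge0 => w _; exact: satsq_ge0.
have I0 n : 0 <= I n by rewrite mulr_ge0.
have mA n : measurable_fun setT (fun r : R => A (c n * r)).
  have mcY : measurable_fun setT (fun w => c n * Y w) by meas.
  have := measurable_Rintegral_cos P mcY; congr measurable_fun.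
  by apply/funext => r; apply: eq_Rintegral => w _; congr cos; ring.
have mh n : measurable_fun setT (h n).
  by rewrite /h; apply: measurable_scale_fun; apply: measurable_funB => //.
have A01 x : 0 <= 1 - A x.
  by rewrite onem_A; apply: Rintegral_ge0 => w _; exact: onem_cos_ge0.
have hub n r : h n r <= (r ^+ 2 + 2) * I n.
  rewrite /h /I mulrCA ler_wpM2l// onem_A /L -RintegralZl//; last exact: isat.
  apply: le_RintegralT.
  - by apply: integrable_sub; [exact: integrable_cst|exact: icos].
  - by apply: integrable_scale; exact: isat.
  - move=> w; have := onem_cos_satsq (Num.sqrt 2 * r) (t / a n * Y w).
    rewrite exprMn sqr_sqrtr// (_ : 2 * r ^+ 2 / 2 = r ^+ 2); last by field.
    by rewrite (_ : Num.sqrt 2 * r * _ = c n * r * Y w)// /c; ring.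
have ih n : gamma.-integrable setT (EFin \o h n).
  apply: (@integrable_dominated _ _ _ gamma _ (fun r => I n * (r ^+ 2 + 2))).
  - exact: mh.
  - apply: (@integrable_scale _ _ _ gamma); apply: (@integrable_add _ _ _ gamma).
      exact: integrable_sqr_gaussian.
    exact: (@integrable_cst _ _ _ gamma).
  - by move=> r; rewrite ger0_norm ?mulr_ge0// mulrC.
have IE n : I n = \int[gamma]_r h n r.
  have mcY : measurable_fun setT (fun w => c n * Y w) by meas.
  rewrite /h RintegralZl//; last first.
    apply: (@integrable_bounded _ _ _ gamma 2) => [|r].
      exact: (measurable_funB (measurable_cst _) (mA n)).
    rewrite ger0_norm// onem_A -[leRHS](RintegralT_cst P).
    apply: le_RintegralT => [||w]; last exact: onem_cos_le2.
    - by apply: integrable_sub; [exact: integrable_cst|exact: icos].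
    - exact: integrable_cst.
  congr (_ * _).
  rewrite RintegralB//; last 2 first.
  - exact: (@integrable_cst _ _ _ gamma).
  - apply: (@integrable_bounded _ _ _ gamma 1) => [|r]; first exact: mA.
    rewrite -[leRHS](RintegralT_cst P); apply: norm_RintegralT_le => [||w].
    + exact: integrable_cst.
    + by meas.
    + exact: cos_max.
  have := gaussian_average_cos P mcY.
  rewrite (_ : (fun r : R => _) = (fun r => A (c n * r))); last first.
    by apply/funext => r; apply: eq_Rintegral => w _; congr cos; ring.
  move=> ->; rewrite (RintegralT_cst gamma).
  have iE : P.-integrable setT (EFin \o (fun w => expR (- (t / a n * Y w) ^+ 2))).
    by apply: i1 => [|w]; [meas|rewrite ger0_norm ?expR_ge0// expRN_le1// sqr_ge0].
  rewrite /L /satsq (RintegralB measurableT (integrable_cst P 1) iE) RintegralT_cst.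
  congr (1 - _); apply: eq_Rintegral => w _; congr (expR (- _)).
  by rewrite /c !exprMn sqr_sqrtr//; field; rewrite gt_eqF.
pose e n := \int[gamma]_r (`|h n r - t ^+ 2 * r ^+ 2| / (1 + I n)).
have i2 : gamma.-integrable setT (EFin \o (fun r : R => t ^+ 2 * r ^+ 2)).
  by apply: (@integrable_scale _ _ _ gamma); exact: integrable_sqr_gaussian.
have el : e n @[n --> \oo] --> 0.
  rewrite -[X in _ --> X](RintegralT_cst gamma).
  apply: (@RintegralT_dct _ _ _ gamma _ _ (fun r => (r ^+ 2 + 2) + t ^+ 2 * r ^+ 2)).
  - by move=> n; apply: measurable_funM => //; apply: measurable_norm_fun; apply: measurable_funB; [exact: mh|meas].
  - apply: (@integrable_add _ _ _ gamma) => //; apply: (@integrable_add _ _ _ gamma).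
      exact: integrable_sqr_gaussian.
    exact: (@integrable_cst _ _ _ gamma).
  - move=> n r; have I1 : 0 < 1 + I n by rewrite ltr_wpDr.
    have I1' := ltW I1; rewrite normrM normr_id (ger0_norm (_ : 0 <= (1 + I n)^-1)) ?invr_ge0//.
    rewrite ler_pdivrMr//.
    apply: le_trans (ler_normB _ _) _.
    have h0 : 0 <= h n r by rewrite mulr_ge0.
    rewrite (ger0_norm h0) (ger0_norm (mulr_ge0 (sqr_ge0 t) (sqr_ge0 r))).
    have := hub n r; have := I0 n; have := sqr_ge0 r; have := sqr_ge0 t.
    set x := h n r; set y := I n; set z := r ^+ 2; set s := t ^+ 2.
    move=> s0 z0 y0 xy; have : 0 <= s * z by rewrite mulr_ge0.
    by move=> sz; nra.
  - move=> r; apply: (@squeeze_cvgr _ _ _ _ (cst 0) (fun n => `|h n r - t ^+ 2 * r ^+ 2|)).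
    + apply: nearW => n; have I1 : 1 <= 1 + I n by rewrite lerDl.
      rewrite divr_ge0 ?ler_pdivrMr ?ler_peMr// ?(lt_le_trans _ I1)//.
      by rewrite (le_trans _ I1).
    + exact: cvg_cst.
    + rewrite -(normr0 R); apply: cvg_norm; apply/subr_cvg0.
      have := @cvg_onem_real_part (Num.sqrt 2 * t * r).
      rewrite !exprMn sqr_sqrtr// (_ : 2 * _ * _ / 2 = t ^+ 2 * r ^+ 2); last by field.
      apply: cvg_trans; apply: near_eq_cvg; apply: nearW => n; rewrite /h /c.
      by congr (_ * (1 - A _)); ring.
have Ie n : `|I n - t ^+ 2| <= e n * (1 + I n).
  have I1 : 0 < 1 + I n by rewrite ltr_wpDr.
  have ihn : gamma.-integrable setT (EFin \o (fun r => `|h n r - t ^+ 2 * r ^+ 2|)).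
    exact: (integrable_norm (integrable_sub (ih n) i2)).
  rewrite /e RintegralZr// divfK ?gt_eqF//.
  have -> : I n - t ^+ 2 = \int[gamma]_r (h n r - t ^+ 2 * r ^+ 2).
    rewrite (RintegralB measurableT (ih n) i2) -IE.
    rewrite (RintegralZl (t ^+ 2) measurableT integrable_sqr_gaussian).
    by rewrite gaussian_second_moment mulr1.
  apply: (@norm_RintegralT_le _ _ _ gamma); [exact: ihn| |by []].
  by apply: measurable_funB; [exact: mh|meas].
apply/subr_cvg0; apply: norm_cvg0.
apply: (@squeeze_cvgr _ _ _ _ (cst 0) (fun n => 2 * (1 + t ^+ 2) * e n)).
- near=> n; rewrite normr_ge0/=.
  have en : e n < 1 / 2 by near: n; apply: cvgr_lt el _ _; lra.
  have e0 : 0 <= e n by apply: Rintegral_ge0 => r _; rewrite divr_ge0 ?addr_ge0.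
  have := Ie n; have := ler_norm (I n - t ^+ 2); rewrite -/(I n).
  set x := `|_| ; set y := I n; set s := t ^+ 2 => yx xe.
  have x0 : 0 <= x by exact: normr_ge0.
  have : e n * (1 + y) <= e n * (1 + s + x) by rewrite ler_wpM2l//; lra.
  by nra.
- exact: cvg_cst.
- by rewrite -[X in _ --> X](mulr0 (2 * (1 + t ^+ 2))); apply: cvgM => //; exact: cvg_cst.
Unshelve. all: by end_near. Qed.

End laplace_of_attraction.

(** * Slow variation of the truncated second moment *)

Section slow_variation.
Context d (T : measurableType d) (R : realType) (P : probability T R).
Variable Y : T -> R.
Hypothesis mY : measurable_fun setT Y.
Hypothesis iY : P.-integrable setT (EFin \o Y).

Definition truncated_moment (r : R) := \int[P]_w satsq (r * Y w).
Definition truncated_mean_error (r : R) := \int[P]_w (`|Y w| * satsq (r * Y w)).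
Local Notation L := truncated_moment.
Local Notation m := truncated_mean_error.
Let Q (r : R) := \int[P]_w (satsq (r * Y w) ^+ 2).

Variable a : nat -> R.
Hypothesis a0 : forall n, 0 < a n.
Hypothesis a_inv : (a n)^-1 @[n --> \oo] --> 0.
Hypothesis cvgL : forall t, n%:R * L (t / a n) @[n --> \oo] --> t ^+ 2.

Lemma integrable_satsq r : P.-integrable setT (EFin \o (fun w => satsq (r * Y w))).
Proof.
apply: (integrable_bounded P (M := 1)) => [|w]; first by meas.
by rewrite ger0_norm ?satsq_ge0 ?satsq_le1.
Qed.

Let isqr r : P.-integrable setT (EFin \o (fun w => satsq (r * Y w) ^+ 2)).
Proof.
apply: (integrable_bounded P (M := 1)) => [|w]; first by meas.
by rewrite ger0_norm ?sqr_ge0// expr_le1 ?satsq_ge0 ?satsq_le1.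
Qed.

Lemma integrable_norm_satsq r :
  P.-integrable setT (EFin \o (fun w => `|Y w| * satsq (r * Y w))).
Proof.
apply: (integrable_dominated _ (integrable_norm iY)).
  by apply: measurable_funM; meas.
by move=> w; rewrite normrM normr_id (ger0_norm (satsq_ge0 _)) ler_piMr// satsq_le1.
Qed.

Lemma truncated_moment_ge0 r : 0 <= L r.
Proof. by apply: Rintegral_ge0 => w _; exact: satsq_ge0. Qed.

Lemma le_truncated_moment r y : 0 <= r -> r <= y -> L r <= L y.
Proof.
move=> r0 ry; apply: le_RintegralT => [||w]; [exact: integrable_satsq..|].
exact: le_satsqM.
Qed.

Lemma truncated_moment_sqrt2 r : L (Num.sqrt 2 * r) = 2 * L r - Q r.
Proof.
rewrite /L -RintegralZl//; last exact: integrable_satsq.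
rewrite -RintegralB//; last by apply: integrable_scale; exact: integrable_satsq.
by apply: eq_Rintegral => w _; rewrite -mulrA satsq_sqrt2.
Qed.

Let leQ r y : 0 <= r -> r <= y -> Q r <= Q y.
Proof.
move=> r0 ry; apply: le_RintegralT => [||w]; [exact: isqr..|].
by apply: lerXn2r; rewrite ?nnegrE ?satsq_ge0// le_satsqM.
Qed.

Let Q_ge0 r : 0 <= Q r.
Proof. by apply: Rintegral_ge0 => w _; exact: sqr_ge0. Qed.

(** Positivity at the scales [(a n)^-1] spreads to all scales by monotonicity. *)
Lemma truncated_moment_gt0 r : 0 < r -> 0 < L r.
Proof.
move=> r0; near \oo => n.
have ar : (a n)^-1 < r by near: n; apply: cvgr_lt a_inv _ _.
have L1 : 0 < n%:R * L (1 / a n).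
  by near: n; apply: cvgr_gt (@cvgL 1) _ _; rewrite expr1n ltr01.
apply: (@lt_le_trans _ _ (L (1 / a n))).
  rewrite ltNge; apply/negP => L0; move: L1; rewrite ltNge => /negP; apply.
  by rewrite mulr_ge0_le0.
by rewrite le_truncated_moment// ?div1r ?invr_ge0 ltW.
Unshelve. all: by end_near. Qed.

(** By [truncated_moment_sqrt2], the limits of [n%:R * L] at the scales
    [sqrt 2 / a n] and [2 / a n] force [n%:R * Q (sqrt 2 / a n) --> 0]. The
    sequence [a] only probes countably many scales; monotonicity of [L] and [Q]
    in the scale interpolates between them. *)
Lemma truncated_moment_slow e : 0 < e ->
  exists2 r0, 0 < r0 & forall r, 0 < r -> r <= r0 -> Q r <= e * L r.
Proof.
move=> e0; pose s2 : R := Num.sqrt 2.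
have interpolate (x y q l : R) : 0 < y -> 0 <= q -> y <= 2 * x -> 1 < y * l ->
    2 * (x * q) <= e -> q <= e * l.
  move=> y0 q0 yx yl xq; have yq : y * q <= e by nra.
  by rewrite -(ler_pM2l y0) mulrCA; apply: le_trans yq _; rewrite ler_peMr// ltW.
have s20 : 0 < s2 by rewrite sqrtr_gt0.
have s22 : s2 * s2 = 2 by rewrite -expr2 sqr_sqrtr.
have cQ : n%:R * Q (s2 / a n) @[n --> \oo] --> 0.
  have l : 2 * (n%:R * L (s2 / a n)) - n%:R * L (2 / a n) @[n --> \oo] --> 2 * s2 ^+ 2 - 2 ^+ 2.
    by apply: cvgB; [apply: cvgM; [exact: cvg_cst|]|]; exact: cvgL.
  have E0 : 2 * s2 ^+ 2 - 2 ^+ 2 = 0 by rewrite (expr2 s2) s22; lra.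
  rewrite E0 in l; apply: cvg_trans l; apply: near_eq_cvg; apply: nearW => n.
  have -> : 2 / a n = s2 * (s2 / a n) by rewrite mulrA s22.
  by rewrite (truncated_moment_sqrt2 (s2 / a n)); ring.
have [N _ HN] : \forall n \near \oo, 2 * (n%:R * Q (s2 / a n)) <= e /\
    1 < n%:R * L (s2 / a n).
  near=> n; split.
    have : n%:R * Q (s2 / a n) < e / 2 by near: n; apply: cvgr_lt cQ _ _; rewrite divr_gt0.
    lra.
  near: n; apply: cvgr_gt (@cvgL s2) _ _; rewrite expr2 s22; lra.
have L0 := cvg_of_natmul (@cvgL s2).
near \oo => k.
have Lk : L (s2 / a k) <= (N.+1%:R)^-1.
  near: k; apply: cvgr_le L0 _ _; by rewrite invr_gt0 ltr0n.
exists (s2 / a k); first by rewrite divr_gt0.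
move=> r r0 rk; have Lr := truncated_moment_gt0 r0.
have LrN : L r <= N.+1%:R^-1.
  by apply: le_trans Lk; rewrite le_truncated_moment// ltW.
(* The index matching the scale [r]: [n%:R * L r] is at most 1 and nearly 1,
   whereas [n%:R * L (sqrt 2 / a n)] exceeds 1, so that [r < sqrt 2 / a n]. *)
pose n := Num.truncn (L r)^-1.
have /andP[n1 n2] : n%:R <= (L r)^-1 < n.+1%:R.
  by apply: truncn_itv; rewrite invr_ge0 ltW.
have Nn : (N < n)%N.
  rewrite -ltnS -(ltr_nat R); apply: le_lt_trans n2.
  by rewrite -[leLHS]invrK lef_pV2 ?posrE ?invr_gt0 ?ltr0n.
have n0 : (0 < n)%N by exact: leq_ltn_trans Nn.
have nR : 0 < n%:R :> R by rewrite ltr0n.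
have [HQ HL] := HN n (ltnW Nn).
have nL : n%:R * L r <= 1 by rewrite -ler_pdivlMr// div1r.
have rn : r < s2 / a n.
  rewrite ltNge; apply/negP => sr.
  have LL : n%:R * L (s2 / a n) <= n%:R * L r.
    by rewrite ler_pM2l// le_truncated_moment// divr_ge0 ?ltW.
  by have := lt_le_trans HL (le_trans LL nL); rewrite ltxx.
apply: (le_trans (leQ (ltW r0) (ltW rn))).
have n3 : 1 < n.+1%:R * L r by rewrite -ltr_pdivrMr// div1r.
have n4 : n.+1%:R <= 2 * n%:R :> R by rewrite -natrM ler_nat mul2n -addnn -addn1 leq_add2l.
have q0 : 0 <= Q (s2 / a n) by [].
exact: (interpolate _ _ _ _ (ltr0Sn R n) q0 n4 n3 HQ).
Unshelve. all: by end_near. Qed.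

(** Slow variation would give any factor below 4; two steps of ratio [sqrt 2],
    each with a factor [2 - 1 / 5], give 3, which beats the 2 that a first
    moment can gain. *)
Lemma truncated_moment_half : exists2 r0, 0 < r0 &
  forall r, 0 < r -> r <= r0 -> 3 * L (r / 2) <= L r.
Proof.
have [r0 r00 H] := truncated_moment_slow (divr_gt0 (ltr0n R 1) (ltr0n R 5)).
pose s2 : R := Num.sqrt 2.
have s20 : 0 < s2 by rewrite sqrtr_gt0.
have s22 : s2 * s2 = 2 by rewrite -expr2 sqr_sqrtr.
have s21 : 1 <= s2 by nra.
exists r0 => // r rp rr0.
have r1 : s2 * (r / 2) <= r0 by apply: le_trans rr0; nra.
have r2 : r / 2 <= r0 by apply: le_trans rr0; lra.
have E1 := truncated_moment_sqrt2 (r / 2).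
have E2 := truncated_moment_sqrt2 (s2 * (r / 2)).
have -> : L r = L (s2 * (s2 * (r / 2))) by rewrite mulrA s22; congr L; field.
rewrite E2 -/s2.
have p1 : 0 < r / 2 by rewrite divr_gt0.
have p2 : 0 < s2 * (r / 2) by rewrite mulr_gt0.
have H1 := H _ p1 r2; have H2 := H _ p2 r1.
rewrite -/s2 in E1; have := truncated_moment_ge0 (r / 2).
move: E1 H1 H2; move: (Q _) (Q _) (L (s2 * (r / 2))) (L (r / 2)) => q1 q2 l1 l2; lra.
Qed.

Let cvg_mean_error r : m (r / 2 ^+ n) @[n --> \oo] --> 0.
Proof.
rewrite -[X in _ --> X](RintegralT_cst P).
apply: (@RintegralT_dct _ _ _ P _ _ (fun w => `|Y w|)).
- by move=> n; apply: measurable_funM; meas.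
- exact: integrable_norm.
- by move=> n w; rewrite normrM normr_id (ger0_norm (satsq_ge0 _)) ler_piMr// satsq_le1.
- move=> w; rewrite -[X in _ --> X](mulr0 `|Y w|); apply: cvgM; first exact: cvg_cst.
  apply: (@squeeze_cvgr _ _ _ _ (cst 0) (fun n => (r * Y w) ^+ 2 / n%:R)).
  + near=> n; rewrite satsq_ge0/= (le_trans (satsq_le_sqr _))//.
    have n1 : 1 <= 2 ^+ n :> R by rewrite exprn_ege1// ler1n.
    have n0 : (0 < n)%N by near: n; exact: nbhs_infty_gt.
    have -> : r / 2 ^+ n * Y w = r * Y w * (2 ^+ n)^-1 by ring.
    rewrite exprMn ler_wpM2l ?sqr_ge0//.
    have x0 : 0 <= (2 ^+ n)^-1 :> R by rewrite invr_ge0 exprn_ge0.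
    apply: (@le_trans _ _ (2 ^+ n)^-1).
      by rewrite expr2 ler_piMl// invf_le1// (lt_le_trans _ n1).
    rewrite lef_pV2 ?posrE ?ltr0n ?exprn_gt0//.
    by rewrite -natrX ler_nat ltnW// ltn_expl.
  + exact: cvg_cst.
  + exact: cvg_scale_invn.
Unshelve. all: by end_near. Qed.

(** Karamata's estimate. Along halved scales, [r * m r] is at most doubled per
    step, up to an error [o(L r)], while [L r] shrinks by a factor 3. Thus
    [f r <= 2 * f (r / 2)], and iterating leaves only
    [2 ^+ n * (r / 2 ^+ n) * m (r / 2 ^+ n) = r * m (r / 2 ^+ n)], which vanishes
    because [Y] is integrable. *)
Lemma truncated_mean_error_small e : 0 < e ->
  exists2 r0, 0 < r0 & forall r, 0 < r -> r <= r0 -> r * m r <= e * L r.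
Proof.
move=> e_gt0; have [e' e'0 ->] : exists2 e', 0 < e' & e = 6 * e'.
  by exists (e / 6); [rewrite divr_gt0|field].
have [r1 r10 H1] := truncated_moment_slow (mulr_gt0 e'0 e'0).
have [r2 r20 H2] := truncated_moment_half.
exists (Num.min r1 r2); first by rewrite lt_min r10.
pose f r := r * m r - 6 * e' * L r.
have step r : 0 < r -> r <= Num.min r1 r2 -> f r <= 2 * f (r / 2).
  rewrite le_min => r0 /andP[rr1 rr2].
  have inc : r * (m r - m (r / 2)) <= e' * L r + e'^-1 * Q r.
    rewrite /m -RintegralB//; [|exact: integrable_norm_satsq..].
    rewrite -RintegralZl//; last by apply: integrable_sub; exact: integrable_norm_satsq.
    rewrite /L -RintegralZl//; last exact: integrable_satsq.
    rewrite -RintegralZl// -RintegralD//; last 2 first.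
    - by apply: integrable_scale; exact: integrable_satsq.
    - exact: integrable_scale.
    apply: le_RintegralT.
    - by apply: integrable_scale; apply: integrable_sub; exact: integrable_norm_satsq.
    - by apply: integrable_add; apply: integrable_scale => //; exact: integrable_satsq.
    - move=> w; have := satsq_half_increment (r * Y w) e'0.
      rewrite normrM (gtr0_norm r0) (_ : r * Y w / 2 = r / 2 * Y w); last by field.
      by move=> H; apply: le_trans H; rewrite le_eqVlt; apply/orP; left; apply/eqP; ring.
  have := H1 r r0 rr1; have := H2 r r0 rr2; rewrite /f => HL HQ.
  have : e'^-1 * Q r <= e' * L r.
    by rewrite -(ler_pM2l e'0) mulrA divff ?gt_eqF// mul1r mulrA.
  have := ler_wpM2l (ltW e'0) HL; move: inc.
  move: (m r) (m (r / 2)) (L r) (L (r / 2)) (e'^-1 * Q r) => m1 m2 l1 l2 q; lra.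
have iter n r : 0 < r -> r <= Num.min r1 r2 -> f r <= 2 ^+ n * f (r / 2 ^+ n).
  elim: n r => [|n IH] r r0 rr; first by rewrite expr0 mul1r divr1.
  apply: le_trans (step r r0 rr) _.
  have -> : 2 ^+ n.+1 * f (r / 2 ^+ n.+1) = 2 * (2 ^+ n * f (r / 2 / 2 ^+ n)).
    rewrite exprS -mulrA; congr (_ * (_ * f _)).
    by rewrite invfM mulrA.
  rewrite ler_pM2l// IH ?divr_gt0//; apply: le_trans rr; lra.
move=> r r0 rr; rewrite -subr_le0 -/(f r).
have rm0 : r * m (r / 2 ^+ n) @[n --> \oo] --> 0.
  rewrite -[X in _ --> X](mulr0 r); apply: cvgM; first exact: cvg_cst.
  exact: cvg_mean_error.
rewrite -(cvg_lim _ rm0)//; apply: limr_ge; first by apply/cvg_ex; eexists; exact: rm0.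
apply: nearW => n; apply: le_trans (iter n r r0 rr) _.
have n0 : 0 < 2 ^+ n :> R by rewrite exprn_gt0.
have LL := truncated_moment_ge0 (r / 2 ^+ n).
rewrite /f (_ : 2 ^+ n * _ =
  r * m (r / 2 ^+ n) - 2 ^+ n * (6 * e' * L (r / 2 ^+ n))).
  by rewrite lerBlDr lerDl !mulr_ge0// ltW.
by field; rewrite gt_eqF.
Qed.

End slow_variation.

(** * Independence for bounded functions *)

Section bounded_measurable_functions.
Context d (T : measurableType d) (R : realType).

Definition bounded_measurable (f : T -> R) :=
  measurable_fun setT f /\ exists M : R, forall x, `|f x| <= M.

Lemma bounded_measurable_prod (I : Type) (s : seq I) (J : pred I) (F : I -> T -> R) :
  (forall i, bounded_measurable (F i)) ->
  bounded_measurable (fun w => \prod_(i <- s | J i) F i w).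
Proof.
move=> bF; elim: s => [|i s [mf [M HM]]].
  split; first by under eq_fun do rewrite big_nil; exact: measurable_cst.
  by exists 1 => w; rewrite big_nil normr1.
have [mi [Mi HMi]] := bF i; under eq_fun do rewrite big_cons.
case: (J i); split => //; [exact: measurable_funM| |by exists M].
by exists (Mi * M) => w; rewrite normrM ler_pM.
Qed.

Lemma bounded_measurable_lin a (f g : T -> R) : bounded_measurable f ->
  bounded_measurable g -> bounded_measurable (fun w => f w + a * g w).
Proof.
move=> [mf [Mf HMf]] [mg [Mg HMg]]; split; first by meas.
exists (Mf + `|a| * Mg) => w; rewrite (le_trans (ler_normD _ _))// lerD//.
by rewrite normrM ler_wpM2l.
Qed.

Lemma bounded_measurable_lim (M : R) (f_ : nat -> T -> R) f :
  (forall n w, `|f_ n w| <= M) -> (forall n, measurable_fun setT (f_ n)) ->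
  (forall w, f_ n w @[n --> \oo] --> f w) -> bounded_measurable f.
Proof.
move=> fM mf ff; split; first by apply: (measurable_fun_cvg mf) => w _.
exists M => w; have H : `|f_ n w| @[n --> \oo] --> `|f w| by apply: cvg_norm; exact: ff.
rewrite -(cvg_lim _ H)//; apply: limr_le; first by apply/cvg_ex; eexists; exact: H.
by apply: nearW => n.
Qed.

Lemma bounded_measurable_indic A : measurable A -> bounded_measurable (\1_A : T -> R).
Proof.
move=> mA; split; first exact: measurable_indic.
by exists 1 => x; rewrite indicE; case: (x \in A); rewrite ?normr1 ?normr0.
Qed.

End bounded_measurable_functions.

Section independence.
Context d (T : measurableType d) (R : realType) (P : probability T R).
Variable X : nat -> {RV P >-> R}.
Implicit Type g : nat -> R -> R.

Let mX i : measurable_fun setT (X i) := measurable_funPT (X i).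

Let bm_comp (g : R -> R) i : bounded_measurable g ->
  bounded_measurable (fun w => g (X i w)).
Proof.
move=> [mg [M HM]]; split; last by exists M.
exact: (measurableT_comp mg (mX i)).
Qed.

Lemma bounded_measurable_integrable (f : T -> R) : bounded_measurable f ->
  P.-integrable setT (EFin \o f).
Proof. by move=> [mf [M HM]]; exact: integrable_bounded HM. Qed.

Hypothesis indepX : mutually_independent P X.

Let prod_indic n (A : nat -> set R) : (forall i, measurable (A i)) ->
  \int[P]_w \prod_(i < n) \1_(A i) (X i w) = \prod_(i < n) \int[P]_w \1_(A i) (X i w).
Proof.
move=> mA; pose J := [fset i in iota 0 n]%fset.
have indE (B : set T) : measurable B -> (\int[P]_w \1_B w)%:E = P B.
  move=> mB; rewrite -EFin_Rintegral; last first.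
    by apply: bounded_measurable_integrable; exact: bounded_measurable_indic.
  by rewrite integral_indic// setIT.
have mXA i : measurable (X i @^-1` A i).
  by rewrite -[X in measurable X]setTI; exact: mX.
have := indepX (J := J) (A := A) (fun i _ => mA i).
rewrite (perm_big (iota 0 n)) /=; last first.
  by apply: uniq_perm; rewrite ?fset_uniq ?iota_uniq// => i; rewrite !inE.
rewrite -(big_mkord xpredT (fun i => \int[P]_w \1_(A i) (X i w))) /index_iota subn0.
rewrite -indE; last first.
  by apply: fin_bigcap_measurable => // i _; exact: mXA.
under eq_bigr do rewrite -indE//.
rewrite -(big_morph EFin (@EFinM R) erefl) => -[] => H.
apply: etrans; last exact: H.
apply: eq_Rintegral => w _; rewrite [in RHS]indicE.
have [/set_mem wA|wA] := boolP (w \in _).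
  apply: big1 => i _; rewrite indicE mem_set//.
  by apply: (wA i); rewrite /= !inE mem_iota add0n ltn_ord.
apply/eqP; apply: contraNT wA => wA.
apply/mem_set => i; rewrite /= !inE mem_iota add0n => /= iltn.
have [/set_mem//|Ai] := boolP (X i w \in A i).
case/negP: wA; apply/prodf_eq0; exists (Ordinal iltn) => //=.
by rewrite indicE (negbTE Ai).
Qed.

(** Multilinearity upgrades the product rule from events to bounded functions,
    one coordinate at a time. *)
Lemma independent_Rintegral_prod n g : (forall i, bounded_measurable (g i)) ->
  \int[P]_w \prod_(i < n) g i (X i w) = \prod_(i < n) \int[P]_w g i (X i w).
Proof.
(* The coordinates from [m] on are still indicators. *)
suff H m : forall g, (forall i, bounded_measurable (g i)) ->
    (forall i, (m <= i < n)%N -> exists2 A, measurable A & g i = \1_A) ->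
  \int[P]_w \prod_(i < n) g i (X i w) = \prod_(i < n) \int[P]_w g i (X i w).
  by move=> bg; apply: (H n) => // i; rewrite ltnNge andbN.
elim: m => [|m IH] {}g bg gA.
  have /choice[A HA] : forall i, exists A : set R, measurable A /\
      ((i < n)%N -> g i = \1_A).
    move=> i; have [iltn|] := ltnP i n; last by exists set0; split.
    by have [A mA ->] := gA i iltn; exists A.
  have := prod_indic n (A := A) (fun i => (HA i).1).
  under eq_Rintegral do under eq_bigr do rewrite -(HA _).2//.
  by under [in RHS]eq_bigr => i _ do under eq_Rintegral do rewrite -(HA _).2//.
have [mn|nm] := ltnP m n; last first.
  apply: IH => // i /andP[mi iltn].
  by have := leq_trans (leq_ltn_trans mi iltn) nm; rewrite ltnn.
pose up (h : R -> R) i := if i == m then h else g i.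
pose K (h : R -> R) := bounded_measurable h /\
  \int[P]_w \prod_(i < n) up h i (X i w) = \prod_(i < n) \int[P]_w up h i (X i w).
have bup h i : bounded_measurable h -> bounded_measurable (up h i).
  by rewrite /up; case: ifP.
pose im := Ordinal mn.
pose H w := \prod_(i < n | i != im) g i (X i w).
pose c := \prod_(i < n | i != im) \int[P]_w g i (X i w).
have upE h w : \prod_(i < n) up h i (X i w) = h (X m w) * H w.
  rewrite (bigD1 im)//= {1}/up eqxx; congr (_ * _); apply: eq_bigr => i im'.
  by rewrite /up -[m]/(val im) (inj_eq val_inj) (negbTE im').
have upE' h : \prod_(i < n) \int[P]_w up h i (X i w) = \int[P]_w h (X m w) * c.
  rewrite (bigD1 im)//= {1}/up eqxx; congr (_ * _); apply: eq_bigr => i im'.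
  by rewrite /up -[m]/(val im) (inj_eq val_inj) (negbTE im').
have bH : bounded_measurable H by apply: bounded_measurable_prod => i; exact: bm_comp.
have bhH h : bounded_measurable h -> bounded_measurable (fun w => h (X m w) * H w).
  move=> bh; have := bounded_measurable_prod (index_enum 'I_n) xpredT
    (fun i => bm_comp (nat_of_ord i) (bup h i bh)).
  by under eq_fun do rewrite upE.
have KE h : bounded_measurable h ->
    K h <-> \int[P]_w (h (X m w) * H w) = \int[P]_w h (X m w) * c.
  move=> bh; rewrite /K upE'; under eq_Rintegral do rewrite upE.
  by split => [[]|].
have : K (g m).
  have [mg [M HM]] := bg m.
  apply: (bounded_measurable_ind _ _ _ mg HM).
  - move=> A mA; split; first exact: bounded_measurable_indic.
    apply: IH => i.
      by apply: bup; exact: bounded_measurable_indic.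
    rewrite /up => /andP[mi iltn]; case: ifPn => im'; first by exists A.
    by apply: gA; rewrite iltn andbT ltn_neqAle eq_sym im'.
  - move=> a h1 h2 K1 K2; have [b1 _] := K1; have [b2 _] := K2.
    move: K1 K2; rewrite !KE//; last exact: bounded_measurable_lin.
    move=> E1 E2.
    have -> : \int[P]_w ((h1 (X m w) + a * h2 (X m w)) * H w) =
        \int[P]_w (h1 (X m w) * H w + a * (h2 (X m w) * H w)).
      by apply: eq_Rintegral => w _; ring.
    have i1 := bounded_measurable_integrable (bhH _ b1).
    have i2 := bounded_measurable_integrable (bhH _ b2).
    have j1 := bounded_measurable_integrable (bm_comp m b1).
    have j2 := bounded_measurable_integrable (bm_comp m b2).
    rewrite [LHS]RintegralD//; last exact: (integrable_scale a i2).
    have -> : \int[P]_w (h1 (X m w) + a * h2 (X m w)) =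
        \int[P]_w h1 (X m w) + a * \int[P]_w h2 (X m w).
      by rewrite RintegralD ?RintegralZl//; exact: (integrable_scale a j2).
    by rewrite RintegralZl// E1 E2; ring.
  - move=> N h_ h hN hh Kh.
    have bh_ k : bounded_measurable (h_ k) by case: (Kh k).
    have bh : bounded_measurable h.
      by apply: bounded_measurable_lim hN _ hh => k; case: (bh_ k).
    apply/KE => //.
    have [mH [MH HMH]] := bH.
    have l1 : \int[P]_w (h_ k (X m w) * H w) @[k --> \oo] --> \int[P]_w (h (X m w) * H w).
      apply: (@RintegralT_bct _ _ _ P (N * MH)).
      + by move=> k; case: (bhH _ (bh_ k)).
      + by move=> k w; rewrite normrM ler_pM.
      + by move=> w; apply: cvgM => //; exact: cvg_cst.
    have l2 : \int[P]_w h_ k (X m w) * c @[k --> \oo] --> \int[P]_w h (X m w) * c.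
      apply: cvgM; last exact: cvg_cst.
      apply: (@RintegralT_bct _ _ _ P N) => // k.
      by case: (bm_comp m (bh_ k)).
    have E : (fun k => \int[P]_w (h_ k (X m w) * H w)) = (fun k => \int[P]_w h_ k (X m w) * c).
      by apply/funext => k; apply/KE.
    by rewrite E in l1; exact: (cvg_unique _ l1 l2).
move=> [_]; have -> // : up (g m) = g.
by apply/funext => i; rewrite /up; case: eqP => // ->.
Qed.

End independence.

(** * Sums of an independent sample *)

Section sample_statistics.
Context d (T : measurableType d) (R : realType).
Variables (X : nat -> {mfun T >-> R}) (theta : R).
Implicit Types (n : nat) (w : T).

Lemma normalized_sumE (a b : R) n w :
  (\sum_(i < n) X i w - b) / a = (\sum_(i < n) (X i w - theta) - (b - n%:R * theta)) / a.
Proof. by rewrite sumrB sumr_const card_ord -mulr_natl; congr (_ / _); ring. Qed.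

Lemma measurable_sum_centered n :
  measurable_fun setT (fun w => \sum_(i < n) (X i w - theta)).
Proof. by apply: measurable_sum => i; exact: measurable_funB. Qed.

Lemma measurable_sum_squares n :
  measurable_fun setT (fun w => \sum_(i < n) (X i w - theta) ^+ 2).
Proof. by apply: measurable_sum => i; apply: measurable_funX; exact: measurable_funB. Qed.

Lemma sum_squares_ge0 n w : 0 <= \sum_(i < n) (X i w - theta) ^+ 2.
Proof. by apply: sumr_ge0 => i _; exact: sqr_ge0. Qed.

Lemma self_normalized_sumE n w : self_normalized_sum X theta n w =
  (\sum_(i < n) (X i w - theta)) / Num.sqrt (\sum_(i < n) (X i w - theta) ^+ 2).
Proof.
rewrite /self_normalized_sum /centered_sum; case: eqP => // V0.
by rewrite -[Num.sqrt _]/(root_sum_squares X theta n w) V0 invr0 mulr0.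
Qed.

Lemma self_normalized_sumM n w :
  self_normalized_sum X theta n w * Num.sqrt (\sum_(i < n) (X i w - theta) ^+ 2) =
  \sum_(i < n) (X i w - theta).
Proof.
rewrite /self_normalized_sum; case: eqP => [/eqP|/eqP V0]; last by rewrite divfK.
rewrite sqrtr_eq0 mul0r => V_le0.
have V0 : \sum_(i < n) (X i w - theta) ^+ 2 = 0.
  by apply/eqP; rewrite eq_le V_le0 sum_squares_ge0.
rewrite big1// => i _; apply/eqP; rewrite -sqrf_eq0; apply/eqP.
by apply: (psumr_eq0P _ V0) => // j _; exact: sqr_ge0.
Qed.

Lemma measurable_self_normalized_sum n :
  measurable_fun setT (self_normalized_sum X theta n).
Proof.
rewrite (_ : self_normalized_sum X theta n = fun w => (\sum_(i < n) (X i w - theta)) *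
    ((\sum_(i < n) (X i w - theta) ^+ 2) `^ (- 2^-1))).
  apply: measurable_funM; first exact: measurable_sum_centered.
  exact: (measurableT_comp (@measurable_powR R (- 2^-1)) (measurable_sum_squares n)).
by apply/funext => w; rewrite self_normalized_sumE powRN powR12_sqrt// sum_squares_ge0.
Qed.

End sample_statistics.

(** * Characteristic functions of sums *)

Section complex_power.
Context {R : realType}.
Implicit Types A B : R.

(** Real and imaginary parts of [(A + iB)^n]. *)
Fixpoint cpow A B n : R * R :=
  if n is n'.+1 then
    (A * (cpow A B n').1 - B * (cpow A B n').2,
     A * (cpow A B n').2 + B * (cpow A B n').1)
  else (1, 0).

Lemma sqr_cpow A B n :
  (cpow A B n).1 ^+ 2 + (cpow A B n).2 ^+ 2 = (A ^+ 2 + B ^+ 2) ^+ n.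
Proof.
elim: n => [|n IH]; first by rewrite /= expr1n expr0n addr0.
by rewrite [RHS]exprS -IH /=; ring.
Qed.

(** In the closed unit disc, [z ^ n] is Lipschitz in [z] with constant [n]. *)
Lemma cpow_near_real A B n : A ^+ 2 + B ^+ 2 <= 1 ->
  `|(cpow A B n).2| <= n%:R * `|B| /\
  `|(cpow A B n).1 - A ^+ n| <= n%:R * `|B|.
Proof.
move=> AB1.
have N (x : R) : x ^+ 2 <= 1 -> `|x| <= 1.
  rewrite -(real_normK (num_real x)); have := normr_ge0 x.
  by set y := `|x| => y0 y1; nra.
have A1 : `|A| <= 1 by apply: N; have := sqr_ge0 B; lra.
have CS k : (cpow A B k).1 ^+ 2 + (cpow A B k).2 ^+ 2 <= 1.
  by rewrite sqr_cpow exprn_ile1// addr_ge0 ?sqr_ge0.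
have C1 k : `|(cpow A B k).1| <= 1.
  by apply: N; have := CS k; have := sqr_ge0 (cpow A B k).2; lra.
have S1 k : `|(cpow A B k).2| <= 1.
  by apply: N; have := CS k; have := sqr_ge0 (cpow A B k).1; lra.
elim: n => [|n [IH1 IH2]].
  by split; rewrite /= ?expr0 ?subrr normr0 mul0r.
rewrite /= -natr1 mulrDl mul1r exprS; split.
  rewrite (le_trans (ler_normD _ _))// !normrM lerD//.
    by apply: le_trans IH1; rewrite ler_piMl.
  by rewrite ler_piMr.
have -> : A * (cpow A B n).1 - B * (cpow A B n).2 - A * A ^+ n =
  A * ((cpow A B n).1 - A ^+ n) - B * (cpow A B n).2 by ring.
rewrite (le_trans (ler_normB _ _))// !normrM lerD//.
  by apply: le_trans IH2; rewrite ler_piMl.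
by rewrite ler_piMr.
Qed.

End complex_power.

Lemma bounded_measurable_mul d (T : measurableType d) (R : realType) (f g : T -> R) :
  bounded_measurable f -> bounded_measurable g ->
  bounded_measurable (fun w => f w * g w).
Proof.
move=> [mf [Mf HMf]] [mg [Mg HMg]]; split; first exact: measurable_funM.
by exists (Mf * Mg) => w; rewrite normrM ler_pM.
Qed.

Section iid_sums.
Context d (T : measurableType d) (R : realType) (P : probability T R).
Variable X : nat -> {RV P >-> R}.
Hypothesis iidX : iid P X.
Variable theta : R.

Let Y i w : R := X i w - theta.

Let mX i : measurable_fun setT (X i) := measurable_funPT (X i).

Lemma iid_Rintegral h i : bounded_measurable h ->
  \int[P]_w h (X i w) = \int[P]_w h (X 0%N w).
Proof.
move=> [mh [M HM]].
have E j : \int[P]_w h (X j w) = fine (\int[distribution P (X j)]_x (h x)%:E)%E.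
  rewrite integral_distribution//.
    exact/measurable_EFinP.
  apply: (integrable_bounded P (f := fun w => h (X j w))); last by move=> w; exact: HM.
  exact: (measurableT_comp mh (mX j)).
rewrite !E; congr fine; apply: eq_measure_integral => B mB _.
by have [_] := iidX; apply.
Qed.

Lemma iid_Rintegral_prod h n : bounded_measurable h ->
  \int[P]_w \prod_(i < n) h (X i w) = (\int[P]_w h (X 0%N w)) ^+ n.
Proof.
move=> bh; rewrite (@independent_Rintegral_prod _ _ _ _ _ iidX.1 n (fun=> h))//.
under eq_bigr do rewrite iid_Rintegral//.
by rewrite prodr_const card_ord.
Qed.

Let bm_comp (g : R -> R) i : bounded_measurable g ->
  bounded_measurable (fun w => g (X i w)).
Proof.
move=> [mg [M HM]]; split; last by exists M.
exact: (measurableT_comp mg (mX i)).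
Qed.

Let bcos (t : R) : bounded_measurable (fun x : R => cos (t * (x - theta))).
Proof.
split; last by exists 1 => x; exact: cos_max.
by apply: measurable_cos_fun; apply: measurable_scale_fun; exact: measurable_funB.
Qed.

Let bsin (t : R) : bounded_measurable (fun x : R => sin (t * (x - theta))).
Proof.
split; last by exists 1 => x; exact: sin_max.
by apply: measurable_sin_fun; apply: measurable_scale_fun; exact: measurable_funB.
Qed.

Let A t := \int[P]_w cos (t * Y 0%N w).
Let B t := \int[P]_w sin (t * Y 0%N w).

Let up (g : nat -> R -> R) (m : nat) (h : R -> R) i := if i == m then h else g i.

Let bup g m h : (forall i, bounded_measurable (g i)) -> bounded_measurable h ->
  forall i, bounded_measurable (up g m h i).
Proof. by move=> bg bh i; rewrite /up; case: ifP. Qed.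

Let prod_up g (m n : nat) h w : (m < n)%N -> g m = (fun=> 1) ->
  \prod_(i < n) up g m h i (X i w) = h (X m w) * \prod_(i < n) g i (X i w).
Proof.
move=> mn gm; pose im := Ordinal mn.
rewrite (bigD1 im)//= [in RHS](bigD1 im)//= gm mul1r {1}/up eqxx.
congr (_ * _); apply: eq_bigr => i im'.
by rewrite /up -[m]/(val im) (inj_eq val_inj) (negbTE im').
Qed.

Let Rintegral_up g (m n : nat) h : (m < n)%N -> g m = (fun=> 1) ->
  (forall i, bounded_measurable (g i)) -> bounded_measurable h ->
  \int[P]_w \prod_(i < n) up g m h i (X i w) =
  \int[P]_w h (X 0%N w) * \int[P]_w \prod_(i < n) g i (X i w).
Proof.
move=> mn gm bg bh; have indep := iidX.1; pose im := Ordinal mn.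
rewrite independent_Rintegral_prod//; last exact: bup.
rewrite (@independent_Rintegral_prod _ _ _ _ _ indep n g)//.
rewrite (bigD1 im)//= [in RHS](bigD1 im)//= gm RintegralT_cst mul1r {1}/up eqxx.
rewrite iid_Rintegral//.
congr (_ * _); apply: eq_bigr => i im'.
by rewrite /up -[m]/(val im) (inj_eq val_inj) (negbTE im').
Qed.

(** The addition formulas peel off one summand at a time. The peeled summand has
    to be moved from the trigonometric factor into the product of bounded
    factors, which is why the identity is proved with arbitrary factors [g]
    in the coordinates that the partial sum leaves free. *)
Let cos_sin_partial t n m : (m <= n)%N -> forall g,
  (forall i, bounded_measurable (g i)) ->
  (forall i, (i < m)%N -> g i = (fun=> 1)) ->
  \int[P]_w (\prod_(i < n) g i (X i w) * cos (t * \sum_(i < m) Y i w)) =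
    (cpow (A t) (B t) m).1 * \int[P]_w \prod_(i < n) g i (X i w) /\
  \int[P]_w (\prod_(i < n) g i (X i w) * sin (t * \sum_(i < m) Y i w)) =
    (cpow (A t) (B t) m).2 * \int[P]_w \prod_(i < n) g i (X i w).
Proof.
elim: m => [|m IH] mn g bg g1.
  split; rewrite /= ?mul1r ?mul0r.
    by apply: eq_Rintegral => w _; rewrite big_ord0 mulr0 cos0 mulr1.
  under eq_Rintegral do rewrite big_ord0 mulr0 sin0 mulr0.
  exact: RintegralT_cst.
have gm : g m = fun=> 1 by exact: g1.
have g1m h i : (i < m)%N -> up g m h i = fun=> 1.
  by move=> im; rewrite /up ltn_eqF// g1// ltnS ltnW.
have [Cc Sc] := IH (ltnW mn) _ (bup m bg (bcos t)) (g1m _).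
have [Cs Ss] := IH (ltnW mn) _ (bup m bg (bsin t)) (g1m _).
have bS h k : bounded_measurable h -> bounded_measurable k ->
    P.-integrable setT (EFin \o (fun w =>
      \prod_(i < n) up g m h i (X i w) * k (t * \sum_(i < m) Y i w))).
  move=> bh [mk [M HM]]; apply: bounded_measurable_integrable.
  apply: bounded_measurable_mul.
    apply: (bounded_measurable_prod _ _ (F := fun (i : 'I_n) w => up g m h i (X i w))) => i.
    by apply: bm_comp; exact: bup.
  split; last by exists M => w; exact: HM.
  by apply: (measurableT_comp mk); apply: measurable_scale_fun; exact: measurable_sum_centered.
have bc : bounded_measurable (@cos R).
  split; last by exists 1 => x; exact: cos_max.
  by apply: continuous_measurable_fun; exact: continuous_cos.
have bs : bounded_measurable (@sin R).
  split; last by exists 1 => x; exact: sin_max.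
  by apply: continuous_measurable_fun; exact: continuous_sin.
rewrite !Rintegral_up// in Cc Sc Cs Ss.
split.
- rewrite (_ : \int[P]_w _ = \int[P]_w
    (\prod_(i < n) up g m (fun x => cos (t * (x - theta))) i (X i w) * cos (t * \sum_(i < m) Y i w) -
     \prod_(i < n) up g m (fun x => sin (t * (x - theta))) i (X i w) * sin (t * \sum_(i < m) Y i w))).
    rewrite RintegralB//; last 2 first.
    + exact: (bS _ _ (bcos t) bc).
    + exact: (bS _ _ (bsin t) bs).
    by rewrite Cc Ss -/(A t) -/(B t) /=; ring.
  apply: eq_Rintegral => w _; rewrite !prod_up// big_ord_recr/= mulrDr cosD -/(Y m w).
  ring.
- rewrite (_ : \int[P]_w _ = \int[P]_w
    (\prod_(i < n) up g m (fun x => cos (t * (x - theta))) i (X i w) * sin (t * \sum_(i < m) Y i w) +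
     \prod_(i < n) up g m (fun x => sin (t * (x - theta))) i (X i w) * cos (t * \sum_(i < m) Y i w))).
    rewrite RintegralD//; last 2 first.
    + exact: (bS _ _ (bcos t) bs).
    + exact: (bS _ _ (bsin t) bc).
    by rewrite Cs Sc -/(A t) -/(B t) /=; ring.
  apply: eq_Rintegral => w _; rewrite !prod_up// big_ord_recr/= mulrDr sinD -/(Y m w).
  ring.
Qed.

Let b1 : bounded_measurable (fun _ : R => 1 : R).
Proof. by split; [exact: measurable_cst|exists 1 => x; rewrite normr1]. Qed.

Lemma cos_sum_cpow t n :
  \int[P]_w cos (t * \sum_(i < n) Y i w) = (cpow (A t) (B t) n).1.
Proof.
have [+ _] := @cos_sin_partial t n n (leqnn n) (fun _ _ => 1) (fun=> b1) (fun _ _ => erefl).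
rewrite [X in _ * X](_ : _ = 1) ?mulr1; last first.
  by under eq_Rintegral do rewrite big1//; exact: RintegralT_cst.
by move=> <-; apply: eq_Rintegral => w _; rewrite [X in _ = X * _]big1// mul1r.
Qed.

Lemma sin_sum_cpow t n :
  \int[P]_w sin (t * \sum_(i < n) Y i w) = (cpow (A t) (B t) n).2.
Proof.
have [_ +] := @cos_sin_partial t n n (leqnn n) (fun _ _ => 1) (fun=> b1) (fun _ _ => erefl).
rewrite [X in _ * X](_ : _ = 1) ?mulr1; last first.
  by under eq_Rintegral do rewrite big1//; exact: RintegralT_cst.
by move=> <-; apply: eq_Rintegral => w _; rewrite [X in _ = X * _]big1// mul1r.
Qed.

(** The squared modulus of a characteristic function is again one, that of the
    difference of two independent copies. *)
Lemma cos_symmetrization t :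
  \int[P]_w cos (t * (X 0%N w - X 1%N w)) = A t ^+ 2 + B t ^+ 2.
Proof.
have pr h : bounded_measurable h ->
    \int[P]_w (h (X 0%N w) * h (X 1%N w)) = (\int[P]_w h (X 0%N w)) ^+ 2.
  move=> bh; rewrite -iid_Rintegral_prod//; apply: eq_Rintegral => w _.
  by rewrite !big_ord_recr big_ord0 /= mul1r.
have ip h : bounded_measurable h ->
    P.-integrable setT (EFin \o (fun w => h (X 0%N w) * h (X 1%N w))).
  move=> bh; apply: bounded_measurable_integrable; apply: bounded_measurable_mul.
  - exact: (bm_comp 0%N bh).
  - exact: (bm_comp 1%N bh).
rewrite -(pr _ (bcos t)) -(pr _ (bsin t)) -RintegralD//; last 2 first.
- exact: (ip _ (bcos t)).
- exact: (ip _ (bsin t)).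
apply: eq_Rintegral => w _; rewrite -cosB; congr cos; ring.
Qed.

End iid_sums.

(** * Consequences of Gaussian attraction *)

Section attraction.
Context d (T : measurableType d) (R : realType) (P : probability T R).
Variable X : nat -> {RV P >-> R}.
Variable theta : R.
Hypothesis iidX : iid P X.
Hypothesis iX : P.-integrable setT (EFin \o X 0%N).
Hypothesis EX : 'E_P[X 0%N]%E = theta%:E.
Local Notation gamma := (normal_prob (0 : R) 1).

Variables a b : nat -> R.
Hypothesis a0 : forall n, 0 < a n.
Let U n w : R := (\sum_(i < n) X i w - b n) / a n.
Hypothesis cvgU : cvg_in_distribution P U gamma.

Let Y w : R := X 0%N w - theta.
Let c n : R := b n - n%:R * theta.
Let A t := \int[P]_w cos (t * Y w).
Let B t := \int[P]_w sin (t * Y w).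
Local Notation L := (truncated_moment P Y).
Local Notation m := (truncated_mean_error P Y).
Let S n w := \sum_(i < n) (X i w - theta).

Let mX i : measurable_fun setT (X i) := measurable_funPT (X i).

Let mY : measurable_fun setT Y. Proof. exact: measurable_funB. Qed.

Let mS n : measurable_fun setT (S n). Proof. exact: measurable_sum_centered. Qed.

Let iY : P.-integrable setT (EFin \o Y).
Proof. by apply: integrable_sub => //; exact: integrable_cst. Qed.

Let EY : \int[P]_w Y w = 0.
Proof.
rewrite RintegralB//; last exact: integrable_cst.
rewrite RintegralT_cst; move: EX; rewrite EFin_expectation// => -[->].
by rewrite subrr.
Qed.

Let UE n w : U n w = (S n w - c n) / a n.
Proof. exact: normalized_sumE. Qed.

Let mU n : measurable_fun setT (U n).
Proof.
apply: measurable_funM => //; apply: measurable_funB => //.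
by apply: measurable_sum => i; exact: mX.
Qed.

Lemma cvg_Rintegral_in_distribution (f : R -> R) : continuous f ->
  (exists M : R, forall x, `|f x| <= M) ->
  \int[P]_w f (U n w) @[n --> \oo] --> \int[gamma]_x f x.
Proof.
move=> cf bf; have [M HM] := bf; have := cvgU cf bf.
have mf : measurable_fun setT f by exact: continuous_measurable_fun.
rewrite [X in _ --> X]EFin_expectation; last first.
  exact: (@integrable_bounded _ _ _ gamma M).
under eq_fun => n.
  rewrite EFin_expectation; last first.
    apply: (integrable_bounded P (M := M)) => [|w]; last exact: HM.
    exact: (measurableT_comp mf (mU n)).
  over.
by move=> /fine_cvg.
Qed.

Let icosS t n : P.-integrable setT
  (EFin \o (fun w => cos (t * \sum_(i < n) (X i w - theta)))).
Proof.
apply: (integrable_bounded P (M := 1)) => [|w]; last exact: cos_max.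
by apply: measurable_cos_fun; apply: measurable_scale_fun; exact: mS.
Qed.

Let isinS t n : P.-integrable setT
  (EFin \o (fun w => sin (t * \sum_(i < n) (X i w - theta)))).
Proof.
apply: (integrable_bounded P (M := 1)) => [|w]; last exact: sin_max.
by apply: measurable_sin_fun; apply: measurable_scale_fun; exact: mS.
Qed.

Let cos_U t n : \int[P]_w cos (t * U n w) =
  (cpow (A (t / a n)) (B (t / a n)) n).1 * cos (t * (c n / a n)) +
  (cpow (A (t / a n)) (B (t / a n)) n).2 * sin (t * (c n / a n)).
Proof.
rewrite -(cos_sum_cpow iidX) -(sin_sum_cpow iidX).
rewrite -!RintegralZr// -RintegralD//; [|exact: integrable_scaler..].
by apply: eq_Rintegral => w _; rewrite -cosB UE; congr cos; rewrite /S; ring.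
Qed.

Let sin_U t n : \int[P]_w sin (t * U n w) =
  (cpow (A (t / a n)) (B (t / a n)) n).2 * cos (t * (c n / a n)) -
  (cpow (A (t / a n)) (B (t / a n)) n).1 * sin (t * (c n / a n)).
Proof.
rewrite -(cos_sum_cpow iidX) -(sin_sum_cpow iidX).
rewrite -!RintegralZr// -RintegralB//; [|exact: integrable_scaler..].
by apply: eq_Rintegral => w _; rewrite -sinB UE; congr sin; rewrite /S; ring.
Qed.

Let cvg_cos_U t : \int[P]_w cos (t * U n w) @[n --> \oo] --> expR (- (t ^+ 2 / 2)).
Proof.
rewrite -gaussian_cos0; apply: (cvg_Rintegral_in_distribution (f := fun x => cos (t * x))).
  move=> x; apply: continuous_comp; last exact: continuous_cos.
  by apply: cvgM => //; exact: cvg_cst.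
by exists 1 => x; exact: cos_max.
Qed.

Let cvg_sin_U t : \int[P]_w sin (t * U n w) @[n --> \oo] --> 0.
Proof.
rewrite -[X in _ --> X](gaussian_sin0 t).
apply: (cvg_Rintegral_in_distribution (f := fun x => sin (t * x))).
  move=> x; apply: continuous_comp; last exact: continuous_sin.
  by apply: cvgM => //; exact: cvg_cst.
by exists 1 => x; exact: sin_max.
Qed.

(** The modulus of the characteristic function ignores the centering. *)
Let cvg_modulus t :
  (A (t / a n) ^+ 2 + B (t / a n) ^+ 2) ^+ n @[n --> \oo] --> expR (- t ^+ 2).
Proof.
have l : (\int[P]_w cos (t * U n w)) ^+ 2 + (\int[P]_w sin (t * U n w)) ^+ 2 @[n --> \oo]
    --> expR (- (t ^+ 2 / 2)) ^+ 2 + 0 ^+ 2.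
  apply: cvgD; rewrite !expr2; apply: cvgM; do ?[exact: cvg_cos_U|exact: cvg_sin_U].
rewrite expr0n addr0 -expRM_natl (_ : 2 * _ = - t ^+ 2) in l; last by field.
apply: cvg_trans l; apply: near_eq_cvg; apply: nearW => n.
rewrite -sqr_cpow cos_U sin_U; set z := t * (c n / a n).
set p := (cpow _ _ _).1; set q := (cpow _ _ _).2.
have := cos2Dsin2 z; set x := cos z; set y := sin z => xy.
have -> : (p * x + q * y) ^+ 2 + (q * x - p * y) ^+ 2 =
  (p ^+ 2 + q ^+ 2) * (x ^+ 2 + y ^+ 2) by ring.
by rewrite xy mulr1.
Qed.

Let D w := X 0%N w - X 1%N w.

Let cfD t : \int[P]_w cos (t * D w) = A t ^+ 2 + B t ^+ 2.
Proof. exact: (cos_symmetrization iidX theta). Qed.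

Let mD : measurable_fun setT D. Proof. exact: measurable_funB. Qed.

Lemma cvg_a_inv : (a n)^-1 @[n --> \oo] --> 0.
Proof. exact: (cvg_norming_inv a0 cvg_modulus mD cfD). Qed.

Lemma cvg_natmul_truncated_moment t : n%:R * L (t / a n) @[n --> \oo] --> t ^+ 2.
Proof. exact: (cvg_laplace mY iY EY a0 cvg_modulus mD cfD). Qed.

Let cvg_real_part t : n%:R * (1 - A (t / a n)) @[n --> \oo] --> t ^+ 2 / 2.
Proof. exact: (cvg_onem_real_part mY iY EY a0 cvg_modulus mD cfD). Qed.

Lemma truncated_mean_error_negligible e : 0 < e ->
  exists2 r0, 0 < r0 & forall r, 0 < r -> r <= r0 -> r * m r <= e * L r.
Proof.
exact: (truncated_mean_error_small mY iY a0 cvg_a_inv cvg_natmul_truncated_moment).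
Qed.

Lemma truncated_moment_halving : exists2 r0, 0 < r0 &
  forall r, 0 < r -> r <= r0 -> 3 * L (r / 2) <= L r.
Proof.
exact: (truncated_moment_half mY a0 cvg_a_inv cvg_natmul_truncated_moment).
Qed.

Lemma truncated_moment_pos r : 0 < r -> 0 < L r.
Proof. exact: (truncated_moment_gt0 mY a0 cvg_a_inv cvg_natmul_truncated_moment). Qed.

Let satsq_norml (t y : R) : satsq (`|t| * y) = satsq (t * y).
Proof. by rewrite /satsq !exprMn real_normK ?num_real. Qed.

(** Since [E Y = 0], the imaginary part only sees [sin - id]. *)
Let norm_B t : `|B t| <= 4 * (`|t| * m `|t|).
Proof.
have -> : B t = \int[P]_w (sin (t * Y w) - t * Y w).
  rewrite RintegralB//; last exact: integrable_scale.
    by rewrite RintegralZl// EY mulr0 subr0.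
  by apply: (integrable_bounded P (M := 1)) => [|w]; [meas|exact: sin_max].
have i := integrable_norm_satsq mY iY `|t|.
rewrite -RintegralZl// -RintegralZl//; last exact: integrable_scale.
apply: norm_RintegralT_le; [|by meas|].
- by apply: integrable_scale; exact: integrable_scale.
- move=> w; apply: le_trans (sin_sub_id_satsq _) _.
  by rewrite satsq_norml normrM !mulrA.
Qed.

Let cvg_natmul_B t : n%:R * B (t / a n) @[n --> \oo] --> 0.
Proof.
have [->|t0] := eqVneq t 0.
  rewrite (_ : (fun n => _) = cst 0); first exact: cvg_cst.
  apply/funext => n; rewrite /B mul0r.
  under eq_Rintegral do rewrite mul0r sin0.
  by rewrite RintegralT_cst mulr0.
apply/cvgr0Pnorm_le => e e0.
pose q := e / (4 * (t ^+ 2 + 1)).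
have t2 : 0 < 4 * (t ^+ 2 + 1) by have := sqr_ge0 t; lra.
have q0 : 0 < q by rewrite divr_gt0.
have [r0 r00 Hr] := truncated_mean_error_negligible q0.
near=> n.
have tn : 0 < `|t / a n| by rewrite normr_gt0 mulf_neq0// invr_eq0 gt_eqF.
have tr : `|t / a n| <= r0.
  rewrite normrM (gtr0_norm (_ : 0 < (a n)^-1)) ?invr_gt0//.
  rewrite mulrC -ler_pdivlMr ?normr_gt0//.
  near: n; apply: cvgr_le cvg_a_inv _ _; by rewrite divr_gt0 ?normr_gt0.
have nL : n%:R * L `|t / a n| <= t ^+ 2 + 1.
  rewrite (_ : L `|t / a n| = L (t / a n)); last first.
    by apply: eq_Rintegral => w _; rewrite satsq_norml.
  near: n; apply: cvgr_le (@cvg_natmul_truncated_moment t) _ _; by rewrite ltrDl.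
rewrite normrM ger0_norm//.
apply: (@le_trans _ _ (n%:R * (4 * (q * L `|t / a n|)))).
  by rewrite ler_wpM2l// (le_trans (norm_B _))// ler_pM2l// Hr.
rewrite (_ : e = q * (4 * (t ^+ 2 + 1))); last by rewrite /q divfK ?gt_eqF.
rewrite (_ : n%:R * _ = q * (4 * (n%:R * L `|t / a n|))); last by ring.
by rewrite ler_pM2l// ler_pM2l.
Unshelve. all: by end_near. Qed.

Let AB_le1 t : A t ^+ 2 + B t ^+ 2 <= 1.
Proof.
rewrite -cfD -(RintegralT_cst P 1); apply: le_RintegralT => [||w].
- by apply: (integrable_bounded P (M := 1)) => [|w]; [meas|exact: cos_max].
- exact: integrable_cst.
- exact: cos_le1.
Qed.

(** The imaginary part being negligible, the characteristic function of the
    centered normalized sum is close to the real number [A (t / a n) ^+ n],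
    which has the Gaussian limit. Comparison with the limit for [U] leaves
    [cos (t * (c n / a n)) --> 1] for every [t], and a Gaussian average over [t]
    gives [expR (- (c n / a n) ^+ 2 / 2) --> 1]. *)
Lemma cvg_centering : c n / a n @[n --> \oo] --> 0.
Proof.
have nB (t : R) : n%:R * `|B (t / a n)| @[n --> \oo] --> 0.
  have l : `|n%:R * B (t / a n)| @[n --> \oo] --> `|0 : R|.
    by apply: cvg_norm; exact: cvg_natmul_B.
  rewrite normr0 in l; apply: cvg_trans l; apply: near_eq_cvg; apply: nearW => n.
  by rewrite normrM ger0_norm.
have cosl (t : R) : cos (t * (c n / a n)) @[n --> \oo] --> (1 : R).
  pose p n := A (t / a n) ^+ n.
  have pl : p n @[n --> \oo] --> expR (- (t ^+ 2 / 2)).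
    have l := cvg_expr_onem (@cvg_real_part t); apply: cvg_trans l.
    by apply: near_eq_cvg; apply: nearW => n; rewrite subKr.
  have dl : \int[P]_w cos (t * U n w) - p n * cos (t * (c n / a n)) @[n --> \oo] --> 0.
    apply: norm_cvg0; apply: (@squeeze_cvgr _ _ _ _ (cst 0)
      (fun n => n%:R * `|B (t / a n)| + n%:R * `|B (t / a n)|)).
    - apply: nearW => n; rewrite normr_ge0/= cos_U.
      have [H2 H1] := cpow_near_real n (AB_le1 (t / a n)).
      rewrite addrAC -mulrBl (le_trans (ler_normD _ _))// !normrM lerD//.
      + by apply: le_trans H1; rewrite ler_piMr// cos_max.
      + by apply: le_trans H2; rewrite ler_piMr// sin_max.
    - exact: cvg_cst.
    - by rewrite -[X in _ --> X](addr0 0); apply: cvgD.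
  have pc : p n * cos (t * (c n / a n)) @[n --> \oo] --> expR (- (t ^+ 2 / 2)).
    have l : \int[P]_w cos (t * U n w) -
        (\int[P]_w cos (t * U n w) - p n * cos (t * (c n / a n))) @[n --> \oo] -->
        expR (- (t ^+ 2 / 2)) - 0.
      by apply: cvgB; [exact: cvg_cos_U|exact: dl].
    rewrite subr0 in l; apply: cvg_trans l; apply: near_eq_cvg; apply: nearW => n.
    by rewrite subKr.
  have q := expR_gt0 (- (t ^+ 2 / 2)).
  have l : p n * cos (t * (c n / a n)) / p n @[n --> \oo] -->
      expR (- (t ^+ 2 / 2)) / expR (- (t ^+ 2 / 2)).
    by apply: cvgM => //; apply: cvgV => //; rewrite gt_eqF.
  rewrite divff ?gt_eqF// in l; apply: cvg_trans l; apply: near_eq_cvg; near=> n.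
  rewrite mulrAC divff ?mul1r// gt_eqF//.
  by near: n; apply: cvgr_gt pl _ _.
have el : expR (- ((c n / a n) ^+ 2 / 2)) @[n --> \oo] --> (1 : R).
  have : \int[gamma]_t cos (t * (c n / a n)) @[n --> \oo] --> \int[gamma]_t (1 : R).
    apply: (@RintegralT_bct _ _ _ gamma 1 (fun n t => cos (t * (c n / a n)))) => //.
    - move=> n; apply: measurable_cos_fun; apply: measurable_funM => //.
    - by move=> n t; exact: cos_max.
  rewrite (RintegralT_cst gamma); apply: cvg_trans; apply: near_eq_cvg; apply: nearW => n.
  by rewrite -gaussian_cos0; under eq_Rintegral do rewrite mulrC.
have sl : (c n / a n) ^+ 2 @[n --> \oo] --> 0.
  have l : -2 * ln (expR (- ((c n / a n) ^+ 2 / 2))) @[n --> \oo] --> -2 * ln 1.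
    apply: cvgM; first exact: cvg_cst.
    by apply: continuous_cvg => //; apply: continuous_ln; exact: ltr01.
  rewrite ln1 mulr0 in l; apply: cvg_trans l; apply: near_eq_cvg; apply: nearW => n.
  by rewrite expRK; field; rewrite gt_eqF.
apply: norm_cvg0.
have : Num.sqrt ((c n / a n) ^+ 2) @[n --> \oo] --> Num.sqrt 0.
  by apply: continuous_cvg => //; exact: sqrt_continuous.
rewrite sqrtr0; apply: cvg_trans; apply: near_eq_cvg; apply: nearW => n.
by rewrite sqrtr_sqr.
Unshelve. all: by end_near. Qed.

Lemma laplace_sum_squares r n :
  \int[P]_w expR (- (r ^+ 2 * \sum_(i < n) (X i w - theta) ^+ 2)) = (1 - L r) ^+ n.
Proof.
have bh : bounded_measurable (fun x : R => expR (- (r * (x - theta)) ^+ 2)).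
  split.
    by apply: measurable_expR_fun; apply: measurable_funN; apply: measurable_funX;
       apply: measurable_scale_fun; exact: measurable_funB.
  by exists 1 => x; rewrite ger0_norm ?expR_ge0// expRN_le1// sqr_ge0.
have -> : 1 - L r = \int[P]_w expR (- (r * (X 0%N w - theta)) ^+ 2).
  rewrite -[X in X - _](RintegralT_cst P) -RintegralB//; last 2 first.
  - exact: integrable_cst.
  - exact: integrable_satsq.
  by apply: eq_Rintegral => w _; rewrite /satsq subKr.
rewrite -(iid_Rintegral_prod iidX n bh); apply: eq_Rintegral => w _.
rewrite -expR_sum; congr expR; rewrite mulr_sumr -sumrN.
by apply: eq_bigr => i _; rewrite exprMn.
Qed.

(** The sum of squares divided by [a n ^+ 2] tends to 1, expressed by Laplace
    transforms. *)
Lemma cvg_laplace_sum_squares t :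
  \int[P]_w expR (- ((t / a n) ^+ 2 * \sum_(i < n) (X i w - theta) ^+ 2)) @[n --> \oo]
    --> expR (- t ^+ 2).
Proof.
under eq_fun do rewrite laplace_sum_squares.
by apply: cvg_expr_onem; exact: cvg_natmul_truncated_moment.
Qed.

End attraction.

(** * A uniform exponential moment of the self-normalized sum *)

Section hyperbolic_cosine.
Context {R : realType}.
Implicit Types x y : R.

Definition two_cosh x : R := expR x + expR (- x).

Lemma two_coshN x : two_cosh (- x) = two_cosh x.
Proof. by rewrite /two_cosh opprK addrC. Qed.

Lemma two_cosh_norm x : two_cosh `|x| = two_cosh x.
Proof. by have [_|_] := ger0P x; rewrite ?two_coshN. Qed.

Lemma two_cosh_ge2 x : 2 <= two_cosh x.
Proof.
rewrite /two_cosh; have := expRxMexpNx_1 x; have := expR_gt0 x; have := expR_gt0 (- x).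
set p := expR x; set q := expR (- x) => p0 q0 pq.
by have := sqr_ge0 (p - q); nra.
Qed.

Lemma le_two_cosh x y : `|x| <= `|y| -> two_cosh x <= two_cosh y.
Proof.
rewrite -(two_cosh_norm x) -(two_cosh_norm y); set a := `|x|; set b := `|y| => ab.
have a0 : 0 <= a by exact: normr_ge0.
rewrite /two_cosh -subr_ge0.
have -> : expR b + expR (- b) - (expR a + expR (- a)) =
    (expR b - expR a) * (1 - expR (- a) * expR (- b)).
  have := expRxMexpNx_1 a; have := expRxMexpNx_1 b.
  set p := expR a; set q := expR b; set p' := expR (- a); set q' := expR (- b).
  move=> qq pp; rewrite mulrBr mulr1 mulrBl.
  have -> : q * (p' * q') = p' by rewrite mulrCA qq mulr1.
  have -> : p * (p' * q') = q' by rewrite mulrA pp mul1r.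
  by ring.
rewrite mulr_ge0 ?subr_ge0 ?ler_expR// -expRD -opprD expRN_le1//.
by rewrite addr_ge0// (le_trans a0).
Qed.

Lemma expR_norm_le_two_cosh x : expR `|x| <= two_cosh x.
Proof. by rewrite -two_cosh_norm /two_cosh lerDl expR_ge0. Qed.

End hyperbolic_cosine.

Section real_estimates.
Context {R : realType}.

Lemma expr_diff_le (p q : R) n : 0 <= q -> q <= p ->
  p ^+ n.+1 - q ^+ n.+1 <= n.+1%:R * (p - q) * p ^+ n.
Proof.
move=> q0 qp; have p0 := le_trans q0 qp.
elim: n => [|n IH]; first by rewrite expr0 !expr1 mul1r mulr1.
have -> : p ^+ n.+2 - q ^+ n.+2 = p ^+ n.+1 * (p - q) + q * (p ^+ n.+1 - q ^+ n.+1).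
  by rewrite [p ^+ n.+2]exprS [q ^+ n.+2]exprS; ring.
have -> : n.+2%:R * (p - q) * p ^+ n.+1 =
    p ^+ n.+1 * (p - q) + p * (n.+1%:R * (p - q) * p ^+ n).
  by rewrite -natr1 [p ^+ n.+1]exprS; ring.
rewrite lerD2l; apply: (@le_trans _ _ (p * (p ^+ n.+1 - q ^+ n.+1))).
  by rewrite ler_wpM2r// subr_ge0 lerXn2r ?nnegrE.
by rewrite ler_wpM2l.
Qed.

(** The summand is dominated by a telescoping difference because the scales
    shrink geometrically. *)
Lemma geometric_scales_sum (x : nat -> R) J : (forall j, 0 <= x j) ->
  (forall j, 3 * x j.+1 <= x j) ->
  \sum_(j < J) x j * expR (- (x j / 4)) <= 6.
Proof.
move=> x0 x3.
apply: (@le_trans _ _ (6 * (expR (- (x J / 4)) - expR (- (x 0%N / 4))))).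
  elim: J => [|J IH]; first by rewrite big_ord0 subrr mulr0.
  rewrite big_ord_recr /=.
  suff : x J * expR (- (x J / 4)) <= 6 * (expR (- (x J.+1 / 4)) - expR (- (x J / 4))).
    lra.
  have H1 : expR (- (x J / 4)) * (1 + x J / 6) <= expR (- (x J.+1 / 4)).
    have -> : - (x J.+1 / 4) = - (x J / 4) + (x J / 4 - x J.+1 / 4) by ring.
    rewrite expRD ler_wpM2l ?expR_ge0//; apply: le_trans (expR_ge1Dx _).
    by have := x3 J; lra.
  lra.
have := expR_ge0 (- (x 0%N / 4)).
have : expR (- (x J / 4)) <= 1 by rewrite expRN_le1// divr_ge0.
lra.
Qed.

Lemma sqr_sum_le n (y : 'I_n -> R) :
  (\sum_(i < n) y i) ^+ 2 <= n%:R * \sum_(i < n) y i ^+ 2.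
Proof.
elim: n y => [|n IH] y; first by rewrite !big_ord0 expr0n mul0r.
rewrite !big_ord_recl; set s := \sum_(i < n) y _; set v := \sum_(i < n) _ ^+ 2.
have sv : s ^+ 2 <= n%:R * v by exact: IH.
have v0 : 0 <= v by apply: sumr_ge0 => i _; exact: sqr_ge0.
set z := y ord0; rewrite -natr1.
have [n0|n0] := eqVneq (n%:R : R) 0.
  have s0 : s = 0 by apply/eqP; rewrite -sqrf_eq0 eq_le sqr_ge0 andbT; rewrite n0 mul0r in sv.
  by rewrite s0 n0; nra.
have nR : 0 < n%:R :> R by rewrite lt_neqAle eq_sym n0 ler0n.
set k := (n%:R : R) in sv n0 nR *.
have : 2 * z * s <= v + k * z ^+ 2.
  rewrite -(ler_pM2l nR); have := sqr_ge0 (s - k * z); nra.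
nra.
Qed.

Lemma crossing_index (u : nat -> R) J : 1 <= u 0%N -> u J < 1 ->
  exists2 j, (j < J)%N & 1 <= u j /\ u j.+1 < 1.
Proof.
move=> u0; elim: J => [|J IH] uJ; first by rewrite ltNge u0 in uJ.
have [u1|/IH[j jJ H]] := leP 1 (u J); first by exists J.
by exists j => //; rewrite ltnS ltnW.
Qed.

End real_estimates.

Section exponential_moment.
Context d (T : measurableType d) (R : realType) (P : probability T R).
Variable X : nat -> {RV P >-> R}.
Variable theta : R.
Hypothesis iidX : iid P X.
Hypothesis iX : P.-integrable setT (EFin \o X 0%N).
Hypothesis EX : 'E_P[X 0%N]%E = theta%:E.

Let Y w : R := X 0%N w - theta.
Local Notation L := (truncated_moment P Y).
Local Notation m := (truncated_mean_error P Y).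

Hypothesis mean_error_small : forall e, 0 < e ->
  exists2 r0, 0 < r0 & forall r, 0 < r -> r <= r0 -> r * m r <= e * L r.
Hypothesis halving : exists2 r0, 0 < r0 &
  forall r, 0 < r -> r <= r0 -> 3 * L (r / 2) <= L r.
Hypothesis L_gt0 : forall r, 0 < r -> 0 < L r.

Let mX i : measurable_fun setT (X i) := measurable_funPT (X i).

Let mY : measurable_fun setT Y. Proof. exact: measurable_funB. Qed.

Let iY : P.-integrable setT (EFin \o Y).
Proof. by apply: integrable_sub => //; exact: integrable_cst. Qed.

Let EY : \int[P]_w Y w = 0.
Proof.
rewrite RintegralB//; last exact: integrable_cst.
rewrite RintegralT_cst; move: EX; rewrite EFin_expectation// => -[->].
by rewrite subrr.
Qed.

Let S n w := \sum_(i < n) (X i w - theta).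
Let V2 n w := \sum_(i < n) (X i w - theta) ^+ 2.

Let drift s r (x : R) := expR (s * (r * (x - theta)) - 2 * (r * (x - theta)) ^+ 2).

Let bdrift s r : s ^+ 2 <= 1 -> bounded_measurable (drift s r).
Proof.
move=> s1; split.
  have mx : measurable_fun setT (fun x : R => x - theta) by exact: measurable_funB.
  by rewrite /drift; meas.
exists (expR 1) => x; rewrite ger0_norm ?expR_ge0// ler_expR.
set u := r * _; have := sqr_ge0 (s - u); have := sqr_ge0 u; nra.
Qed.

Let driftE s r n w :
  expR (s * (r * S n w) - 2 * (r ^+ 2 * V2 n w)) = \prod_(i < n) drift s r (X i w).
Proof.
rewrite -expR_sum; congr expR; rewrite /S /V2 !mulr_sumr -sumrB.
by apply: eq_bigr => i _; rewrite exprMn.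
Qed.

Let idrift s r n : s ^+ 2 <= 1 -> P.-integrable setT
  (EFin \o (fun w => expR (s * (r * S n w) - 2 * (r ^+ 2 * V2 n w)))).
Proof.
move=> s1; apply: bounded_measurable_integrable.
under eq_fun do rewrite driftE.
apply: (bounded_measurable_prod _ _ (F := fun (i : 'I_n) w => drift s r (X i w))) => i.
have [md [M HM]] := bdrift r s1; split; last by exists M.
exact: (measurableT_comp md (mX i)).
Qed.

Let Rintegral_drift s r n : s ^+ 2 <= 1 ->
  \int[P]_w expR (s * (r * S n w) - 2 * (r ^+ 2 * V2 n w)) =
  (\int[P]_w drift s r (X 0%N w)) ^+ n.
Proof.
move=> s1; rewrite -(iid_Rintegral_prod iidX n (bdrift r s1)).
by apply: eq_Rintegral => w _; rewrite driftE.
Qed.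

(** With [r * m r] below [L r / 600], the error [150 * r * m r] of
    [expR_drift_le] uses up half of the gain [L r / 2]; the linear term has mean
    zero. *)
Let drift_le s r : s = 1 \/ s = -1 -> 0 < r -> r * m r <= 600^-1 * L r ->
  \int[P]_w drift s r (X 0%N w) <= 1 - L r / 4.
Proof.
move=> s1 r0 mr.
have s2 : s ^+ 2 <= 1 by case: s1 => ->; rewrite ?sqrrN expr1n.
have ns : `|s| = 1 by case: s1 => ->; rewrite ?normrN normr1.
have iL := integrable_satsq P mY r.
have im := integrable_norm_satsq mY iY r.
have i1 : P.-integrable setT (EFin \o (fun w => 1 + (s * r) * Y w - 2^-1 * satsq (r * Y w))).
  apply: integrable_sub; last exact: integrable_scale.
  by apply: integrable_add; [exact: integrable_cst|exact: integrable_scale].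
have i2 : P.-integrable setT (EFin \o (fun w => (150 * r) * (`|Y w| * satsq (r * Y w)))).
  exact: integrable_scale.
apply: (@le_trans _ _ (\int[P]_w (1 + (s * r) * Y w - 2^-1 * satsq (r * Y w) +
    (150 * r) * (`|Y w| * satsq (r * Y w))))).
  apply: le_RintegralT.
  - apply: bounded_measurable_integrable; have [md [M HM]] := bdrift r s2.
    by split; [exact: (measurableT_comp md (mX 0%N))|exists M].
  - exact: integrable_add.
  - move=> w; have := expR_drift_le (s * (r * Y w)).
    have -> : satsq (s * (r * Y w)) = satsq (r * Y w).
      by case: s1 => ->; rewrite ?mul1r ?mulN1r ?satsqN.
    rewrite normrM ns mul1r normrM (gtr0_norm r0) (exprMn _ s).
    have -> : s ^+ 2 = 1 by case: s1 => ->; rewrite ?sqrrN expr1n.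
    rewrite mul1r /drift -/(Y w) => /le_trans; apply.
    by rewrite le_eqVlt; apply/orP; left; apply/eqP; field.
rewrite (RintegralD measurableT i1 i2) (RintegralZl _ measurableT im).
rewrite RintegralB//; [|by apply: integrable_add; [exact: integrable_cst|exact: integrable_scale]|exact: integrable_scale].
rewrite (RintegralZl _ measurableT iL) RintegralD//; [|exact: integrable_cst|exact: integrable_scale].
rewrite RintegralT_cst (RintegralZl _ measurableT iY) EY mulr0 addr0.
by move: mr; rewrite -/(L r) -/(m r); lra.
Qed.

(** Subtracting the value 2 of [two_cosh] at 0 makes the expectation of [G]
    small when [n%:R * L r] is small, which a bare exponential would not be. *)
Let G r n w : R := (two_cosh (r * S n w) - 2) * expR (- (2 * (r ^+ 2 * V2 n w))).

Let G_ge0 r n w : 0 <= G r n w.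
Proof. by rewrite mulr_ge0 ?expR_ge0// subr_ge0 two_cosh_ge2. Qed.

Let GE r n w : G r n w = expR (1 * (r * S n w) - 2 * (r ^+ 2 * V2 n w)) +
  expR (-1 * (r * S n w) - 2 * (r ^+ 2 * V2 n w)) -
  2 * expR (0 * (r * S n w) - 2 * (r ^+ 2 * V2 n w)).
Proof. by rewrite /G /two_cosh !expRD mul1r mulN1r mul0r expR0; ring. Qed.

Let sqr1 : (1 : R) ^+ 2 <= 1. Proof. by rewrite expr1n. Qed.
Let sqrN1 : (-1 : R) ^+ 2 <= 1. Proof. by rewrite sqrrN expr1n. Qed.
Let sqr0 : (0 : R) ^+ 2 <= 1. Proof. by rewrite expr0n. Qed.

Let iG r n : P.-integrable setT (EFin \o G r n).
Proof.
rewrite (_ : G r n = fun w => expR (1 * (r * S n w) - 2 * (r ^+ 2 * V2 n w)) +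
  expR (-1 * (r * S n w) - 2 * (r ^+ 2 * V2 n w)) -
  2 * expR (0 * (r * S n w) - 2 * (r ^+ 2 * V2 n w))); last first.
  by apply/funext => w; exact: GE.
apply: integrable_sub; last by apply: integrable_scale; exact: idrift.
by apply: integrable_add; exact: idrift.
Qed.

Let drift0 r : \int[P]_w drift 0 r (X 0%N w) = 1 - L (Num.sqrt 2 * r).
Proof.
have iL := integrable_satsq P mY (Num.sqrt 2 * r).
rewrite -[X in X - _](RintegralT_cst P) -(RintegralB measurableT (integrable_cst P 1) iL).
apply: eq_Rintegral => w _; rewrite /drift /satsq subKr mul0r sub0r -/(Y w).
by congr (expR (- _)); rewrite !exprMn sqr_sqrtr//; ring.
Qed.

Let L_le1 r : L r <= 1.
Proof.
rewrite -(RintegralT_cst P 1); apply: le_RintegralT => [||w].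
- exact: integrable_satsq.
- exact: integrable_cst.
- exact: satsq_le1.
Qed.

Let Rintegral_G r n : 0 < r -> r * m r <= 600^-1 * L r ->
  \int[P]_w G r n w <= 7 * (n%:R * L r * expR (- (n%:R * L r / 4))).
Proof.
move=> r0 mr; have L0 := ltW (L_gt0 r0); have L1 := L_le1 r.
have -> : \int[P]_w G r n w = (\int[P]_w drift 1 r (X 0%N w)) ^+ n +
    (\int[P]_w drift (-1) r (X 0%N w)) ^+ n - 2 * (\int[P]_w drift 0 r (X 0%N w)) ^+ n.
  rewrite -!Rintegral_drift//.
  under eq_Rintegral do rewrite GE.
  have i1 := idrift r n sqr1; have i2 := idrift r n sqrN1; have i3 := idrift r n sqr0.
  rewrite (RintegralB measurableT (integrable_add i1 i2) (integrable_scale 2 i3)).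
  by rewrite (RintegralD measurableT i1 i2) (RintegralZl 2 measurableT i3).
set p1 := \int[P]_w drift 1 r _; set p2 := \int[P]_w drift (-1) r _.
set q := \int[P]_w drift 0 r _.
have p1le : p1 <= 1 - L r / 4 by apply: drift_le => //; left.
have p2le : p2 <= 1 - L r / 4 by apply: drift_le => //; right.
clear mr.
have p10 : 0 <= p1 by apply: Rintegral_ge0 => w _; exact: expR_ge0.
have p20 : 0 <= p2 by apply: Rintegral_ge0 => w _; exact: expR_ge0.
have q0 : 0 <= q by apply: Rintegral_ge0 => w _; exact: expR_ge0.
have qge : 1 - 2 * L r <= q.
  rewrite /q drift0 lerB// truncated_moment_sqrt2//.
  have : 0 <= \int[P]_w (satsq (r * Y w) ^+ 2) by apply: Rintegral_ge0 => w _; exact: sqr_ge0.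
  lra.
case: n => [|n]; first by rewrite !expr0 !mul0r mulr0; lra.
pose p := 1 - L r / 4; have p0 : 0 <= p by rewrite /p; lra.
suff K x : 0 <= x -> x <= p -> x ^+ n.+1 - q ^+ n.+1 <=
    7 / 2 * (n.+1%:R * L r * expR (- (n.+1%:R * L r / 4))).
  have := K _ p10 p1le; have := K _ p20 p2le.
  move: (p1 ^+ _) (p2 ^+ _) (q ^+ _) (_ * expR _) => x1 x2 y z; lra.
move=> x0 xp; have nL : 0 <= n.+1%:R * L r by rewrite mulr_ge0.
have rhs0 : 0 <= 7 / 2 * (n.+1%:R * L r * expR (- (n.+1%:R * L r / 4))).
  by rewrite mulr_ge0// mulr_ge0// expR_ge0.
apply: (@le_trans _ _ (p ^+ n.+1 - q ^+ n.+1)).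
  by rewrite lerB// lerXn2r ?nnegrE.
have [pq|qp] := leP p q.
  by apply: le_trans rhs0; rewrite subr_le0 lerXn2r ?nnegrE.
apply: le_trans (expr_diff_le n q0 (ltW qp)) _.
have pn : p ^+ n <= 2 * expR (- (n.+1%:R * L r / 4)).
  have e1 : p <= expR (- (L r / 4)) by have := expR_ge1Dx (- (L r / 4)); rewrite /p; lra.
  apply: (@le_trans _ _ (expR (- (L r / 4)) ^+ n)); first by rewrite lerXn2r ?nnegrE ?expR_ge0.
  rewrite -expRM_natl (_ : - (n.+1%:R * L r / 4) = n%:R * - (L r / 4) + - (L r / 4)); last first.
    by rewrite -natr1; field.
  rewrite expRD mulrCA ler_peMr ?expR_ge0//.
  by have := expR_ge1Dx (- (L r / 4)); lra.
have pq7 : p - q <= 7 / 4 * L r by rewrite /p; lra.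
have pq0 : 0 <= p - q by rewrite subr_ge0 ltW.
have n0 : 0 <= n.+1%:R :> R by [].
have e0 := expR_ge0 (- (n.+1%:R * L r / 4)).
apply: (@le_trans _ _ (n.+1%:R * (7 / 4 * L r) * (2 * expR (- (n.+1%:R * L r / 4))))).
  by apply: ler_pM; rewrite ?mulr_ge0 ?exprn_ge0// ler_wpM2l.
by rewrite le_eqVlt; apply/orP; left; apply/eqP; field.
Qed.

Let Z n w := self_normalized_sum X theta n w.

Let V2_ge0 n w : 0 <= V2 n w. Proof. exact: sum_squares_ge0. Qed.

Let ZE n w : Z n w = S n w / Num.sqrt (V2 n w).
Proof. exact: self_normalized_sumE. Qed.

Let sqr_Z n w : Z n w ^+ 2 <= n%:R.
Proof.
rewrite ZE exprMn exprVn sqr_sqrtr//.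
have := V2_ge0 n w; rewrite le_eqVlt => /predU1P[<-|V0]; first by rewrite invr0 mulr0.
by rewrite ler_pdivrMr//; exact: sqr_sum_le.
Qed.

Let two_cosh_Z_le n w : two_cosh (Z n w) <= two_cosh (Num.sqrt n%:R).
Proof.
apply: le_two_cosh; rewrite -!sqrtr_sqr ler_sqrt ?sqr_ge0//.
by rewrite sqr_sqrtr.
Qed.

Let iexpV r n : P.-integrable setT (EFin \o (fun w => expR (- (r ^+ 2 * V2 n w)))).
Proof.
apply: (integrable_bounded P (M := 1)) => [|w].
  have := measurable_sum_squares X theta n => mV; by meas.
by rewrite ger0_norm ?expR_ge0// expRN_le1// mulr_ge0 ?sqr_ge0.
Qed.

Lemma integrable_two_cosh_self_normalized n : P.-integrable setT (EFin \o (fun w => two_cosh (Z n w))).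
Proof.
apply: (integrable_bounded P (M := two_cosh (Num.sqrt n%:R))) => [|w].
  by rewrite /two_cosh; have := measurable_self_normalized_sum X theta n => mZ; meas.
by rewrite ger0_norm ?two_cosh_Z_le// (le_trans _ (two_cosh_ge2 _)).
Qed.

(** Peeling over the random size of [V = Num.sqrt (V2 n w)]. If [r_j * V] lies
    in [[1, 2[] for a scale [r_j = r0 / 2 ^+ j], then [`|Z| <= r_j * `|S|] and the
    compensator in [G (r_j)] is at least [expR (- 8)]. The last line covers
    [r0 * V < 1] and [1 <= r_J * V], where only [`|Z| <= sqrt n] is available. *)
Let peeling (r0 : R) n J w : 0 < r0 ->
  two_cosh (Z n w) - 2 <= expR 8 * \sum_(j < J) G (r0 / 2 ^+ j) n w +
    two_cosh (Num.sqrt n%:R) * (expR 1 * expR (- (r0 ^+ 2 * V2 n w)) +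
      2 * (1 - expR (- ((r0 / 2 ^+ J) ^+ 2 * V2 n w)))).
Proof.
move=> r00; set C := two_cosh (Num.sqrt n%:R).
have C2 : 2 <= C by exact: two_cosh_ge2.
have CZ : two_cosh (Z n w) <= C by exact: two_cosh_Z_le.
have SG : 0 <= expR 8 * \sum_(j < J) G (r0 / 2 ^+ j) n w.
  by rewrite mulr_ge0 ?expR_ge0// sumr_ge0.
have e1 := expR_ge0 (- (r0 ^+ 2 * V2 n w)).
have e2 : expR (- ((r0 / 2 ^+ J) ^+ 2 * V2 n w)) <= 1.
  by rewrite expRN_le1// mulr_ge0 ?sqr_ge0.
have e1' : 0 <= expR 1 * expR (- (r0 ^+ 2 * V2 n w)) by rewrite mulr_ge0 ?expR_ge0.
have K x : 1 <= x -> two_cosh (Z n w) - 2 <=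
    expR 8 * \sum_(j < J) G (r0 / 2 ^+ j) n w + C * x.
  move=> x1; have CC : 0 <= C by lra.
  have : C <= C * x by rewrite ler_peMr.
  lra.
have [u0|u0] := ltP (r0 ^+ 2 * V2 n w) 1.
  have : 1 <= expR 1 * expR (- (r0 ^+ 2 * V2 n w)).
    by rewrite -expRD -[leLHS]expR0 ler_expR subr_ge0 ltW.
  by move=> H; apply: K; lra.
have [uJ|uJ] := ltP ((r0 / 2 ^+ J) ^+ 2 * V2 n w) 1; last first.
  have : expR (- ((r0 / 2 ^+ J) ^+ 2 * V2 n w)) <= 1 / 2.
    have := @expRN_mul_le1 R ((r0 / 2 ^+ J) ^+ 2 * V2 n w).
    have := expR_ge0 (- ((r0 / 2 ^+ J) ^+ 2 * V2 n w)).
    set y := _ * _ in uJ *; set x := expR _ => x0 /(_ (le_trans ler01 uJ)); nra.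
  by move=> H; apply: K; lra.
have [|j jJ [uj1 uj2]] := @crossing_index R (fun j => (r0 / 2 ^+ j) ^+ 2 * V2 n w) J _ uJ.
  by rewrite expr0 divr1.
have [r rE] : exists r, r = r0 / 2 ^+ j by eexists.
have rr : r0 / 2 ^+ j.+1 = r / 2 by rewrite exprS rE; field; rewrite expf_neq0.
rewrite rr -rE in uj1 uj2.
have rgt0 : 0 < r by rewrite rE divr_gt0// exprn_gt0.
have V0 : 0 < V2 n w.
  by rewrite lt_neqAle V2_ge0 andbT eq_sym; apply: contraTneq uj1 => ->; rewrite mulr0 -ltNge ltr01.
have Zr : two_cosh (Z n w) <= two_cosh (r * S n w).
  apply: le_two_cosh; rewrite -!sqrtr_sqr ler_sqrt ?sqr_ge0//.
  rewrite ZE !exprMn exprVn sqr_sqrtr// mulrC ler_wpM2r ?sqr_ge0//.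
  by rewrite -div1r ler_pdivrMr.
have e8 : expR (- 8) <= expR (- (2 * (r ^+ 2 * V2 n w))).
  by rewrite ler_expR lerN2; move: uj2; rewrite exprMn (_ : 2^-1 ^+ 2 = 4^-1 :> R); [lra|field].
have GZ : two_cosh (Z n w) - 2 <= expR 8 * G r n w.
  rewrite /G mulrCA; apply: (@le_trans _ _ (two_cosh (r * S n w) - 2)); first by rewrite lerB.
  rewrite ler_peMr ?subr_ge0 ?two_cosh_ge2//.
  by rewrite -[leLHS](expRxMexpNx_1 8) ler_wpM2l ?expR_ge0.
have GS : G r n w <= \sum_(j < J) G (r0 / 2 ^+ j) n w.
  by rewrite rE (bigD1 (Ordinal jJ))//= lerDl sumr_ge0.
have : expR 8 * G r n w <= expR 8 * \sum_(j < J) G (r0 / 2 ^+ j) n w.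
  by rewrite ler_wpM2l ?expR_ge0.
have : 0 <= C * (expR 1 * expR (- (r0 ^+ 2 * V2 n w)) +
      2 * (1 - expR (- ((r0 / 2 ^+ J) ^+ 2 * V2 n w)))).
  apply: mulr_ge0; first lra.
  by rewrite addr_ge0// mulr_ge0// subr_ge0.
lra.
Qed.

(** The peeled terms sum to a constant because [n%:R * L (r_j)] decreases at
    least geometrically in [j]. The event of small [V] has probability of order
    [expR (- n%:R * l0)], which beats [expR (sqrt n)]; the event of large [V]
    disappears as the number [J] of scales tends to infinity. *)
Lemma exponential_moment_bounded : exists C, forall n, \int[P]_w two_cosh (Z n w) <= C.
Proof.
have c0 : 0 < 600^-1 :> R by rewrite invr_gt0 ltr0n.
have [r1 r10 H1] := mean_error_small c0.
have [r2 r20 H2] := halving.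
pose r0 := Num.min r1 r2.
have r00 : 0 < r0 by rewrite lt_min r10.
pose r j := r0 / 2 ^+ j.
have rj0 j : 0 < r j by rewrite divr_gt0// exprn_gt0.
have rjr j : r j <= r0.
  by rewrite ler_pdivrMr ?exprn_gt0// ler_peMr ?(ltW r00)// exprn_ege1// ler1n.
have rj1 j : r j <= r1 by rewrite (le_trans (rjr j))// /r0 ge_min lexx.
have rj2 j : r j <= r2 by rewrite (le_trans (rjr j))// /r0 ge_min lexx orbT.
have rS j : r j.+1 = r j / 2 by rewrite /r exprS; field; rewrite expf_neq0.
have L3 j : 3 * L (r j.+1) <= L (r j) by rewrite rS; exact: H2.
have Ljn j : L (r j) <= j.+1%:R^-1.
  elim: j => [|j IH]; first by rewrite invr1 L_le1.
  have : 3 * L (r j.+1) <= j.+1%:R^-1 by exact: le_trans (L3 j) IH.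
  have : j.+1%:R^-1 <= 3 * j.+2%:R^-1 :> R.
    rewrite -ler_pdivrMl// -invfM lef_pV2 ?posrE ?mulr_gt0 ?ltr0n//.
    rewrite -[j.+2%:R]natr1; have : 1 <= j.+1%:R :> R by rewrite ler1n.
    lra.
  move=> c3 a3; rewrite -(ler_pM2l (ltr0n R 3)).
  exact: le_trans a3 c3.
set l0 := L r0; have l00 : 0 < l0 by exact: L_gt0.
exists (2 + expR 8 * 42 + 2 * expR 1 * expR (4 * l0)^-1) => n.
pose D := two_cosh (Num.sqrt n%:R) * (2 * n%:R) : R.
have iE j := iexpV (r j) n.
have key J : \int[P]_w two_cosh (Z n w) <= 2 + expR 8 * 42 + 2 * expR 1 * expR (4 * l0)^-1 +
    D / J.+1%:R.
  pose F w := 2 + (expR 8 * \sum_(j < J) G (r j) n w +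
    two_cosh (Num.sqrt n%:R) * (expR 1 * expR (- (r0 ^+ 2 * V2 n w)) +
      2 * (1 - expR (- ((r J) ^+ 2 * V2 n w))))).
  have iGj j : P.-integrable setT (EFin \o (fun w => G (r j) n w)) by exact: iG.
  have iS := integrable_sum_ord J iGj.
  have IS : \int[P]_w (\sum_(j < J) G (r j) n w) <= 42.
    rewrite (Rintegral_sum_ord J iGj).
    apply: (@le_trans _ _ (\sum_(j < J) 7 * (n%:R * L (r j) * expR (- (n%:R * L (r j) / 4))))).
      by apply: ler_sum => j _; apply: Rintegral_G => //; exact: H1.
    rewrite -mulr_sumr; have -> : 42 = 7 * 6 :> R by rewrite -natrM.
    rewrite ler_pM2l//.
    apply: (geometric_scales_sum (x := fun j => n%:R * L (r j))) => j.
      by rewrite mulr_ge0// truncated_moment_ge0.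
    by rewrite mulrCA ler_wpM2l.
  have i0 := iexpV r0 n.
  have i1 : P.-integrable setT (EFin \o (fun w => 1 - expR (- (r J ^+ 2 * V2 n w)))).
    by apply: integrable_sub => //; exact: integrable_cst.
  have i2 : P.-integrable setT (EFin \o (fun w => expR 1 * expR (- (r0 ^+ 2 * V2 n w)) +
      2 * (1 - expR (- ((r J) ^+ 2 * V2 n w))))).
    by apply: integrable_add; exact: integrable_scale.
  have i3 : P.-integrable setT (EFin \o (fun w => expR 8 * \sum_(j < J) G (r j) n w +
    two_cosh (Num.sqrt n%:R) * (expR 1 * expR (- (r0 ^+ 2 * V2 n w)) +
      2 * (1 - expR (- ((r J) ^+ 2 * V2 n w)))))).
    by apply: integrable_add; exact: integrable_scale.
  apply: (@le_trans _ _ (\int[P]_w F w)).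
    apply: le_RintegralT.
    - exact: integrable_two_cosh_self_normalized.
    - by apply: integrable_add => //; exact: integrable_cst.
    - by move=> w; rewrite /F -lerBlDl; exact: peeling.
  rewrite /F (RintegralD measurableT (integrable_cst P 2) i3) RintegralT_cst.
  rewrite (RintegralD measurableT (integrable_scale _ iS) (integrable_scale _ i2)).
  rewrite (RintegralZl _ measurableT iS) (RintegralZl _ measurableT i2).
  rewrite (RintegralD measurableT (integrable_scale _ i0) (integrable_scale _ i1)).
  rewrite (RintegralZl _ measurableT i0) (RintegralZl _ measurableT i1).
  rewrite (RintegralB measurableT (integrable_cst P 1) (iE J)) RintegralT_cst.
  rewrite !(laplace_sum_squares theta iidX) -/l0 -[leRHS]addrA -[leRHS]addrA lerD2l lerD//.
    by rewrite ler_wpM2l ?expR_ge0.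
  (* the contributions of small and of large [V] *)
  rewrite mulrDr lerD//.
  - rewrite [leLHS]mulrCA (mulrC 2 (expR 1)) -[leRHS]mulrA ler_wpM2l ?expR_ge0//.
    have chn : two_cosh (Num.sqrt n%:R) <= 2 * expR (Num.sqrt n%:R) :> R.
      rewrite /two_cosh mulr2n mulrDl mul1r lerD2l ler_expR.
      by have := sqrtr_ge0 (n%:R : R); lra.
    have ln : (1 - l0) ^+ n <= expR (- (n%:R * l0)).
      rewrite -mulrN expRM_natl lerXn2r ?nnegrE ?expR_ge0 ?subr_ge0 ?L_le1//.
      by have := expR_ge1Dx (- l0).
    have l1 : 0 <= (1 - l0) ^+ n by rewrite exprn_ge0// subr_ge0 L_le1.
    apply: (@le_trans _ _ (2 * expR (Num.sqrt n%:R) * expR (- (n%:R * l0)))).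
      by apply: ler_pM => //; rewrite (le_trans _ (two_cosh_ge2 _)).
    rewrite -mulrA ler_pM2l// -expRD ler_expR.
    have sn : Num.sqrt n%:R ^+ 2 = n%:R :> R by rewrite sqr_sqrtr.
    move: sn; set y := Num.sqrt n%:R => <-; set q := (4 * l0)^-1.
    (* [y <= l0 * y ^+ 2 + (4 * l0)^-1], by completing the square *)
    have : 0 <= l0 * (y - (2 * l0)^-1) ^+ 2 by rewrite mulr_ge0 ?sqr_ge0// ltW.
    rewrite (_ : l0 * _ = y ^+ 2 * l0 - y + q); first lra.
    by rewrite /q; field; rewrite gt_eqF.
  - rewrite /D -mulrA ler_wpM2l//; first by rewrite (le_trans _ (two_cosh_ge2 _)).
    rewrite -mulrA ler_pM2l//; apply: (@le_trans _ _ (n%:R * L (r J))).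
      have LJ1 := L_le1 (r J); have LJ0 : 0 <= L (r J) by exact: truncated_moment_ge0.
      have q0 : 0 <= 1 - L (r J) by rewrite subr_ge0.
      have q1 : 1 - L (r J) <= 1 by rewrite lerBlDr lerDl.
      case: (n) => [|k]; first by rewrite expr0 subrr mul0r.
      have := expr_diff_le k q0 q1.
      by rewrite !expr1n mulr1 subKr.
    by rewrite ler_wpM2l.
have l : 2 + expR 8 * 42 + 2 * expR 1 * expR (4 * l0)^-1 + D / J.+1%:R @[J --> \oo] -->
    2 + expR 8 * 42 + 2 * expR 1 * expR (4 * l0)^-1 + D * 0.
  by apply: cvgD; [exact: cvg_cst|apply: cvgM; [exact: cvg_cst|exact: cvg_harmonic]].
rewrite mulr0 addr0 in l; rewrite -(cvg_lim _ l)//.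
apply: limr_ge; first by apply/cvg_ex; eexists; exact: l.
exact: nearW.
Qed.

End exponential_moment.

(** * Powers of the positive part *)

Section positive_part_power.
Context {R : realType}.
Implicit Types (x y alpha lambda : R).

Lemma pos_powR_ge0 x alpha : 0 <= pos_powR x alpha.
Proof. by rewrite /pos_powR; case: eqP => // _; exact: powR_ge0. Qed.

Lemma le_pos_powR alpha x y : 0 <= alpha -> x <= y -> pos_powR x alpha <= pos_powR y alpha.
Proof.
move=> a0 xy; rewrite /pos_powR; case: eqP => _.
  have [x0|x0] := leP 0 x; first by rewrite (le_trans x0 xy).
  by rewrite /= mulr0n ler0n.
apply: ge0_ler_powR => //; [by rewrite nnegrE le_max lexx..|].
by rewrite ge_max !le_max lexx xy orbT.
Qed.

Lemma measurable_pos_powR alpha : measurable_fun setT (fun x => pos_powR x alpha).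
Proof.
rewrite /pos_powR; case: eqP => _.
  rewrite (_ : (fun x => _) = \1_[set x | 0 <= x]); last first.
    apply/funext => x; rewrite indicE; congr (_%:R); congr nat_of_bool.
    by apply/idP/idP => [?|/set_mem//]; apply/mem_set.
  apply: measurable_indic; rewrite (_ : [set x | _] = `[0, +oo[%classic)//.
  by apply/seteqP; split => x /=; rewrite in_itv/= andbT.
apply: (measurableT_comp (@measurable_powR R alpha)).
exact: measurable_maxr.
Qed.

Lemma continuous_pos_powR alpha : 0 < alpha -> continuous (fun x => pos_powR x alpha).
Proof.
move=> a0; have -> : (fun x => pos_powR x alpha) = (fun x => Num.max 0 x `^ alpha).
  by apply/funext => x; rewrite /pos_powR gt_eqF.
move=> x; have [x0|x0|x0] := ltgtP x 0.
- have l : (fun=> Num.max 0 x `^ alpha) y @[y --> x] --> Num.max 0 x `^ alpha.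
    exact: cvg_cst.
  apply: cvg_trans l; apply: near_eq_cvg; near=> y; rewrite /= !max_l//; last exact: ltW.
  by apply: ltW; near: y; exact: lt_nbhsl.
- have l : expR (alpha * ln y) @[y --> x] --> expR (alpha * ln x).
    have la : alpha * ln y @[y --> x] --> alpha * ln x.
      by apply: cvgM; [exact: cvg_cst|exact: continuous_ln].
    exact: (cvg_comp _ _ la (@continuous_expR R _)).
  rewrite /continuous_at (_ : Num.max 0 x `^ alpha = expR (alpha * ln x)); last first.
    by rewrite max_r ?ltW// /powR gt_eqF.
  apply: cvg_trans l; apply: near_eq_cvg; near=> y.
  have y0 : 0 < y by near: y; exact: lt_nbhsr.
  by rewrite max_r ?ltW// /powR gt_eqF.
- rewrite /continuous_at x0 maxxx powR0 ?gt_eqF//; apply/cvgrPdist_le => e e0.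
  pose dl := e `^ (alpha^-1); have dl0 : 0 < dl by exact: powR_gt0.
  near=> y; rewrite sub0r normrN ger0_norm ?powR_ge0//.
  have yd : y < dl by near: y; apply: lt_nbhsl.
  have -> : e = dl `^ alpha by rewrite -powRrM mulVf ?powRr1 ?gt_eqF// ltW.
  apply: ge0_ler_powR; [exact: ltW|by rewrite nnegrE le_max lexx|by rewrite nnegrE ltW|].
  by rewrite ge_max !ltW.
Unshelve. all: by end_near. Qed.

(** A power grows slower than an exponential: [y `^ a <= expR (a * ln y)], and
    [ln] is below each of its tangents. *)
Lemma sqr_pos_powR_le_two_cosh alpha lambda : 0 <= alpha ->
  exists2 C, 0 <= C & forall z, pos_powR (z - lambda) alpha ^+ 2 <= C * two_cosh z.
Proof.
rewrite le_eqVlt => /predU1P[<-|a0].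
  exists 1 => // z; rewrite mul1r (le_trans _ (two_cosh_ge2 z))// /pos_powR eqxx.
  by case: (0 <= _); rewrite ?expr1n ?expr0n//; lra.
(* The tangent of [ln] at [2 * alpha] has slope [(2 * alpha)^-1]. *)
pose c := `|lambda| + 2 * alpha * ln (2 * alpha).
exists (expR c); first exact: expR_ge0.
move=> z; rewrite /pos_powR gt_eqF//.
have [y0|y0] := leP (z - lambda) 0.
  by rewrite powR0 ?gt_eqF// expr0n mulr_ge0 ?expR_ge0// (le_trans _ (two_cosh_ge2 z)).
set y := z - lambda in y0 *.
have a2 : 0 < 2 * alpha by rewrite mulr_gt0.
apply: (@le_trans _ _ (expR (c + `|z|))); last first.
  by rewrite expRD ler_wpM2l ?expR_ge0// expR_norm_le_two_cosh.
rewrite /powR gt_eqF// -expRM_natl ler_expR mulrA.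
have ly : ln y <= y / (2 * alpha) - 1 + ln (2 * alpha).
  have -> : ln y = ln (1 + (y / (2 * alpha) - 1)) + ln (2 * alpha).
    rewrite -lnM ?posrE//; last by rewrite addrC subrK divr_gt0.
    by rewrite addrC subrK divfK ?gt_eqF.
  rewrite lerD2r; apply: le_ln1Dx.
  by rewrite ltrBrDl subrr divr_gt0.
apply: (@le_trans _ _ (2 * alpha * (y / (2 * alpha) - 1 + ln (2 * alpha)))).
  by rewrite ler_pM2l.
have -> : 2 * alpha * (y / (2 * alpha) - 1 + ln (2 * alpha)) =
    y - 2 * alpha + 2 * alpha * ln (2 * alpha).
  by field; rewrite gt_eqF.
rewrite /c /y; have := ler_norm z; have := ler_norm (- lambda); rewrite normrN; lra.
Qed.

Lemma le_min_add_sqr (K v : R) : 0 < K -> 0 <= v -> v <= Num.min v K + v ^+ 2 / K.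
Proof.
move=> K0 v0; have [vK|Kv] := leP v K; first by rewrite lerDl divr_ge0 ?sqr_ge0// ltW.
apply: (@le_trans _ _ (v ^+ 2 / K)); last by rewrite lerDr ltW.
by rewrite ler_pdivlMr// expr2 ler_pM2l ?(lt_trans K0)// ltW.
Qed.

Lemma continuous_minr (f g : R -> R) :
  continuous f -> continuous g -> continuous (fun x => Num.min (f x) (g x)).
Proof. by move=> cf cg x; exact: (@continuous_min _ _ f g x (cf x) (cg x)). Qed.

Lemma continuous_maxr (f g : R -> R) :
  continuous f -> continuous g -> continuous (fun x => Num.max (f x) (g x)).
Proof. by move=> cf cg x; exact: (@continuous_max _ _ f g x (cf x) (cg x)). Qed.

(** Monotonicity leaves room for a continuous function between two shifts of the
    truncated power, also for the exponent 0, where the power jumps. *)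
Lemma continuous_interpolant alpha lambda (K e : R) : 0 <= alpha -> 1 <= K -> 0 < e ->
  exists h : R -> R, [/\ continuous h, forall x, 0 <= h x <= K,
    forall x, Num.min (pos_powR (x + e - lambda) alpha) K <= h x &
    forall x, h x <= Num.min (pos_powR (x + 2 * e - lambda) alpha) K].
Proof.
rewrite le_eqVlt => /predU1P[<-|a0] K1 e0.
- exists (fun x => Num.min (Num.max 0 ((x + 2 * e - lambda) / e)) 1); split.
  + apply: continuous_minr; last by move=> x; exact: cvg_cst.
    apply: continuous_maxr => x; first exact: cvg_cst.
    by apply: cvgM; [apply: cvgB; [apply: cvgD; [exact: cvg_id|]|]|]; exact: cvg_cst.
  + by move=> x; rewrite le_min le_max lexx ler01 ge_min K1 orbT.
  + move=> x; rewrite /pos_powR eqxx; have [xe|xe] := leP 0 (x + e - lambda).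
      rewrite min_l// le_min lexx andbT le_max; apply/orP; right.
      by rewrite ler_pdivlMr//= mulr1n; lra.
    by rewrite /= mulr0n min_l ?(le_trans ler01 K1)// le_min ler01 le_max lexx.
  + move=> x; rewrite /pos_powR eqxx; have [xe|xe] := leP 0 (x + 2 * e - lambda).
      by rewrite /= mulr1n (min_l K1) ge_min lexx orbT.
    rewrite /= mulr0n (min_l (le_trans ler01 K1)) ge_min ge_max lexx /=.
    by rewrite ler_pdivrMr// mul0r ltW.
- exists (fun x => Num.min (pos_powR (x + e - lambda) alpha) K); split.
  + apply: continuous_minr => x; last exact: cvg_cst.
    apply: (@continuous_comp _ _ _ (fun x => x + e - lambda) (fun y => pos_powR y alpha)).
      by apply: cvgB; [apply: cvgD; [exact: cvg_id|]|]; exact: cvg_cst.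
    exact: continuous_pos_powR.
  + by move=> x; rewrite le_min pos_powR_ge0 (le_trans ler01 K1) ge_min lexx orbT.
  + by [].
  + move=> x; rewrite le_min !ge_min lexx orbT andbT; apply/orP; left.
    by apply: le_pos_powR; [exact: ltW|lra].
Qed.

(** Right continuity is what survives at the jump of the exponent 0, thanks to
    the closed condition in [0 <= x]. *)
Lemma cvg_pos_powR_right alpha x : 0 <= alpha ->
  pos_powR (x + 2 * n.+1%:R^-1) alpha @[n --> \oo] --> pos_powR x alpha.
Proof.
have l : x + 2 * n.+1%:R^-1 @[n --> \oo] --> x + 2 * 0.
  by apply: cvgD; [exact: cvg_cst|apply: cvgM; [exact: cvg_cst|exact: cvg_harmonic]].
rewrite mulr0 addr0 in l.
rewrite le_eqVlt => /predU1P[<-|a0]; last first.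
  exact: (cvg_comp _ _ l (@continuous_pos_powR _ a0 x)).
rewrite /pos_powR eqxx; have [x0|x0] := leP 0 x.
  have l1 : (fun=> 1 : R) n @[n --> \oo] --> (1 : R) by exact: cvg_cst.
  by apply: cvg_trans l1; apply: near_eq_cvg; apply: nearW => n; rewrite addr_ge0// mulr_ge0.
have l0 : (fun=> 0 : R) n @[n --> \oo] --> (0 : R) by exact: cvg_cst.
apply: cvg_trans l0; apply: near_eq_cvg; near=> n; rewrite leNgt; have -> // : x + 2 * n.+1%:R^-1 < 0.
by near: n; apply: cvgr_lt l _ _.
Unshelve. all: by end_near. Qed.

End positive_part_power.

(** * The limit superior of the expectations *)

Section sandwich.
Context {R : realType}.

Lemma laplace_away_from_one (eta : R) : 0 < eta -> eta < 1 ->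
  exists2 kappa : R, 0 < kappa & forall r, 0 <= r -> eta < `|1 - r| ->
    kappa <= (expR (- r ^+ 2) - expR (-1)) ^+ 2.
Proof.
move=> e0 e1.
pose p := expR (- (1 - eta) ^+ 2) - expR (-1).
pose q := expR (-1) - expR (- (1 + eta) ^+ 2).
have p0 : 0 < p by rewrite subr_gt0 ltr_expR ltrN2 expr_lt1 ?subr_ge0 ?ltW//; lra.
have q0 : 0 < q by rewrite subr_gt0 ltr_expR ltrN2 expr_gt1 ?addr_ge0 ?ltW//; lra.
exists (Num.min p q ^+ 2) => [|r r0]; first by rewrite exprn_gt0// lt_min p0.
have pq0 : 0 <= Num.min p q by rewrite le_min !ltW.
have [r1|r1] := leP r 1.
  rewrite ger0_norm ?subr_ge0// => er.
  have pr : p <= expR (- r ^+ 2) - expR (-1).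
    rewrite lerD2r ler_expR lerN2 lerXn2r ?nnegrE//; lra.
  by rewrite lerXn2r ?nnegrE ?(le_trans (ltW p0) pr)// ge_min pr.
rewrite ltr0_norm ?subr_lt0// => er.
have qr : q <= expR (-1) - expR (- r ^+ 2).
  rewrite lerD2l lerN2 ler_expR lerN2 lerXn2r ?nnegrE//; lra.
by rewrite -[leRHS]sqrrN opprB lerXn2r ?nnegrE ?(le_trans (ltW q0) qr)// ge_min qr orbT.
Qed.

(** Either [z] is large, or the normalisation [v / a] is far from 1, or [z] and
    [(s - c) / a] are within [dl] of each other; the first two cases are paid
    for by the last summand. *)
Lemma min_le_interpolant (f h : R -> R) (K dl M kappa z s v c a : R) :
  {homo f : x y / x <= y} -> (forall x, 0 <= h x) -> 0 <= K ->
  (forall x, Num.min (f (x + dl)) K <= h x) ->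
  0 < dl -> 0 < M -> 0 < a -> 0 <= v -> z * v = s -> `|c / a| <= dl / 2 ->
  0 < kappa ->
  (forall r, 0 <= r -> dl / (2 * M) < `|1 - r| ->
     kappa <= (expR (- r ^+ 2) - expR (-1)) ^+ 2) ->
  Num.min (f z) K <= h ((s - c) / a) +
    K * (two_cosh z / M + (expR (- (v / a) ^+ 2) - expR (-1)) ^+ 2 / kappa).
Proof.
move=> fmono h0 K0 fh dl0 M0 a0 v0 zv ca kappa0 hkappa.
set W := (_ - _) ^+ 2; have W0 : 0 <= W by exact: sqr_ge0.
have Wk0 : 0 <= W / kappa by rewrite divr_ge0// ltW.
have ch0 : 0 <= two_cosh z / M by rewrite divr_ge0 ?(le_trans _ (two_cosh_ge2 z))// ltW.
have trivial_bound : 1 <= two_cosh z / M + W / kappa ->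
    Num.min (f z) K <= h ((s - c) / a) + K * (two_cosh z / M + W / kappa).
  move=> h1; apply: (@le_trans _ _ K); first by rewrite ge_min lexx orbT.
  by apply: (@le_trans _ _ (K * (two_cosh z / M + W / kappa))); [exact: ler_peMr|rewrite lerDr].
have [Mz|zM] := ltP M `|z|.
  apply: trivial_bound; rewrite -[1]addr0 lerD// ler_pdivlMr// mul1r.
  apply: le_trans (expR_norm_le_two_cosh z); have := expR_ge1Dx `|z|; lra.
have va0 : 0 <= v / a by rewrite divr_ge0// ltW.
have [far|near] := ltP (dl / (2 * M)) `|1 - v / a|.
  by apply: trivial_bound; rewrite -[1]add0r lerD// ler_pdivlMr// mul1r; exact: hkappa.
apply: (@le_trans _ _ (h ((s - c) / a))); last first.
  by rewrite lerDl mulr_ge0// addr_ge0.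
apply: le_trans (fh _).
have zu : z <= (s - c) / a + dl.
  have -> : z = (s - c) / a + (z * (1 - v / a) + c / a).
    by rewrite -zv; field; rewrite gt_eqF.
  rewrite lerD2l; apply: le_trans (ler_norm _) _; apply: le_trans (ler_normD _ _) _.
  have -> : dl = dl / 2 + dl / 2 by lra.
  apply: lerD => //; rewrite normrM.
  have -> : dl / 2 = M * (dl / (2 * M)) by field; rewrite gt_eqF.
  exact: ler_pM.
by rewrite le_min !ge_min lexx orbT andbT fmono.
Qed.

End sandwich.

Section limit.
Context d (T : measurableType d) (R : realType) (P : probability T R).
Variable X : nat -> {RV P >-> R}.
Variable theta : R.
Hypothesis iidX : iid P X.
Hypothesis iX : P.-integrable setT (EFin \o X 0%N).
Hypothesis EX : 'E_P[X 0%N]%E = theta%:E.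
Local Notation gamma := (normal_prob (0 : R) 1).

Variables a b : nat -> R.
Hypothesis a0 : forall n, 0 < a n.
Hypothesis cvgU :
  cvg_in_distribution P (fun n w => (\sum_(i < n) X i w - b n) / a n) gamma.

Let c n : R := b n - n%:R * theta.
Let S n w := \sum_(i < n) (X i w - theta).
Let V2 n w := \sum_(i < n) (X i w - theta) ^+ 2.
Let Z n w := self_normalized_sum X theta n w.
Let U n w : R := (\sum_(i < n) X i w - b n) / a n.

Let V2_ge0 n w : 0 <= V2 n w. Proof. exact: sum_squares_ge0. Qed.

Let UE n w : U n w = (S n w - c n) / a n. Proof. exact: normalized_sumE. Qed.

Let ZV n w : Z n w * Num.sqrt (V2 n w) = S n w. Proof. exact: self_normalized_sumM. Qed.

Let mU n : measurable_fun setT (U n).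
Proof.
apply: measurable_funM => //; apply: measurable_funB => //.
by apply: measurable_sum => i; exact: measurable_funPT.
Qed.

Let mZ n : measurable_fun setT (Z n).
Proof. exact: measurable_self_normalized_sum. Qed.

Let W n w := (expR (- (Num.sqrt (V2 n w) / a n) ^+ 2) - expR (-1)) ^+ 2.

Let WE n w : W n w = expR (- ((Num.sqrt 2 / a n) ^+ 2 * V2 n w)) -
  2 * expR (-1) * expR (- ((1 / a n) ^+ 2 * V2 n w)) + expR (-1) ^+ 2.
Proof.
rewrite /W !expr_div_n !sqr_sqrtr// sqrrB -!expRM_natl expr1n.
rewrite (_ : 2%:R * - (V2 n w / a n ^+ 2) = - (2 / a n ^+ 2 * V2 n w)); last by ring.
rewrite (_ : 1 / a n ^+ 2 * V2 n w = V2 n w / a n ^+ 2); last by ring.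
by congr (_ - _ + _); ring.
Qed.

Let iE t n : P.-integrable setT (EFin \o (fun w => expR (- ((t / a n) ^+ 2 * V2 n w)))).
Proof.
apply: (integrable_bounded P (M := 1)) => [|w].
  by have := measurable_sum_squares X theta n => mV; meas.
by rewrite ger0_norm ?expR_ge0// -expR0 ler_expR oppr_le0 mulr_ge0 ?sqr_ge0.
Qed.

Let iW n : P.-integrable setT (EFin \o W n).
Proof.
rewrite (_ : W n = fun w => expR (- ((Num.sqrt 2 / a n) ^+ 2 * V2 n w)) -
  2 * expR (-1) * expR (- ((1 / a n) ^+ 2 * V2 n w)) + expR (-1) ^+ 2); last first.
  by apply/funext => w; exact: WE.
apply: integrable_add; last exact: integrable_cst.
by apply: integrable_sub; [exact: iE|exact: integrable_scale].
Qed.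

Let cvg_W : \int[P]_w W n w @[n --> \oo] --> 0.
Proof.
have l : \int[P]_w expR (- ((Num.sqrt 2 / a n) ^+ 2 * V2 n w)) -
    2 * expR (-1) * \int[P]_w expR (- ((1 / a n) ^+ 2 * V2 n w)) + expR (-1) ^+ 2
    @[n --> \oo] --> expR (- Num.sqrt 2 ^+ 2) - 2 * expR (-1) * expR (- 1 ^+ 2) + expR (-1) ^+ 2.
  apply: cvgD; last exact: cvg_cst.
  apply: cvgB; first exact: (cvg_laplace_sum_squares iidX iX EX a0 cvgU).
  by apply: cvgM; [exact: cvg_cst|exact: (cvg_laplace_sum_squares iidX iX EX a0 cvgU)].
rewrite (_ : expR (- Num.sqrt 2 ^+ 2) - _ + _ = 0) in l; last first.
  rewrite sqr_sqrtr// expr1n (_ : expR (- 2) = expR (-1) ^+ 2); first by ring.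
  by rewrite -expRM_natl mulrN1.
apply: cvg_trans l; apply: near_eq_cvg; apply: nearW => n.
under [RHS]eq_Rintegral do rewrite WE.
have i1 := iE (Num.sqrt 2) n; have i2 := integrable_scale (2 * expR (-1)) (iE 1 n).
rewrite (RintegralD measurableT (integrable_sub i1 i2) (integrable_cst P _)) RintegralT_cst.
by rewrite (RintegralB measurableT i1 i2) (RintegralZl _ measurableT (iE 1 n)).
Qed.

Lemma exponential_moment_self_normalized :
  exists C, forall n, \int[P]_w two_cosh (Z n w) <= C.
Proof.
apply: (exponential_moment_bounded iidX iX EX).
- exact: (truncated_mean_error_negligible iidX iX EX a0 cvgU).
- exact: (truncated_moment_halving iidX iX EX a0 cvgU).
- exact: (truncated_moment_pos iidX iX EX a0 cvgU).
Qed.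

(** In [min_le_interpolant] with [z], [s], [v] the self-normalized sum, the
    centered sum and the root of the sum of squares, the interpolant is evaluated
    at the normalized sum [U n], to which convergence in distribution applies. *)
Lemma limsup_truncated_le (f h : R -> R) (K dl e : R) :
  {homo f : x y / x <= y} -> (forall x, 0 <= f x) ->
  continuous h -> (forall x, 0 <= h x <= K) -> 0 < K -> 0 < dl ->
  (forall x, Num.min (f (x + dl)) K <= h x) -> measurable_fun setT f -> 0 < e ->
  \forall n \near \oo, \int[P]_w Num.min (f (Z n w)) K <= \int[gamma]_x h x + e.
Proof.
move=> fmono f0 ch0 hK K0 dl0 fh mf e0.
have [C1 HC1] := exponential_moment_self_normalized.
have C10 : 0 <= C1.
  by apply: le_trans (HC1 0%N); apply: Rintegral_ge0 => w _; rewrite (le_trans _ (two_cosh_ge2 _)).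
(* The summand [dl] keeps the radius [dl / (2 * M)] below 1. *)
pose M := dl + 3 * K * C1 / e.
have Mdl : dl <= M by rewrite lerDl divr_ge0 ?mulr_ge0 ?(ltW K0) ?(ltW e0).
have M0 : 0 < M by exact: lt_le_trans Mdl.
have eta0 : 0 < dl / (2 * M) by rewrite divr_gt0// mulr_gt0.
have eta1 : dl / (2 * M) < 1 by rewrite ltr_pdivrMr ?mulr_gt0//; lra.
have [kappa kappa0 hkappa] := laplace_away_from_one eta0 eta1.
have lh : \int[P]_w h (U n w) @[n --> \oo] --> \int[gamma]_x h x.
  apply: (cvg_Rintegral_in_distribution cvgU) => //.
  by exists K => x; have /andP[h0 h1] := hK x; rewrite ger0_norm.
have lc := cvg_centering iidX iX EX a0 cvgU.
have dl2 : 0 < dl / 2 by rewrite divr_gt0.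
have e3 : 0 < e / 3 by rewrite divr_gt0.
have ek : 0 < e / 3 * (kappa / K) by rewrite mulr_gt0// divr_gt0.
move/cvgrPdist_le : lh => /(_ _ e3) lh.
move/cvgrPdist_le : lc => /(_ _ dl2) lc.
move/cvgrPdist_le : cvg_W => /(_ _ ek) lW.
near=> n.
have hc : `|c n / a n| <= dl / 2.
  by have : `|0 - c n / a n| <= dl / 2; [near: n; exact: lc|rewrite sub0r normrN].
have hW : \int[P]_w W n w <= e / 3 * (kappa / K).
  have : `|0 - \int[P]_w W n w| <= e / 3 * (kappa / K) by near: n; exact: lW.
  by rewrite sub0r normrN; apply: le_trans; exact: ler_norm.
have hh : \int[P]_w h (U n w) <= \int[gamma]_x h x + e / 3.
  have : `|\int[gamma]_x h x - \int[P]_w h (U n w)| <= e / 3 by near: n; exact: lh.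
  by rewrite ler_distlC => /andP[].
have mh : measurable_fun setT h by exact: continuous_measurable_fun.
have ihU : P.-integrable setT (EFin \o (fun w => h (U n w))).
  apply: (integrable_bounded P (M := K)) => [|w]; first exact: (measurableT_comp mh (mU n)).
  by have /andP[h0 h1] := hK (U n w); rewrite ger0_norm.
have ich : P.-integrable setT (EFin \o (fun w => two_cosh (Z n w))).
  exact: integrable_two_cosh_self_normalized.
have i1 := integrable_scaler M^-1 ich; have i2 := integrable_scaler kappa^-1 (iW n).
have i3 := integrable_scale K (integrable_add i1 i2).
apply: (@le_trans _ _ (\int[P]_w (h (U n w) + K * (two_cosh (Z n w) / M + W n w / kappa)))).
  apply: le_RintegralT => [||w].
  - apply: (integrable_bounded P (M := K)) => [|w].
      by apply: measurable_minr => //; exact: (measurableT_comp mf (mZ n)).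
    by rewrite ger0_norm ?ge_min ?lexx ?orbT// le_min f0 ltW.
  - exact: integrable_add.
  - rewrite UE; apply: min_le_interpolant => //.
    + by move=> x; case/andP: (hK x).
    + exact: ltW.
rewrite (RintegralD measurableT ihU i3) (RintegralZl _ measurableT (integrable_add i1 i2)).
rewrite (RintegralD measurableT i1 i2) (RintegralZr _ measurableT ich).
rewrite (RintegralZr _ measurableT (iW n)).
have b1 : K * (\int[P]_w two_cosh (Z n w) / M) <= e / 3.
  rewrite mulrA ler_pdivrMr//; apply: (@le_trans _ _ (K * C1)).
    by rewrite ler_pM2l.
  have -> : e / 3 * M = e / 3 * dl + K * C1 by rewrite /M; field; rewrite gt_eqF.
  by rewrite lerDr mulr_ge0 ?ltW.
have b2 : K * (\int[P]_w W n w / kappa) <= e / 3.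
  by rewrite mulrA ler_pdivrMr// mulrC -ler_pdivlMr// -mulrA.
rewrite mulrDr; apply: le_trans (lerD hh (lerD b1 b2)) _.
by rewrite -addrA lerD2l (_ : e / 3 + (e / 3 + e / 3) = e)//; field.
Unshelve. all: by end_near. Qed.

Variables lambda alpha : R.
Hypothesis alpha_ge0 : 0 <= alpha.
Let f x := pos_powR (x - lambda) alpha.

Let mf : measurable_fun setT f.
Proof. by apply: (measurableT_comp (measurable_pos_powR alpha)); exact: measurable_funB. Qed.

Let mfK K : measurable_fun setT (fun x => Num.min (f x) K).
Proof. exact: measurable_minr. Qed.

Let minfK_norm K x : 0 <= K -> `|Num.min (f x) K| <= K.
Proof. by move=> K0; rewrite ger0_norm ?ge_min ?lexx ?orbT// le_min pos_powR_ge0. Qed.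

Lemma integrable_pos_powR_self_normalized n : P.-integrable setT (EFin \o (fun w => f (Z n w))).
Proof.
have [C C0 HC] := sqr_pos_powR_le_two_cosh lambda alpha_ge0.
have ich := @integrable_two_cosh_self_normalized _ _ _ P X theta n.
apply: (integrable_dominated (g := fun w => 1 + C * two_cosh (Z n w))).
- exact: (measurableT_comp mf (mZ n)).
- by apply: integrable_add; [exact: integrable_cst|exact: integrable_scale].
move=> w; rewrite ger0_norm ?pos_powR_ge0//.
apply: le_trans (le_min_add_sqr ltr01 (pos_powR_ge0 _ _)) _.
by rewrite divr1 lerD// ge_min lexx orbT.
Qed.

Let cvg_shift K : 0 <= K ->
  \int[gamma]_x Num.min (f (x + 2 * k.+1%:R^-1)) K @[k --> \oo] -->
  \int[gamma]_x Num.min (f x) K.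
Proof.
move=> K0; apply: (@RintegralT_bct _ _ _ gamma K
    (fun k x => Num.min (f (x + 2 * k.+1%:R^-1)) K) (fun x => Num.min (f x) K)).
- move=> k; apply: (measurableT_comp (mfK K)).
  exact: measurable_funD.
- by move=> k x; exact: minfK_norm.
move=> x; have l := @cvg_pos_powR_right _ alpha (x - lambda) alpha_ge0.
have cmin : continuous (fun y : R => Num.min y K).
  by apply: continuous_minr => y; [exact: cvg_id|exact: cvg_cst].
have := cvg_comp _ _ l (cmin _); apply: cvg_trans; apply: near_eq_cvg; apply: nearW => k /=.
by rewrite /f addrAC.
Qed.

(** The exponential moment bounds [f ^+ 2] in mean, so truncating [f] at [K]
    costs at most a multiple of [K^-1]. The shift is undone by right continuity. *)
Lemma limsup_expectation_le e : gamma.-integrable setT (EFin \o f) -> 0 < e ->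
  \forall n \near \oo, \int[P]_w f (Z n w) <= \int[gamma]_x f x + e.
Proof.
move=> fi e0.
have [C C0 HC] := sqr_pos_powR_le_two_cosh lambda alpha_ge0.
have [C1 HC1] := exponential_moment_self_normalized.
have C10 : 0 <= C1.
  by apply: le_trans (HC1 0%N); apply: Rintegral_ge0 => w _; rewrite (le_trans _ (two_cosh_ge2 _)).
pose K := 1 + 3 * C * C1 / e.
have K1 : 1 <= K by rewrite lerDl divr_ge0 ?mulr_ge0 ?(ltW e0).
have K0 : 0 < K by exact: lt_le_trans K1.
have CK : C * C1 / K <= e / 3.
  rewrite ler_pdivrMr// (_ : e / 3 * K = e / 3 + C * C1); first by rewrite lerDr divr_ge0// ltW.
  by rewrite /K; field; rewrite gt_eqF.
have e3 : 0 < e / 3 by rewrite divr_gt0.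
have [k hk] : exists k : nat, \int[gamma]_x Num.min (f (x + 2 * k.+1%:R^-1)) K <=
    \int[gamma]_x f x + e / 3.
  have /cvgrPdist_le/(_ _ e3) [k _ /(_ k (leqnn k))] := cvg_shift (ltW K0).
  rewrite /= ler_distlC => /andP[_ hk]; exists k; apply: le_trans hk _.
  rewrite lerD2r; apply: le_RintegralT => // [|x]; last by rewrite ge_min lexx.
  by apply: (integrable_bounded gamma (M := K)) => [|x]; [exact: mfK|exact: (minfK_norm _ (ltW K0))].
have dl0 : 0 < k.+1%:R^-1 :> R by rewrite invr_gt0.
have [h [hcont h0K fh hf]] := continuous_interpolant lambda alpha_ge0 K1 dl0.
have fmono : {homo f : x y / x <= y}.
  by move=> x y xy; apply: le_pos_powR => //; rewrite lerD2r.
have lim := @limsup_truncated_le f h K k.+1%:R^-1 (e / 3) fmono (fun x => pos_powR_ge0 _ _)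
  hcont h0K K0 dl0 fh mf e3.
near=> n.
have hn : \int[P]_w Num.min (f (Z n w)) K <= \int[gamma]_x h x + e / 3 by near: n.
have hh : \int[gamma]_x h x <= \int[gamma]_x Num.min (f (x + 2 * k.+1%:R^-1)) K.
  apply: le_RintegralT => [||x]; last exact: hf.
  - apply: (integrable_bounded gamma (M := K)) => [|x]; first exact: continuous_measurable_fun.
    by have /andP[h0 h1] := h0K x; rewrite ger0_norm.
  - apply: (integrable_bounded gamma (M := K)) => [|x]; last exact: (minfK_norm _ (ltW K0)).
    by apply: (measurableT_comp (mfK K)); exact: measurable_funD.
have ich := @integrable_two_cosh_self_normalized _ _ _ P X theta n.
have im : P.-integrable setT (EFin \o (fun w => Num.min (f (Z n w)) K)).
  apply: (integrable_bounded P (M := K)) => [|w]; last exact: (minfK_norm _ (ltW K0)).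
  exact: (measurableT_comp (mfK K) (mZ n)).
have tail : \int[P]_w f (Z n w) <=
    \int[P]_w Num.min (f (Z n w)) K + C / K * \int[P]_w two_cosh (Z n w).
  rewrite -(RintegralZl _ measurableT ich) -(RintegralD measurableT im (integrable_scale _ ich)).
  apply: le_RintegralT => [||w].
  - exact: integrable_pos_powR_self_normalized.
  - by apply: integrable_add => //; exact: integrable_scale.
  - apply: le_trans (le_min_add_sqr K0 (pos_powR_ge0 _ _)) _; rewrite lerD2l.
    by rewrite [leRHS]mulrAC ler_pM2r ?invr_gt0.
apply: le_trans tail _.
have tC : C / K * \int[P]_w two_cosh (Z n w) <= e / 3.
  by apply: le_trans CK; rewrite mulrAC ler_pM2r ?invr_gt0// ler_wpM2l.
apply: le_trans (lerD (le_trans hn (lerD (le_trans hh hk) (lexx _))) tC) _.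
by rewrite -!addrA lerD2l (_ : e / 3 + (e / 3 + e / 3) = e)//; field.
Unshelve. all: by end_near. Qed.

End limit.

(** * The asymptotic e-value *)

Lemma limn_esup_le (R : realType) (u : nat -> \bar R) (l : R) :
  (forall e, 0 < e -> \forall n \near \oo, (u n <= (l + e)%:E)%E) ->
  (limn_esup u <= l%:E)%E.
Proof.
move=> ul; apply/lee_addgt0Pr => e e0; rewrite /limn_esup limf_esupE.
apply: le_trans (ereal_inf_lbound _) _.
  by exists [set n | (u n <= (l + e)%:E)%E] => //; exact: ul.
by apply: ge_ereal_sup => _ [n /= ? <-]; rewrite -EFinD.
Qed.

Theorem theorem4p1 (R : realType) (d : measure_display) (T : measurableType d)
    (X : nat -> {mfun T >-> R}) (theta lambda alpha : R) (alpha_ge0 : 0 <= alpha) :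
  asymptotic_evalue
    [set P : probability T R |
      [/\ iid P X,
          forall i, P.-integrable [set: T] (EFin \o X i) /\
                    'E_P[X i]%E = theta%:E &
          in_gaussian_domain_of_attraction P X]]
    (self_normalized_evalue alpha X theta lambda).
Proof.
pose f (x : R) := pos_powR (x - lambda) alpha.
have mf : measurable_fun setT f.
  by apply: (measurableT_comp (measurable_pos_powR alpha)); exact: measurable_funB.
have moment_ge0 : 0 <= gaussian_pos_moment alpha lambda :> R.
  by apply: fine_ge0; apply: expectation_ge0 => x; exact: pos_powR_ge0.
split.
- move=> n _; apply: measurable_funM => //.
  exact: (measurableT_comp mf (measurable_self_normalized_sum X theta n)).
- by move=> n w _; rewrite divr_ge0// pos_powR_ge0.
move=> P [iidX /(_ 0%N)[iX EX] [a [b [a0 cvgU]]]].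
apply: limn_esup_le => e e0.
(* A zero value of the moment makes the e-value vanish identically; a nonzero
   one certifies that the expectation under [fine] is finite. *)
have [I0|I_neq0] := eqVneq (gaussian_pos_moment alpha lambda : R) 0.
  apply: nearW => n.
  rewrite (_ : self_normalized_evalue _ _ _ _ n = fun=> 0).
    by rewrite EFin_expectation ?RintegralT_cst ?lee_fin ?addr_ge0 ?ltW//; exact: integrable_cst.
  by apply/funext => w; rewrite /self_normalized_evalue I0 invr0 mulr0.
have I0 : 0 < gaussian_pos_moment alpha lambda :> R by rewrite lt_neqAle eq_sym I_neq0.
have fi : (normal_prob (0 : R) 1).-integrable setT (EFin \o f).
  apply/integrableP; split; first exact/measurable_EFinP.
  under eq_integral do rewrite /= ger0_norm ?pos_powR_ge0//.
  rewrite ltNge leye_eq; apply/eqP => Eoo; move/eqP: I_neq0; apply.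
  by rewrite /gaussian_pos_moment unlock Eoo.
have IE : gaussian_pos_moment alpha lambda = \int[normal_prob (0 : R) 1]_x f x.
  by rewrite /gaussian_pos_moment EFin_expectation.
have eI : 0 < e * gaussian_pos_moment alpha lambda by exact: mulr_gt0.
have := limsup_expectation_le iidX iX EX a0 cvgU alpha_ge0 fi eI.
apply: filterS => n.
have ifZ := @integrable_pos_powR_self_normalized _ _ _ P X theta lambda _ alpha_ge0 n.
rewrite EFin_expectation; last exact: integrable_scaler.
rewrite (RintegralZr _ measurableT ifZ) lee_fin ler_pdivrMr// mulrDl mul1r IE.
exact.
Qed.
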